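(* Let $f$ be a smooth positive function on $\mathbb R^4$ depending only on $x_1$ and $x_2$, where $(x_1,x_2,x_3,x_4)$ are the standard coordinates, and let $g$ be the neutral metric on $\mathbb R^4$ $$g=f(dx_1\otimes dx_1+dx_2\otimes dx_2)+dx_1\otimes dx_3+dx_3\otimes dx_1+dx_2\otimes dx_4+dx_4\otimes dx_2 .$$ Then the hyperbolic twistor space $(\mathcal Z,\mathcal J_1)$ of $(\mathbb R^4,g)$ is biholomorphic to $\mathbb C^2\times H$.
   Context: $\mathbb R^4$ carries its standard orientation, for which the following $g$-orthonormal frame (with $g(\mathbf e_1,\mathbf e_1)=g(\mathbf e_2,\mathbf e_2)=1$, $g(\mathbf e_3,\mathbf e_3)=g(\mathbf e_4,\mathbf e_4)=-1$) is positively oriented: $\mathbf e_1=\frac1{\sqrt f}\frac{\partial}{\partial x_1}$, $\mathbf e_2=\frac1{\sqrt f}\frac{\partial}{\partial x_2}$, $\mathbf e_3=-\frac1{\sqrt f}\frac{\partial}{\partial x_1}+\sqrt f\frac{\partial}{\partial x_3}$, $\mathbf e_4=-\frac1{\sqrt f}\frac{\partial}{\partial x_2}+\sqrt f\frac{\partial}{\partial x_4}$. Hyperbolic twistor space of an oriented $4$-manifold $(M,g)$ with $g$ of signature $(2,2)$: the metric on $\bigwedge^2TM$ is $g(X\wedge Y,Z\wedge T)=\frac12(g(X,Z)g(Y,T)-g(X,T)g(Y,Z))$. The subbundle $\bigwedge^-\subset\bigwedge^2TM$ is the $(-1)$-eigenbundle of the Hodge star; for a positively oriented local $g$-orthonormal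 frame $\mathbf e_1,\mathbf e_2,\mathbf e_3,\mathbf e_4$ of $TM$ with $g(\mathbf e_1,\mathbf e_1)=g(\mathbf e_2,\mathbf e_2)=1$ and $g(\mathbf e_3,\mathbf e_3)=g(\mathbf e_4,\mathbf e_4)=-1$ it is spanned by $s_1=\mathbf e_1\wedge\mathbf e_2-\mathbf e_3\wedge\mathbf e_4$, $s_2=\mathbf e_1\wedge\mathbf e_3-\mathbf e_2\wedge\mathbf e_4$, $s_3=\mathbf e_1\wedge\mathbf e_4+\mathbf e_2\wedge\mathbf e_3$, with $g(s_1,s_1)=1$, $g(s_2,s_2)=g(s_3,s_3)=-1$. A bivector $\sigma$ is identified with the endomorphism $K_\sigma$ given by $g(K_\sigma X,Y)=2g(\sigma,X\wedge Y)$. The vector product on fibres of $\bigwedge^-$ is bilinear, antisymmetric, with $s_1\times s_2=s_3$, $s_2\times s_3=-s_1$, $s_3\times s_1=s_2$. Then $\pi:\mathcal Z\to M$ is $\mathcal Z=\{\sigma\in\bigwedge^-:g(\sigma,\sigma)=1\}$. The Levi-Civita connection splits $T\mathcal Z$ into horizontal and vertical parts; $X^h_\sigma$ is the horizontal lift of $X\in T_{\pi(\sigma)}M$, and the vertical space is $\mathcal V_\sigma=\{V\in\bigwedge^-_{\pi(\sigma)}:g(\sigma,V)=0\}$. The almost complex structure $\mathcal J_1$ is $\mathcal J_1X^h_\sigma=(K_\sigma X)^h_\sigma$, $\mathcal J_1V=\sigma\times V$ for $V\in\mathcal V_\sigma$. (For the metric $g$ of the claim $\mathcal J_1$ is integrable.)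 $H=\{(y_1,y_2,y_3)\in\mathbb R^3:y_1^2-y_2^2-y_3^2=1\}$ is the two-sheeted hyperboloid with complex structure $SV=y\times V$, $V\in T_yH$, where $\times$ on $\mathbb R^3$ is the bilinear antisymmetric product with $e_1\times e_2=e_3$, $e_2\times e_3=-e_1$, $e_3\times e_1=e_2$; each of its two components is biholomorphic to the unit disk in $\mathbb C$. *)

(* Defs.v *)
From HB Require Import structures.
From mathcomp Require Import all_boot all_order all_algebra.
From mathcomp Require Import all_classical all_reals all_analysis.
From mathcomp Require Import ring.

Set Implicit Arguments.
Unset Strict Implicit.
Unset Printing Implicit Defensive.

Import Order.TTheory GRing.Theory Num.Theory.
Import numFieldNormedType.Exports.

Local Open Scope classical_set_scope.
Local Open Scope ring_scope.

Fixpoint Ck (R : realType) (V W : normedModType R) (n : nat)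
    (U : set V) (F : V -> W) {struct n} : Prop :=
  match n with
  | 0 => forall x, U x -> {for x, continuous F}
  | k.+1 => (forall x, U x -> differentiable F x) /\
            (forall v : V, Ck k U ('D_v F))
  end.

(* Meant for U open and V finite-dimensional. *)
Definition smooth_on (R : realType) (V W : normedModType R)
    (U : set V) (F : V -> W) : Prop :=
  forall n, Ck n U F.

(* Manifolds are embedded submanifolds S of a finite-dimensional normed space V,
   and a map on S is represented by a map on V of which only the restriction to
   S matters; it is smooth when it extends smoothly near each point of S. *)
Definition smooth_map (R : realType) (V W : normedModType R)
    (S : set V) (F : V -> W) : Prop :=
  forall p, S p -> exists U : set V, exists G : V -> W,
    [/\ open U, U p, smooth_on U G & forall q, U q -> S q -> F q = G q].

(* v is tangent to S at p, and the differential at p of the smooth map F on S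
   sends v to w. *)
Definition tangent_map (R : realType) (V W : normedModType R)
    (S : set V) (F : V -> W) (p v : V) (w : W) : Prop :=
  exists c : R -> V,
    [/\ smooth_on [set: R] c, forall t, S (c t), c 0 = p,
        'D_1 c 0 = v & 'D_1 (F \o c) 0 = w].

(* An almost complex structure on S is given by J p v, for p in S and v tangent
   to S at p; its values elsewhere are irrelevant. *)
Definition holomorphic (R : realType) (V W : normedModType R)
    (S : set V) (J : V -> V -> V) (T : set W) (J' : W -> W -> W)
    (F : V -> W) : Prop :=
  [/\ forall p, S p -> T (F p),
      smooth_map S F &
      forall p v w, S p -> tangent_map S F p v w ->
        tangent_map S F p (J p v) (J' (F p) w)].

Definition biholomorphic (R : realType) (V W : normedModType R)
    (S : set V) (J : V -> V -> V) (T : set W) (J' : W -> W -> W) : Prop :=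
  exists F : V -> W, exists G : W -> V,
    [/\ holomorphic S J T J' F, holomorphic T J' S J G,
        forall p, S p -> G (F p) = p & forall q, T q -> F (G q) = q].

(* Tangent vectors of R^4 are rows, G : 'M_4 is the Gram matrix of a metric in
   the coordinate basis, and the bivector sum_(i,j) 1/2 s_ij d_i /\ d_j is the
   antisymmetric matrix s. *)
Definition vmetric (R : realType) (G : 'M[R]_4) (X Y : 'rV[R]_4) : R :=
  \sum_(i < 4) \sum_(j < 4) X 0 i * Y 0 j * G i j.

Definition wedge (R : realType) (X Y : 'rV[R]_4) : 'M[R]_4 :=
  X^T *m Y - Y^T *m X.

Definition bmetric (R : realType) (G s t : 'M[R]_4) : R :=
  4^-1 * \sum_(i < 4) \sum_(j < 4) \sum_(k < 4) \sum_(l < 4)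
           s i j * t k l * G i k * G j l.

Lemma wedgeE (R : realType) (X Y : 'rV[R]_4) i j :
  wedge X Y i j = X 0 i * Y 0 j - Y 0 i * X 0 j.
Proof. by rewrite !mxE !big_ord1 !mxE. Qed.

Lemma bmetric_wedge (R : realType) (G : 'M[R]_4) (X Y Z T : 'rV[R]_4) :
  bmetric G (wedge X Y) (wedge Z T) =
  2^-1 * (vmetric G X Z * vmetric G Y T - vmetric G X T * vmetric G Y Z).
Proof.
have E (A B C D : 'rV[R]_4) : vmetric G A C * vmetric G B D =
    \sum_i \sum_j \sum_k \sum_l (A 0 i * B 0 j) * (C 0 k * D 0 l) * G i k * G j l.
  rewrite /vmetric mulr_suml; apply: eq_bigr => i _.
  rewrite mulr_sumr; apply: eq_bigr => j _.
  rewrite mulr_suml; apply: eq_bigr => k _.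
  by rewrite mulr_sumr; apply: eq_bigr => l _; ring.
transitivity (4^-1 * (vmetric G X Z * vmetric G Y T - vmetric G X T * vmetric G Y Z
   - vmetric G Y Z * vmetric G X T + vmetric G Y T * vmetric G X Z)); last by field.
rewrite !E /bmetric -!sumrB -!big_split /=; congr (_ * _).
do 4!(rewrite -?sumrB -?big_split /=; apply: eq_bigr => ? _).
by rewrite !wedgeE; ring.
Qed.

Definition levi_civita_symbol (R : realType) (i j k l : 'I_4) : R :=
  \det (\matrix_(a < 4, b < 4) (b == tnth [tuple i; j; k; l] a)%:R).

(* Hodge star on bivectors for the standard orientation: a /\ (star b) is
   2 * bmetric a b times the unit positive 4-vector, the factor 2 making star
   an involution and e1 /\ e2 |-> e3 /\ e4 on positive orthonormal frames. *)
Definition hodge_star (R : realType) (G s : 'M[R]_4) : 'M[R]_4 :=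
  \matrix_(k < 4, l < 4)
    ((Num.sqrt `|\det G|)^-1 * 2^-1 *
     \sum_(i < 4) \sum_(j < 4)
       levi_civita_symbol R i j k l * (G *m s *m G^T) i j).

Definition lambda_minus (R : realType) (G : 'M[R]_4) : set 'M[R]_4 :=
  [set s | s^T = - s /\ hodge_star G s = - s].

(* The vector K_s X defined by vmetric (K_s X) Y = 2 * bmetric s (X /\ Y): its
   covariant components are obtained for Y = d_j. *)
Definition Kend (R : realType) (G s : 'M[R]_4) (X : 'rV[R]_4) : 'rV[R]_4 :=
  (\row_(j < 4) (2 * bmetric G s (wedge X (delta_mx 0 j)))) *m invmx G.

Lemma Kend_metric (R : realType) (G s : 'M[R]_4) (X Y : 'rV[R]_4) :
  G \in unitmx ->
  vmetric G (Kend G s X) Y = 2 * bmetric G s (wedge X Y).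
Proof.
move=> uG.
transitivity (\sum_j (2 * bmetric G s (wedge X (delta_mx 0 j))) * Y 0 j).
  rewrite /vmetric exchange_big /=; apply: eq_bigr => j _.
  transitivity ((Kend G s X *m G) 0 j * Y 0 j).
    by rewrite mxE mulr_suml; apply: eq_bigr => i _; rewrite mulrAC.
  by rewrite /Kend mulmxKV // mxE.
have bZ (c : 'I_4 -> R) (t : 'I_4 -> 'M[R]_4) :
    bmetric G s (\sum_m c m *: t m) = \sum_m c m * bmetric G s (t m).
  rewrite /bmetric; under [RHS]eq_bigr do rewrite mulrCA.
  rewrite -mulr_sumr; congr (_ * _).
  do 4!(under [RHS]eq_bigr do rewrite mulr_sumr; rewrite [RHS]exchange_big /=; apply: eq_bigr => ? _).
  rewrite summxE mulr_sumr !mulr_suml; apply: eq_bigr => m _; rewrite mxE; ring.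
have -> : wedge X Y = \sum_j Y 0 j *: wedge X (delta_mx 0 j).
  apply/matrixP => a b; rewrite summxE wedgeE.
  have YE c : Y 0 c = \sum_j Y 0 j * (c == j)%:R.
    by rewrite (bigD1 c) //= eqxx mulr1 big1 ?addr0 // => m /negPf; rewrite eq_sym => ->; rewrite mulr0.
  rewrite (YE a) (YE b) mulr_sumr mulr_suml -sumrB; apply: eq_bigr => j _.
  by rewrite [RHS]mxE wedgeE !mxE !eqxx /=; ring.
by rewrite bZ mulr_sumr; apply: eq_bigr => j _; ring.
Qed.

(* The rows of E are e1, e2, e3, e4. *)
Definition sframe (R : realType) (E : 'M[R]_4) (i : 'I_3) : 'M[R]_4 :=
  tnth [tuple wedge (row 0 E) (row 1 E) - wedge (row 2 E) (row 3 E);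
              wedge (row 0 E) (row 2 E) - wedge (row 1 E) (row 3 E);
              wedge (row 0 E) (row 3 E) + wedge (row 1 E) (row 2 E)] i.

Definition cross3 (R : realType) (y w : 'rV[R]_3) : 'rV[R]_3 :=
  \row_(i < 3)
    tnth [tuple - (y 0 1 * w 0 2 - y 0 2 * w 0 1);
                y 0 2 * w 0 0 - y 0 0 * w 0 2;
                y 0 0 * w 0 1 - y 0 1 * w 0 0] i.

Definition scoord (R : realType) (G E s : 'M[R]_4) : 'rV[R]_3 :=
  \row_(i < 3) (bmetric G s (sframe E i) /
                bmetric G (sframe E i) (sframe E i)).

Definition vprod (R : realType) (G E s t : 'M[R]_4) : 'M[R]_4 :=
  \sum_(i < 3) cross3 (scoord G E s) (scoord G E t) 0 i *: sframe E i.

Definition christoffel (R : realType) (g : 'rV[R]_4 -> 'M[R]_4) (x : 'rV[R]_4)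
    (k i j : 'I_4) : R :=
  2^-1 * \sum_(l < 4) invmx (g x) k l *
    ('D_(delta_mx 0 i) (fun y => g y j l) x
     + 'D_(delta_mx 0 j) (fun y => g y i l) x
     - 'D_(delta_mx 0 l) (fun y => g y i j) x).

Definition conn_mx (R : realType) (g : 'rV[R]_4 -> 'M[R]_4) (x X : 'rV[R]_4) :
    'M[R]_4 :=
  \matrix_(i < 4, j < 4) \sum_(k < 4) X 0 k * christoffel g x i k j.

(* With A = conn_mx g x X, the Levi-Civita derivative of a bivector field s is
   ds(X) + A s + s A^T; the lift is the velocity of a parallel bivector. *)
Definition hlift (R : realType) (g : 'rV[R]_4 -> 'M[R]_4)
    (p : 'rV[R]_4 * 'M[R]_4) (X : 'rV[R]_4) : 'rV[R]_4 * 'M[R]_4 :=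
  (X, - (conn_mx g p.1 X *m p.2 + p.2 *m (conn_mx g p.1 X)^T)).

Definition twistor_space (R : realType) (g : 'rV[R]_4 -> 'M[R]_4) :
    set ('rV[R]_4 * 'M[R]_4) :=
  [set p | lambda_minus (g p.1) p.2 /\ bmetric (g p.1) p.2 p.2 = 1].

(* E is a field of positively oriented g-orthonormal frames. A tangent vector w
   is hlift w.1 plus the vertical vector w.2 - (hlift w.1).2. *)
Definition J1 (R : realType) (g E : 'rV[R]_4 -> 'M[R]_4)
    (p w : 'rV[R]_4 * 'M[R]_4) : 'rV[R]_4 * 'M[R]_4 :=
  hlift g p (Kend (g p.1) p.2 w.1)
  + (0, vprod (g p.1) (E p.1) p.2 (w.2 - (hlift g p w.1).2)).

Definition neutral_metric (R : realType) (f : 'rV[R]_4 -> R) (x : 'rV[R]_4) :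
    'M[R]_4 :=
  block_mx (f x)%:M 1%:M 1%:M 0 : 'M[R]_(2 + 2).

Definition neutral_frame (R : realType) (f : 'rV[R]_4 -> R) (x : 'rV[R]_4) :
    'M[R]_4 :=
  block_mx (Num.sqrt (f x))^-1%:M 0
           (- (Num.sqrt (f x))^-1)%:M (Num.sqrt (f x))%:M : 'M[R]_(2 + 2).

Lemma neutral_frameP (R : realType) (f : 'rV[R]_4 -> R) (x : 'rV[R]_4) :
  0 < f x ->
  neutral_frame f x *m neutral_metric f x *m (neutral_frame f x)^T =
    (block_mx 1%:M 0 0 (- 1)%:M : 'M[R]_(2 + 2)) /\ \det (neutral_frame f x) = 1.
Proof.
move=> fx; rewrite /neutral_frame /neutral_metric.
have r0 : Num.sqrt (f x) != 0 by rewrite sqrtr_eq0 -ltNge.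
have rr : f x = Num.sqrt (f x) ^+ 2 by rewrite sqr_sqrtr // ltW.
set r := Num.sqrt _ in r0 rr *; split; last first.
  by rewrite (@det_lblock _ 2 2) !det_scalar -exprMn mulVf // expr1n.
rewrite rr (@tr_block_mx _ 2 2 2 2) !(@mulmx_block _ 2 2 2 2 2 2) !tr_scalar_mx trmx0.
rewrite !mulmx1 ?(mul0mx, mulmx0, addr0, add0r) -!scalar_mxM -!raddfD /= -!scalar_mxM -?raddfD /=.
have Z (a : R) : a = 0 -> a%:M = 0 :> 'M[R]_2 by move=> ->; rewrite raddf0.
congr (@block_mx _ 2 2 2 2 _ _ _ _); try (apply: Z; by field).
  by congr _%:M; field.
by congr _%:M; field.
Qed.

(* The complex number a + ib is the pair (a, b). *)
Definition imul (R : realType) (z : R * R) : R * R := (- z.2, z.1).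

Definition hyperboloid (R : realType) : set 'rV[R]_3 :=
  [set y | y 0 0 ^+ 2 - y 0 1 ^+ 2 - y 0 2 ^+ 2 = 1].

Definition C2xH (R : realType) : set (((R * R) * (R * R)) * 'rV[R]_3) :=
  [set q | hyperboloid q.2].

Definition JC2xH (R : realType) (q w : ((R * R) * (R * R)) * 'rV[R]_3) :
    ((R * R) * (R * R)) * 'rV[R]_3 :=
  ((imul w.1.1, imul w.1.2), cross3 q.2 w.2).

(* Main.v *)
(* Along a parallel frame s_1, s_2, s_3 of the anti-self-dual bivectors the twistor
   space becomes R^4 x H, with J (X, Y) = (K_y X, y x Y).  On a sheet of H put
   zeta = i (y_2 + i y_3) / (1 + y_1), z = x_1 + i x_2, W = x_3 + i x_4 (on the sheet
   y_1 < 0, first conjugate z and W and replace y by (- y_1, y_2, - y_3)).  Then zeta,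
   u = z + zeta conj(z) and v = W - zeta conj(W) - 2 zeta k are holomorphic as soon as
   k(z, zeta) is holomorphic in zeta, |zeta| < 1, and solves
   (1 - zeta) d_1 k + i (1 + zeta) d_2 k = f.
   Since |zeta| < 1 this map is a bijection onto C^2 x H with an explicit smooth inverse,
   and the inverse of a smooth holomorphic bijection is holomorphic if it is smooth.

   The equation for k is solved for compactly supported data by convolution with
   1 / (w + zeta conj(w)).  A general f is cut into annular pieces; before solving, the
   piece r is multiplied by a power W^(N_r) of a function of the two points that is 1 on
   the diagonal, annihilated by the operator in the first point and of modulus < 1 when the
   second point is far from the first, so that the solutions become summable. *)

Require Import Defs.
From HB Require Import structures.
From mathcomp Require Import all_boot all_order all_algebra.
From mathcomp Require Import all_classical all_reals all_analysis.
From mathcomp Require Import measurable_realfun zify ring lra complex.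
Set Implicit Arguments.
Unset Strict Implicit.
Unset Printing Implicit Defensive.
Import Order.TTheory GRing.Theory Num.Theory.
Import numFieldNormedType.Exports.
Local Open Scope classical_set_scope.
Local Open Scope complex_scope.
Local Open Scope ring_scope.

(** * Smooth maps *)

Section Calculus.
Context {R : realType}.
Implicit Types V W : normedModType R.

(** The equation is 2 (d/dconj(z) - zeta d/dz) k = f, elliptic for each zeta of the disk; at fixed
    zeta its operator annihilates u = z + zeta conj(z) and all polynomials in u. The obstacle is
    that f may grow arbitrarily while k has to be smooth and holomorphic in zeta over the whole
    disk. A Mittag-Leffler argument would correct the solution of each piece by an approximating
    polynomial in u, chosen holomorphically in zeta. Here the correction is built into the
    integrand: W is affine in u, so that its powers keep both the equation and the holomorphy, and
    the approximation theorem is replaced by the inequality [Wt_small], uniform on compact parts of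
    the disk. Two definitions shape the rest. Holomorphy is tested on velocities of curves that stay
    on the manifold, so that each J v must be realized by such a curve; [hyperboloid_arc] provides
    it. Smoothness is a condition on all iterated directional derivatives, which is checked by
    exhibiting a class of functions closed under derivation instead of computing higher
    derivatives. *)

Definition dvs V W (vs : seq V) (F : V -> W) : V -> W :=
  foldl (fun G v => 'D_v G) F vs.

(* Smoothness on [U] in a form suited to the coinduction principle [sm_coind]. *)
Definition sm V W (U : set V) (F : V -> W) :=
  forall vs x, U x -> differentiable (dvs vs F) x.

Lemma sm_derive V W (U : set V) (F : V -> W) v : sm U F -> sm U ('D_v F).
Proof. by move=> sF vs x Ux; exact: (sF (v :: vs)). Qed.

Lemma sm_dvs V W (U : set V) (F : V -> W) vs : sm U F -> sm U (dvs vs F).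
Proof. by elim: vs F => //= v vs IH F sF; apply: IH; exact: sm_derive. Qed.

Lemma sm_differentiable V W (U : set V) (F : V -> W) x :
  sm U F -> U x -> differentiable F x.
Proof. by move=> sF Ux; exact: (sF [::]). Qed.

Lemma smooth_onP V W (U : set V) (F : V -> W) : smooth_on U F <-> sm U F.
Proof.
split=> [sF vs x Ux|sF n].
  elim: vs F sF => [|v vs IH] F sF /=; first by have [/(_ x Ux)] := sF 1.
  by apply: IH => n; have [_ /(_ v)] := sF n.+1.
elim: n F sF => [|n IH] F sF /=.
  by move=> x Ux; apply: differentiable_continuous; exact: sm_differentiable sF _.
split=> [x|v]; first exact: sm_differentiable.
by apply: IH; exact: sm_derive.
Qed.

(** Uniqueness of the differential lets a candidate be tested by a plain epsilon inequality. *)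
Lemma differentiable_ex V W (F : V -> W) x (df : {linear V -> W}) :
  continuous df ->
  (forall e, 0 < e -> \forall h \near (0 : V), `|F (h + x) - F x - df h| <= e * `|h|) ->
  differentiable F x.
Proof.
move=> cdf H.
have E : F \o shift x = cst (F x) + df +o_ 0 id.
  apply/eqaddoP => e e0; near=> h.
  rewrite /= -[X in `|X|]/(F (h + x) - (F x + df h)) opprD addrA.
  by near: h; exact: H.
have D := diff_unique cdf E.
by apply/diff_locallyP; rewrite D; split.
Unshelve. all: by end_near. Qed.

Lemma differentiable_le V W (F : V -> W) x e : differentiable F x -> 0 < e ->
  \forall h \near (0 : V), `|F (h + x) - F x - 'd F x h| <= e * `|h|.
Proof.
move=> /diff_locally /eqaddoP H e0; near=> h.
by rewrite -addrA -opprD; near: h; exact: H.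
Unshelve. all: by end_near. Qed.

Lemma near_eq_differentiable V W (F G : V -> W) x :
  (\near x, F x = G x) -> differentiable F x -> differentiable G x.
Proof.
move=> FG dF; apply: (@differentiable_ex _ _ _ _ ('d F x)).
  exact: diff_continuous.
move=> e e0; have := differentiable_le dF e0.
rewrite (nbhs_singleton FG).
have {}FG : \forall h \near (0 : V), F (h + x) = G (h + x).
  by move: FG; rewrite (near_shift 0 x); apply: filterS => h /=; rewrite subr0.
by move=> H; apply: filterS2 FG H => h ->.
Qed.

Lemma open_near V (U : set V) x (P : V -> Prop) :
  open U -> U x -> (forall y, U y -> P y) -> \near x, P x.
Proof. by move=> oU Ux H; apply: filterS H _; exact: open_nbhs_nbhs. Qed.

Lemma derive_eq_on V W (U : set V) (F G : V -> W) v :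
  open U -> (forall x, U x -> F x = G x) -> forall x, U x -> 'D_v F x = 'D_v G x.
Proof. by move=> oU FG x Ux; apply: near_eq_derive; exact: open_near FG. Qed.

Lemma dvs_eq_on V W (U : set V) (F G : V -> W) vs :
  open U -> (forall x, U x -> F x = G x) -> forall x, U x -> dvs vs F x = dvs vs G x.
Proof.
by move=> oU; elim: vs F G => //= v vs IH F G FG x Ux; apply: IH => //; exact: derive_eq_on.
Qed.

Lemma sm_eq_on V W (U : set V) (F G : V -> W) :
  open U -> (forall x, U x -> F x = G x) -> sm U F -> sm U G.
Proof.
move=> oU FG sF vs x Ux; apply: near_eq_differentiable (sF vs x Ux).
by apply: (open_near oU Ux) => y Uy; exact: (dvs_eq_on _ oU).
Qed.

Lemma sm_subset V W (U U' : set V) (F : V -> W) : U' `<=` U -> sm U F -> sm U' F.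
Proof. by move=> UU sF vs x /UU; exact: sF. Qed.

Lemma sm_local V W (U : set V) (F : V -> W) :
  (forall x, U x -> exists2 A : set V, A x & sm A F) -> sm U F.
Proof. by move=> H vs x /H[A Ax]; exact. Qed.

(** Induction on the list of directions, the current function being replaced by a member of [P] that
    equals it on [U]; equality on [U] survives derivation because [U] is open. Each closure property
    of smooth functions then only requires a stable class [P]. *)
Lemma sm_coind V W (U : set V) (P : (V -> W) -> Prop) : open U ->
  (forall F, P F -> forall x, U x -> differentiable F x) ->
  (forall F v, P F -> exists2 G, P G & forall x, U x -> 'D_v F x = G x) ->
  forall F, P F -> sm U F.
Proof.
move=> oU P1 P2 F PF vs.
suff H G : P G -> (forall x, U x -> F x = G x) -> forall x, U x -> differentiable (dvs vs F) x.
  exact: (H F).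
elim: vs F {PF} G => [|v vs IH] F G PG FG x Ux /=.
  by apply: (near_eq_differentiable _ (P1 _ PG x Ux)); apply: (open_near oU Ux) => y /FG.
have [H PH GH] := P2 _ v PG.
by apply: (IH _ H) => // y Uy; rewrite (derive_eq_on _ oU FG) // GH.
Qed.

Lemma sm_cst V W (U : set V) (a : W) : open U -> sm U (cst a).
Proof.
move=> oU; apply: (@sm_coind _ _ _ (fun F => exists a, F = cst a)) => //; last by exists a.
- by move=> F [b ->] x _; exact: differentiable_cst.
- by move=> F v [b ->]; exists (cst 0); [exists 0|move=> x _; rewrite derive_cst].
Qed.

Lemma sm_linear V W (U : set V) (f : {linear V -> W}) : open U -> continuous f -> sm U f.
Proof.
move=> oU cf; apply: (@sm_coind _ _ _ (fun F => F = f \/ exists a, F = cst a)) => //; last by left.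
- by move=> F [->|[b ->]] x _; [exact: linear_differentiable|exact: differentiable_cst].
- move=> F v [->|[b ->]]; last by exists (cst 0); [right; exists 0|move=> x _; rewrite derive_cst].
  exists (cst (f v)); first by right; exists (f v).
  by move=> x _; rewrite deriveE; [rewrite diff_lin|exact: linear_differentiable].
Qed.

Lemma smD V W (U : set V) (F G : V -> W) : open U -> sm U F -> sm U G ->
  sm U (fun x => F x + G x).
Proof.
move=> oU sF sG.
apply: (@sm_coind _ _ _ (fun H => exists F G, [/\ H = F \+ G, sm U F & sm U G])) => //;
  last by exists F, G.
- move=> _ [A [B [-> sA sB]]] x Ux.
  by apply: differentiableD; [exact: sm_differentiable sA Ux|exact: sm_differentiable sB Ux].
- move=> _ v [A [B [-> sA sB]]]; exists ('D_v A \+ 'D_v B).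
    by exists ('D_v A), ('D_v B); split => //; exact: sm_derive.
  by move=> x Ux; rewrite deriveD //; apply: diff_derivable;
    [exact: sm_differentiable sA Ux|exact: sm_differentiable sB Ux].
Qed.

(** Finite sums of products of smooth functions: the class that the Leibniz rule leaves stable,
    without indexing the terms of an iterated derivative. *)
Inductive mul_alg V (U : set V) : (V -> R) -> Prop :=
| MulAlg (F G : V -> R) : sm U F -> sm U G -> mul_alg U (fun x => F x * G x)
| AddAlg (A B : V -> R) : mul_alg U A -> mul_alg U B -> mul_alg U (fun x => A x + B x).

Lemma smM V (U : set V) (F G : V -> R) : open U -> sm U F -> sm U G ->
  sm U (fun x => F x * G x).
Proof.
move=> oU sF sG.
have D H : mul_alg U H -> forall x, U x -> differentiable H x.
  elim=> [A B sA sB|A B _ dA _ dB] x Ux.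
    by apply: differentiableM; [exact: sm_differentiable sA Ux|exact: sm_differentiable sB Ux].
  by apply: differentiableD; [exact: dA|exact: dB].
apply: (@sm_coind _ _ _ (mul_alg U)) => //; last exact: MulAlg.
move=> H v; elim=> {H} [A B sA sB|A B mA [A' mA' AA'] mB [B' mB' BB']].
  exists (fun x => A x * 'D_v B x + B x * 'D_v A x).
    by apply: AddAlg; apply: MulAlg => //; exact: sm_derive.
  by move=> x Ux; rewrite deriveM //; apply: diff_derivable;
    [exact: sm_differentiable sA Ux|exact: sm_differentiable sB Ux].
exists (fun x => A' x + B' x); first exact: AddAlg.
by move=> x Ux; rewrite deriveD ?AA' ?BB' //; apply: diff_derivable; exact: D.
Qed.

End Calculus.

(** * Finite dimension and the C^1 criterion of differentiability *)

Section FinDim.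
Context {R : realType}.
Implicit Types V W : normedModType R.

(** A finite spanning family with continuous linear coordinates: the form used for telescoping
    increments and for expanding the chain rule. *)
Definition findim W := exists n (b : 'I_n -> W) (c : 'I_n -> {linear W -> R}),
  (forall i, continuous (c i)) /\ forall w, w = \sum_i c i w *: b i.

Lemma findim_R : findim R.
Proof.
exists 1, (fun=> 1), (fun=> idfun); split=> [i|w]; first by move=> x; exact: cvg_id.
by rewrite big_ord1 /= /GRing.scale /= mulr1.
Qed.

Lemma findim_prod V W : findim V -> findim W -> findim (V * W)%type.
Proof.
move=> [n [b [c [cc cE]]]] [m [b' [c' [cc' cE']]]].
pose B (i : 'I_(n + m)) : V * W :=
  match fintype.split i with inl j => (b j, 0) | inr j => (0, b' j) end.
pose fstl : {linear (V * W)%type -> V} := fst.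
pose sndl : {linear (V * W)%type -> W} := snd.
pose C (i : 'I_(n + m)) : {linear (V * W)%type -> R} :=
  match fintype.split i with inl j => c j \o fstl | inr j => c' j \o sndl end.
exists (n + m)%N, B, C; split=> [i|[v w]].
  rewrite /C; case: fintype.split => j x.
    by apply: (@continuous_comp _ _ _ fst (c j)); [exact: cvg_fst|exact: cc].
  by apply: (@continuous_comp _ _ _ snd (c' j)); [exact: cvg_snd|exact: cc'].
rewrite big_split_ord /=.
under eq_bigr do rewrite /C /B (unsplitK (inl _)) /=.
under [X in _ + X]eq_bigr do rewrite /C /B (unsplitK (inr _)) /=.
have E1 k (g : 'I_k -> R) (u : 'I_k -> V) :
    \sum_i g i *: (u i, 0 : W) = (\sum_i g i *: u i, 0).
  elim/big_rec2: _ => [//|i y1 _ _ ->].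
  by apply: injective_projections; rewrite /= ?scaler0 ?addr0.
have E2 k (g : 'I_k -> R) (u : 'I_k -> W) :
    \sum_i g i *: (0 : V, u i) = (0, \sum_i g i *: u i).
  elim/big_rec2: _ => [//|i y1 _ _ ->].
  by apply: injective_projections; rewrite /= ?scaler0 ?addr0.
by rewrite E1 E2 -cE -cE'; apply: injective_projections; rewrite /= ?addr0 ?add0r.
Qed.

Lemma findim_mx m n : findim 'M[R]_(m, n).
Proof.
pose B (k : 'I_#|{: 'I_m * 'I_n}|) : 'M[R]_(m, n) :=
  delta_mx (enum_val k).1 (enum_val k).2.
have cl (i : 'I_m) (j : 'I_n) : linear (fun M : 'M[R]_(m, n) => M i j : R).
  by move=> a M N; rewrite !mxE.
pose cE i j : {linear 'M[R]_(m, n) -> R} :=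
  HB.pack (fun M : 'M[R]_(m, n) => M i j : R) (GRing.isLinear.Build _ _ _ _ _ (cl i j)).
exists #|{: 'I_m * 'I_n}|, B, (fun k => cE (enum_val k).1 (enum_val k).2).
split=> [k|M]; first exact: coord_continuous.
rewrite [LHS](matrix_sum_delta M) pair_big /= (reindex (@enum_val _ predT)) /=; last first.
  by apply: onW_bij; exact: enum_val_bij.
by apply: eq_bigr => i _.
Qed.

Lemma is_derive_line V W (F : V -> W) y v t : derivable F (y + t *: v) v ->
  is_derive (t : R) 1 (fun t : R => F (y + t *: v)) ('D_v F (y + t *: v)).
Proof.
have E : (fun h : R => h^-1 *: (((fun t : R => F (y + t *: v)) \o shift t) (h *: 1) - F (y + t *: v)))
    = (fun h => h^-1 *: ((F \o shift (y + t *: v)) (h *: v) - F (y + t *: v))).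
  apply/funext => h /=; rewrite [h%:A]mulr1 scalerDl.
  by rewrite addrCA.
by move=> D; apply: DeriveDef; rewrite /derivable /derive E.
Qed.

(** The mean value theorem along a line, for [s] of either sign, since it is applied to coordinates
    of an arbitrary small increment. *)
Lemma mvt_line V (F : V -> R) y v (s : R) :
  (forall t : R, `|t| <= `|s| -> derivable F (y + t *: v) v) ->
  exists2 t : R, `|t| <= `|s| & F (y + s *: v) - F y = s * 'D_v F (y + t *: v).
Proof.
move=> H.
pose phi t := F (y + t *: v).
have D (t : R) : `|t| <= `|s| -> is_derive t 1 phi ('D_v F (y + t *: v)).
  by move=> ts; exact/is_derive_line/H.
have phi0 : phi 0 = F y by rewrite /phi scale0r addr0.
have C a b : (forall t, t \in `[a, b] -> `|t| <= `|s|) -> {within `[a, b], continuous phi}.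
  move=> ab; apply: derivable_within_continuous => t /ab ts.
  by have [] := D t ts.
have [s0|s0] := leP 0 s.
  have ab t : t \in `[0, s] -> `|t| <= `|s|.
    by rewrite in_itv /= => /andP[t0 ts]; rewrite !ger0_norm.
  have [t] := @MVT_segment _ phi (fun t => 'D_v F (y + t *: v)) 0 s s0
    (fun t ts => D t (ab t (subset_itv_oo_cc ts))) (C _ _ ab).
  by move=> /ab ts; rewrite phi0 subr0 mulrC; exists t.
have ab t : t \in `[s, 0] -> `|t| <= `|s|.
  by rewrite in_itv /= => /andP[t0 ts]; rewrite !ler0_norm ?lerN2 // ltW.
have [t] := @MVT_segment _ phi (fun t => 'D_v F (y + t *: v)) s 0 (ltW s0)
    (fun t ts => D t (ab t (subset_itv_oo_cc ts))) (C _ _ ab).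
move=> /ab ts; rewrite phi0 sub0r mulrN => E; exists t => //.
by rewrite mulrC -[RHS]opprK -E opprB.
Qed.

(* Frechet differentiability is obtained by telescoping along the coordinates,
   each increment being handled by the mean value theorem. *)
Lemma C1_differentiable V (U : set V) (F : V -> R) : findim V -> open U ->
  (forall v x, U x -> derivable F x v) ->
  (forall v x, U x -> {for x, continuous ('D_v F)}) ->
  forall x, U x -> differentiable F x.
Proof.
move=> [n [b [c [cc cE]]]] oU dF cF x Ux.
pose df (h : V) : R := \sum_i c i h * 'D_(b i) F x.
have ldf : linear df.
  move=> a u v; rewrite /df scaler_sumr -big_split /=; apply: eq_bigr => i _.
  by rewrite linearP /= mulrDl /GRing.scale /= mulrA.
pose dfL : {linear V -> R} := HB.pack df (GRing.isLinear.Build _ _ _ _ _ ldf).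
have cdf : continuous df.
  move=> h; rewrite /df; apply: (@cvg_big _ _ _ _ xpredT) => //.
    by apply: add_continuous.
  by move=> i _; apply: cvgM; [exact: cc|exact: cvg_cst].
apply: (@differentiable_ex _ _ _ _ _ dfL) => // e e0.
pose P (k : nat) (h : V) := \sum_(i < n | (i < k)%N) c i h *: b i.
pose Q (k : nat) (h : V) := \sum_(i < n | (i < k)%N) c i h * 'D_(b i) F x.
have cP k : continuous (P k).
  move=> h; rewrite /P; apply: (@cvg_big _ _ _ _ (fun i : 'I_n => (i < k)%N)) => //.
    by apply: add_continuous.
  by move=> i _; apply: cvgZr_tmp; exact: cc.
suff H k : (k <= n)%N -> forall e, 0 < e ->
    \forall h \near (0 : V), `|F (x + P k h) - F x - Q k h| <= e * `|h|.
  have PnE h : P n h = h by rewrite /P [RHS]cE; apply: eq_bigl => i; rewrite ltn_ord.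
  have QnE h : Q n h = df h by rewrite /Q; apply: eq_bigl => i; rewrite ltn_ord.
  have := H n (leqnn n) e e0; apply: filterS => h.
  by rewrite PnE QnE (addrC x).
elim: k => {e e0} [|k IH] kn e e0.
  near=> h; rewrite /P /Q !big_pred0 // addr0 subrr subr0 normr0.
  by rewrite mulr_ge0 // ltW.
pose i0 := Ordinal kn.
have PS h : P k.+1 h = P k h + c i0 h *: b i0.
  rewrite /P (bigD1 i0) //= addrC; congr (_ + _); apply: eq_bigl => i.
  by rewrite ltnS ltn_neqAle andbC.
have QS h : Q k.+1 h = Q k h + c i0 h * 'D_(b i0) F x.
  rewrite /Q (bigD1 i0) //= addrC; congr (_ + _); apply: eq_bigl => i.
  by rewrite ltnS ltn_neqAle andbC.
(* [M] is the operator norm bound of the coordinate: an error e / (2 M) on the partial derivative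
   costs at most (e / 2) |h|, the other half being left to the induction hypothesis. *)
have [M M0 cM] : exists2 M, 0 < M & forall h, `|c i0 h| <= M * `|h|.
  by have [M [? ?]] := linear_lipschitz (cc i0); exists M.
have eM : 0 < e / (2 * M) by rewrite divr_gt0 // mulr_gt0.
have /nbhs_ballP[d /= d0 dU] : nbhs x [set y | U y /\ `|'D_(b i0) F x - 'D_(b i0) F y| <= e / (2 * M)].
  apply: filterI; first exact: open_nbhs_nbhs.
  by have /cvgrPdist_le := cF (b i0) x Ux; exact.
have N1 : \forall h \near (0 : V), `|P k h| < d / 2.
  have := cP k 0; rewrite /continuous_at.
  have -> : P k 0 = 0 by rewrite /P big1 // => i _; rewrite linear0 scale0r.
  by move=> /cvgr0Pnorm_lt; apply; rewrite divr_gt0.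
have N2 : \forall h \near (0 : V), `|c i0 h *: b i0| < d / 2.
  have : (fun h => c i0 h *: b i0) h @[h --> (0 : V)] --> (0 : V).
    rewrite -[X in _ --> X](scale0r (b i0)) -(linear0 (c i0)).
    by apply: cvgZr_tmp; exact: cc.
  by move=> /cvgr0Pnorm_lt; apply; rewrite divr_gt0.
have e20 : 0 < e / 2 by rewrite divr_gt0.
have N3 := IH (ltnW kn) _ e20.
near=> h.
have inB t : `|t| <= `|c i0 h| -> ball x d (x + P k h + t *: b i0).
  move=> tc; rewrite -ball_normE /= -addrA opprD addrA subrr sub0r normrN.
  apply: le_lt_trans (ler_normD _ _) _; rewrite [d]splitr ltrD //; first by near: h.
  apply: le_lt_trans (_ : `|c i0 h *: b i0| < _); last by near: h.
  by rewrite !normrZ ler_wpM2r.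
rewrite PS QS addrA.
have [|t tc E] := @mvt_line _ F (x + P k h) (b i0) (c i0 h).
  by move=> t tc; apply: dF; have [] := dU _ (inB t tc).
have -> : F (x + P k h + c i0 h *: b i0) - F x - (Q k h + c i0 h * 'D_(b i0) F x)
   = (F (x + P k h) - F x - Q k h)
    + c i0 h * ('D_(b i0) F (x + P k h + t *: b i0) - 'D_(b i0) F x).
  by rewrite mulrBr -E; ring.
apply: le_trans (ler_normD _ _) _; rewrite [e in X in _ <= X]splitr mulrDl lerD //.
  by near: h.
rewrite normrM distrC; have [_ D2] := dU _ (inB t tc).
apply: le_trans (ler_pM _ _ (cM h) D2) _ => //.
by rewrite mulrC -mulrA [X in _ <= X]mulrC le_eqVlt; apply/orP; left; apply/eqP; field; rewrite gt_eqF.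
Unshelve. all: by end_near. Qed.
End FinDim.

(** * Composition and elementary smooth functions *)

Section Composition.
Context {R : realType}.
Implicit Types V W Z : normedModType R.

Lemma sm_derivable V W (U : set V) (F : V -> W) x v : sm U F -> U x -> derivable F x v.
Proof. by move=> sF Ux; apply: diff_derivable; exact: sm_differentiable sF Ux. Qed.

Lemma sm_continuous V W (U : set V) (F : V -> W) x : sm U F -> U x -> {for x, continuous F}.
Proof. by move=> sF Ux; apply: differentiable_continuous; exact: sm_differentiable sF Ux. Qed.

Lemma derive_lincomp V W Z (L : {linear W -> Z}) (F : V -> W) x v : continuous L ->
  differentiable F x -> 'D_v (L \o F) x = L ('D_v F x).
Proof.
move=> cL dF; have dL := linear_differentiable (F x) cL.
have dLF : differentiable (L \o F) x by exact: differentiable_comp.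
rewrite (deriveE _ dLF) (diff_comp dF dL) [RHS]/= (deriveE _ dF).
by rewrite /= (diff_lin (F x) cL).
Qed.

Lemma sm_lincomp V W Z (U : set V) (L : {linear W -> Z}) (F : V -> W) :
  open U -> continuous L -> sm U F -> sm U (fun x => L (F x)).
Proof.
move=> oU cL sF.
apply: (@sm_coind _ _ _ _ (fun H => exists2 F : V -> W, H = L \o F & sm U F)) => //; last by exists F.
- move=> _ [G -> sG] x Ux; apply: differentiable_comp; first exact: sm_differentiable sG Ux.
  exact: linear_differentiable.
- move=> _ v [G -> sG]; exists (L \o 'D_v G); first by exists ('D_v G) => //; exact: sm_derive.
  by move=> x Ux; rewrite derive_lincomp //; exact: sm_differentiable sG Ux.
Qed.

Lemma sm_sum V W (U : set V) n (F : 'I_n -> V -> W) : open U ->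
  (forall i, sm U (F i)) -> sm U (fun x => \sum_i F i x).
Proof.
move=> oU; elim: n F => [|n IH] F sF.
  by apply: sm_eq_on (sm_cst 0 oU) => // x _; rewrite big_ord0.
apply: (@sm_eq_on _ _ _ _ (fun x => F ord0 x + \sum_i F (lift ord0 i) x)) => //.
  by move=> x _; rewrite big_ord_recl.
by apply: smD => //; exact: IH.
Qed.

Lemma scalel_linear W (a : W) : linear (fun r : R => r *: a).
Proof. by move=> k x y; rewrite scalerDl scalerA. Qed.
Definition mklin V W (f : V -> W) (lf : linear f) : {linear V -> W} :=
  HB.pack f (GRing.isLinear.Build _ _ _ _ _ lf).

Lemma sm_scalel V W (U : set V) (F : V -> R) (a : W) : open U -> sm U F ->
  sm U (fun x => F x *: a).
Proof.
move=> oU sF; apply: (@sm_lincomp _ _ _ _ (mklin (scalel_linear a))) => //.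
by move=> x; apply: cvgZr_tmp; exact: cvg_id.
Qed.

Lemma sm_pair V W Z (U : set V) (F : V -> W) (G : V -> Z) : open U ->
  sm U F -> sm U G -> sm U (fun x => (F x, G x)).
Proof.
move=> oU sF sG.
have l1 : linear (fun w : W => (w, 0) : (W * Z)%type).
  by move=> a x y; apply: injective_projections; rewrite /= ?scaler0 ?addr0.
have l2 : linear (fun z : Z => (0, z) : (W * Z)%type).
  by move=> a x y; apply: injective_projections; rewrite /= ?scaler0 ?addr0.
apply: (@sm_eq_on _ _ _ _ (fun x => mklin l1 (F x) + mklin l2 (G x))) => //.
  by move=> x _; apply: injective_projections; rewrite /= ?addr0 ?add0r.
apply: smD => //; apply: sm_lincomp => //.
  by move=> x; apply: cvg_pair; [exact: cvg_id|exact: cvg_cst].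
by move=> x; apply: cvg_pair; [exact: cvg_cst|exact: cvg_id].
Qed.

Lemma sm_fst V W Z (U : set V) (F : V -> W * Z) : open U -> sm U F -> sm U (fun x => (F x).1).
Proof.
by move=> oU sF; apply: (@sm_lincomp _ _ _ _ fst) => // x; exact: cvg_fst.
Qed.

Lemma sm_snd V W Z (U : set V) (F : V -> W * Z) : open U -> sm U F -> sm U (fun x => (F x).2).
Proof.
by move=> oU sF; apply: (@sm_lincomp _ _ _ _ snd) => // x; exact: cvg_snd.
Qed.

Lemma sm_id V (U : set V) : open U -> sm U id.
Proof. by move=> oU; apply: (@sm_linear _ _ _ _ idfun) => // x; exact: cvg_id. Qed.

Lemma sm_entry V m n (U : set V) (F : V -> 'M[R]_(m, n)) i j : open U -> sm U F ->
  sm U (fun x => F x i j).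
Proof.
move=> oU sF.
have l : linear (fun M : 'M[R]_(m, n) => M i j : R) by move=> a M N; rewrite !mxE.
by apply: (@sm_lincomp _ _ _ _ (mklin l)) => //; exact: coord_continuous.
Qed.

Lemma sm_mx V m n (U : set V) (F : V -> 'M[R]_(m, n)) : open U ->
  (forall i j, sm U (fun x => F x i j)) -> sm U F.
Proof.
move=> oU sF.
apply: (@sm_eq_on _ _ _ _ (fun x => \sum_i \sum_j F x i j *: delta_mx i j)) => //.
  by move=> x _; rewrite -matrix_sum_delta.
by apply: sm_sum => // i; apply: sm_sum => // j; exact: sm_scalel.
Qed.

(** Sums of terms phi (G o F), stable under derivation: the chain rule turns G into its partial
    derivatives and multiplies phi by coordinates of the derivative of [F], which are smooth. *)
Inductive comp_alg V W (U : set V) (T : set W) (F : V -> W) : (V -> R) -> Prop :=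
| CompMul (phi : V -> R) (G : W -> R) : sm U phi -> sm T G ->
    comp_alg U T F (fun x => phi x * G (F x))
| CompAdd (A B : V -> R) : comp_alg U T F A -> comp_alg U T F B ->
    comp_alg U T F (fun x => A x + B x).

Lemma comp_alg_sum V W (U : set V) (T : set W) (F : V -> W) n (A : 'I_n -> V -> R) :
  open U -> open T -> (forall i, comp_alg U T F (A i)) ->
  comp_alg U T F (fun x => \sum_i A i x).
Proof.
move=> oU oT; elim: n A => [|n IH] A cA.
  have -> : (fun x => \sum_i A i x) = (fun x => (cst 0 : V -> R) x * (cst 0 : W -> R) (F x)).
    by apply/funext => x; rewrite big_ord0 /= mulr0.
  by apply: CompMul; exact: sm_cst.
have -> : (fun x => \sum_i A i x) = (fun x => A ord0 x + \sum_i A (lift ord0 i) x).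
  by apply/funext => x; rewrite big_ord_recl.
by apply: CompAdd => //; exact: IH.
Qed.

Lemma derive_comp_findim V W (F : V -> W) (G : W -> R) n (b : 'I_n -> W) (c : 'I_n -> W -> R) x v :
  (forall w, w = \sum_i c i w *: b i) ->
  differentiable F x -> differentiable G (F x) ->
  'D_v (fun x => G (F x)) x = \sum_i c i ('D_v F x) * 'D_(b i) G (F x).
Proof.
move=> cE dF dG; have dGF : differentiable (G \o F) x by exact: differentiable_comp.
rewrite (deriveE _ dGF) (diff_comp dF dG) /= -(deriveE _ dF) [in LHS](cE ('D_v F x)) linear_sum.
by apply: eq_bigr => i _; rewrite linearZ /= (deriveE _ dG).
Qed.

Lemma sm_comp V W (U : set V) (T : set W) (F : V -> W) (G : W -> R) :
  findim W -> open U -> open T -> (forall x, U x -> T (F x)) ->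
  sm U F -> sm T G -> sm U (fun x => G (F x)).
Proof.
move=> [n [b [c [cc cE]]]] oU oT UT sF sG.
have dF x : U x -> differentiable F x by exact: sm_differentiable.
have dGF G' : sm T G' -> forall x, U x -> differentiable (fun x => G' (F x)) x.
  move=> sG' x Ux; apply: differentiable_comp; first exact: dF.
  by apply: sm_differentiable sG' _; exact: UT.
have D H : comp_alg U T F H -> forall x, U x -> differentiable H x.
  elim=> [phi A sphi sA|A B _ dA _ dB] x Ux.
    apply: differentiableM; first exact: sm_differentiable sphi Ux.
    exact: dGF.
  by apply: differentiableD; [exact: dA|exact: dB].
suff : sm U (fun x => (cst 1 : V -> R) x * G (F x)).
  by apply: sm_eq_on => // x _; rewrite /= mul1r.
apply: (@sm_coind _ _ _ _ (comp_alg U T F)) => //; last by apply: CompMul => //; exact: sm_cst.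
move=> H v; elim=> {H} [phi A sphi sA|A B mA [A' mA' AA'] mB [B' mB' BB']].
  exists (fun x => 'D_v phi x * A (F x) + \sum_i (phi x * c i ('D_v F x)) * 'D_(b i) A (F x)).
    apply: CompAdd; first by apply: CompMul => //; exact: sm_derive.
    apply: (@comp_alg_sum _ _ _ _ _ n
      (fun i x => (phi x * c i ('D_v F x)) * 'D_(b i) A (F x))) => // i.
    apply: (@CompMul _ _ U T F (fun x => phi x * c i ('D_v F x)) ('D_(b i) A)); last exact: sm_derive.
    by apply: smM => //; apply: sm_lincomp => //; exact: sm_derive.
  move=> x Ux; rewrite deriveM.
  - rewrite addrC /GRing.scale /= mulrC; congr (_ + _).
    rewrite (derive_comp_findim _ cE) ?mulr_sumr; [|exact: dF|].
      by apply: eq_bigr => i _; rewrite mulrA.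
    by apply: sm_differentiable sA _; exact: UT.
  - exact: sm_derivable sphi Ux.
  - by apply: diff_derivable; exact: dGF.
exists (fun x => A' x + B' x); first exact: CompAdd.
by move=> x Ux; rewrite deriveD ?AA' ?BB' //; apply: diff_derivable; exact: D.
Qed.

Lemma smN V W (U : set V) (F : V -> W) : open U -> sm U F -> sm U (fun x => - F x).
Proof.
move=> oU sF; apply: (@sm_lincomp _ _ _ _ -%R) => // x.
by apply: cvgN; exact: cvg_id.
Qed.

Lemma smB V W (U : set V) (F G : V -> W) : open U -> sm U F -> sm U G ->
  sm U (fun x => F x - G x).
Proof. by move=> oU sF sG; apply: smD => //; exact: smN. Qed.

Lemma smX V (U : set V) (F : V -> R) n : open U -> sm U F -> sm U (fun x => F x ^+ n).
Proof.
move=> oU sF; elim: n => [|n IH]; first exact: sm_cst.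
by under eq_fun do rewrite exprS; exact: smM.
Qed.

(** On the line the derivative in direction v is v times the derivative in direction 1, so stability
    under scaling and ordinary derivation is enough. *)
Lemma sm_coind1 (U : set R) (P : (R -> R) -> Prop) : open U ->
  (forall F v, P F -> P (fun x => v * F x)) ->
  (forall F, P F -> exists2 G, P G & forall x, U x -> is_derive x (1 : R) F (G x)) ->
  forall F, P F -> sm U F.
Proof.
move=> oU P1 P2; apply: sm_coind => // [F /P2[G PG FG] x /FG[dx _]|F v /P2[G PG FG]].
  exact/derivable1_diffP.
exists (fun x => v * G x); first exact: P1.
move=> x /FG[/derivable1_diffP dF <-].
by rewrite !(deriveE _ dF) -[v in LHS]mulr1 -[v * 1]/(v *: (1 : R)) linearZ.
Qed.

Lemma is_derive_mulXV (F : R -> R) (df x : R) n : x != 0 -> is_derive x (1 : R) F df ->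
  is_derive x (1 : R) (fun x => F x * (x^-1) ^+ n)
    (df * (x^-1) ^+ n - n%:R * F x * (x^-1) ^+ n.+1).
Proof.
move=> x0 dF.
have dV : is_derive x (1 : R) (fun x : R => x^-1) (- x^-2).
  by apply: DeriveDef; [exact: derivableV|rewrite deriveV // derive_id /GRing.scale /= mulr1].
have -> : (fun x => F x * (x^-1) ^+ n) = F * (fun x : R => x^-1) ^+ n.
  by apply/funext => y; rewrite fctE exprfctE.
apply: is_derive_eq; rewrite exprfctE /GRing.scale /= -exprVn.
case: n => [|n]; first by rewrite mul0r; ring.
by rewrite /= !exprS; ring.
Qed.

Lemma sm_inv : sm [set x : R | x != 0] (GRing.inv : R -> R).
Proof.
have oU : open [set x : R | x != 0] by exact: open_neq.
suff : sm [set x : R | x != 0] (fun x : R => 1 * (x^-1) ^+ 1).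
  by apply: sm_eq_on => // x _; rewrite mul1r.
apply: (@sm_coind1 _ (fun F => exists n a, F = (fun x : R => a * (x^-1) ^+ n))) => //;
  last by exists 1%N, 1.
- by move=> _ v [n [a ->]]; exists n, (v * a); apply/funext => x; rewrite mulrA.
- move=> _ [n [a ->]]; exists (fun x => (- n%:R * a) * x^-1 ^+ n.+1); first by exists n.+1, (- n%:R * a).
  move=> x x0; apply: is_derive_eq (is_derive_mulXV n x0 (is_derive_cst a x 1)) _.
  by rewrite /cst; ring.
Qed.

(** The derivative of sqrt(x) is sqrt(x) / (2 x), so the functions a sqrt(x) x^(-n) form a stable
    class. *)
Lemma sm_sqrt : sm [set x : R | 0 < x] (Num.sqrt : R -> R).
Proof.
have oU : open [set x : R | 0 < x] by exact: open_gt.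
suff : sm [set x : R | 0 < x] (fun x : R => 1 * Num.sqrt x * (x^-1) ^+ 0).
  by apply: sm_eq_on => // x _; rewrite mul1r mulr1.
apply: (@sm_coind1 _ (fun F => exists n a, F = (fun x : R => a * Num.sqrt x * (x^-1) ^+ n))) => //;
  last by exists 0%N, 1.
- by move=> _ v [n [a ->]]; exists n, (v * a); apply/funext => x; rewrite !mulrA.
- move=> _ [n [a ->]]; exists (fun x => ((2^-1 - n%:R) * a) * Num.sqrt x * x^-1 ^+ n.+1).
    by exists n.+1, ((2^-1 - n%:R) * a).
  move=> x x0; have dS := is_derive1_sqrt x0.
  have s0 : Num.sqrt x != 0 by rewrite sqrtr_eq0 -ltNge.
  have dA : is_derive x (1 : R) (fun x => a * Num.sqrt x) (a * (2 * Num.sqrt x)^-1).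
    by have -> : (fun x => a * Num.sqrt x) = a *: Num.sqrt by []; apply: is_deriveZ.
  apply: is_derive_eq (is_derive_mulXV n (lt0r_neq0 x0) dA) _.
  have -> : (2 * Num.sqrt x)^-1 = 2^-1 * Num.sqrt x * x^-1.
    by rewrite -{3}(sqr_sqrtr (ltW x0)); field.
  by rewrite exprS; ring.
Qed.

Lemma sm_trig (a b : R) : sm setT (fun x : R => a * sin x + b * cos x).
Proof.
apply: (@sm_coind1 _ (fun F => exists a b, F = (fun x : R => a * sin x + b * cos x))) => //.
- exact: openT.
- by move=> _ v [p [q ->]]; exists (v * p), (v * q); apply/funext => x; ring.
- move=> _ [p [q ->]]; exists (fun x => (- q) * sin x + p * cos x); first by exists (- q), p.
  move=> x _; apply: is_derive_eq (is_deriveD (is_deriveZ p (is_derive_sin x))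
    (is_deriveZ q (is_derive_cos x))) _.
  by rewrite /GRing.scale /= addrC mulrN mulNr.
- by exists a, b.
Qed.

Lemma sm_sin : sm setT (sin : R -> R).
Proof. by have := sm_trig 1 0; apply: sm_eq_on; [exact: openT|move=> x _; ring]. Qed.

Lemma sm_cos : sm setT (cos : R -> R).
Proof. by have := sm_trig 0 1; apply: sm_eq_on; [exact: openT|move=> x _; ring]. Qed.

End Composition.

(** * Integrals and series of smooth functions *)

Section UnderIntegral.
Context {R : realType}.
Implicit Types V W : normedModType R.

(** Dominated convergence concerns sequences; this criterion transfers it to limits at a point. A
    failure yields bad points in the balls of radius 1 / (n + 1). *)
Lemma cvg_seqP V (f : V -> R) (p : V) (l : R) :
  (forall u : nat -> V, u n @[n --> \oo] --> p -> f (u n) @[n --> \oo] --> l) ->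
  f x @[x --> p] --> l.
Proof.
move=> H; apply/cvgrPdist_lt => e e0; apply: contrapT => nf.
have /choice[u uP] : forall n : nat, exists x, ball p n.+1%:R^-1 x /\ e <= `|l - f x|.
  move=> n; apply: contrapT => nx; apply: nf.
  apply/nbhs_ballP; exists n.+1%:R^-1 => /=; first by rewrite invr_gt0.
  move=> x px; rewrite ltNge; apply/negP => le; apply: nx.
  by exists x.
have : u n @[n --> \oo] --> p.
  apply/cvgrPdist_lt => d d0.
  have [N _ NP] := near_infty_natSinv_lt (PosNum d0).
  exists N => // n /= Nn; have [+ _] := uP n.
  by rewrite -ball_normE /= => /lt_trans; apply; exact: NP.
move=> /H /cvgrPdist_lt /(_ e e0)[N _ /(_ N (leqnn N)) /=].
by rewrite ltNge; have [_ ->] := uP N.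
Qed.

Section Dominated.
Context d {Y : measurableType d} (mu : {measure set Y -> \bar R}) (B : set Y).
Hypothesis mB : measurable B.
Variables (V : normedModType R) (U : set V).
Hypotheses (fdV : findim V) (oU : open U).

(** The integrable majorant is local in the parameter and is asked of every iterated derivative, so
    that the condition passes to derivatives. The measure is arbitrary: Lebesgue measure serves for
    parameter integrals, counting measure for series. *)
Definition dominated (F : Y -> V -> R) :=
  [/\ forall y, B y -> sm U (F y),
      forall vs x, U x -> measurable_fun B (fun y => dvs vs (F y) x) &
      forall vs x, U x -> exists2 h : Y -> R, mu.-integrable B (EFin \o h) &
        \forall z \near x, forall y, B y -> `|dvs vs (F y) z| <= h y].

Lemma dominated_derive F v : dominated F -> dominated (fun y => 'D_v (F y)).
Proof.
move=> [F1 F2 F3]; split=> [y By|vs x Ux|vs x Ux].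
- by apply: sm_derive; exact: F1.
- exact: (F2 (v :: vs)).
- exact: (F3 (v :: vs)).
Qed.

Lemma dominated_integrable F x : dominated F -> U x ->
  mu.-integrable B (EFin \o (F ^~ x)).
Proof.
move=> [F1 F2 F3] Ux; have [h ih hF] := F3 [::] x Ux.
apply: le_integrable ih => //; first by apply/measurable_EFinP; exact: (F2 [::]).
move=> y By /=; rewrite lee_fin (le_trans (nbhs_singleton hF y By)) //.
exact: ler_norm.
Qed.

Lemma dominated_continuous F x : dominated F -> U x ->
  {for x, continuous (fun x => \int[mu]_(y in B) F y x)}.
Proof.
move=> dF Ux; have [F1 F2 F3] := dF; have [h ih hF] := F3 [::] x Ux.
apply: cvg_seqP => u ux.
have [N _ NP] : \forall n \near \oo, U (u n) /\ forall y, B y -> `|F y (u n)| <= h y.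
  suff /ux : nbhs x [set z | U z /\ forall y, B y -> `|F y z| <= h y] by [].
  by apply: filterI hF; exact: open_nbhs_nbhs.
(* The majorant is only valid near [x]; shifting the sequence makes it valid for all indices. *)
rewrite -(cvg_shiftn N) /=.
apply: fine_cvg; rewrite fineK; last first.
  by apply: integrable_fin_num => //; exact: dominated_integrable.
apply: (@dominated_cvg _ _ _ mu _ mB (fun n y => (F y (u (n + N)%N))%:E) _ (EFin \o h)) => //.
- move=> n; apply/measurable_EFinP; apply: (F2 [::]).
  by have [] := NP (n + N)%N (leq_addl _ _).
- move=> y By; apply: cvg_EFin; first exact: nearW.
  rewrite (cvg_shiftn N (fun n => F y (u n))).
  apply: continuous_cvg => //.
  by apply: sm_continuous (F1 y By) _.
- move=> n y By /=; rewrite lee_fin.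
  by have [_ ->] := NP (n + N)%N (leq_addl _ _).
Qed.

(** Restriction to the line x + t v reduces the claim to differentiation under the integral in one
    real variable, on an interval where the local majorant holds. *)
Lemma dominated_is_derive F x v : dominated F -> U x ->
  is_derive x v (fun x => \int[mu]_(y in B) F y x) (\int[mu]_(y in B) 'D_v (F y) x).
Proof.
move=> dF Ux; have [F1 F2 F3] := dF.
have [h0 ih0 hF0] := F3 [::] x Ux; have [h1 ih1 hF1] := F3 [:: v] x Ux.
have : \forall t \near (0 : R), U (x + t *: v) /\
    forall y, B y -> `|'D_v (F y) (x + t *: v)| <= h1 y.
  have c : (x + t *: v) @[t --> (0 : R)] --> x.
    rewrite -[X in _ --> X]addr0 -(scale0r v); apply: cvgD; first exact: cvg_cst.
    by apply: cvgZr_tmp; exact: cvg_id.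
  suff /c : nbhs x [set z | U z /\ forall y, B y -> `|'D_v (F y) z| <= h1 y] by [].
  by apply: filterI hF1; exact: open_nbhs_nbhs.
move=> /nbhs_ballP[e /= e0 eP].
have eP' t : `]- e, e[%classic t -> U (x + t *: v) /\
    forall y, B y -> `|'D_v (F y) (x + t *: v)| <= h1 y.
  rewrite /= in_itv /= => /andP[t1 t2]; apply: eP.
  by rewrite -ball_normE /= sub0r normrN ltr_norml t1.
have D1 t y : `]- e, e[%classic t -> B y ->
    is_derive t (1 : R) (fun t : R => F y (x + t *: v)) ('D_v (F y) (x + t *: v)).
  move=> /eP'[Ut _] By; apply: is_derive_line.
  exact: sm_derivable (F1 y By) Ut.
have I0 : `]- e, e[%classic (0 : R) by rewrite /= in_itv /= oppr_lt0 e0.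
have := @cvg_differentiation_under_integral R _ Y mu (fun t y => F y (x + t *: v)) B mB 0 (- e) e
  I0 _ _ (fun y => `|h1 y|) (fun y => normr_ge0 _) _ _.
have -> : \int[mu]_(y in B) partial1of2 (fun t y => F y (x + t *: v)) 0 y
    = \int[mu]_(y in B) 'D_v (F y) x.
  apply: eq_Rintegral => y /set_mem By; rewrite partial1of2E.
  by have [_ ->] := D1 0 y I0 By; rewrite scale0r addr0.
move=> H.
have : h^-1 *: ((\int[mu]_(y in B) F y (h *: v + x)) - \int[mu]_(y in B) F y x) @[h --> 0^']
    --> \int[mu]_(y in B) 'D_v (F y) x.
  have E : (fun h : R => h^-1 *: ((\int[mu]_(y in B) F y (h *: v + x)) - \int[mu]_(y in B) F y x))
     = (fun h => h^-1 *: ((\int[mu]_(y in B) F y (x + (h + 0) *: v)) - \int[mu]_(y in B) F y (x + 0 *: v))).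
    by apply/funext => h; rewrite addr0 scale0r addr0 [h *: v + x]addrC.
  rewrite E; apply: H.
  - by move=> t /eP'[Ut _]; exact: dominated_integrable.
  - by move=> t y It By; have [] := D1 t y It By.
  - exact: integrable_norm.
  - move=> t y It By; rewrite partial1of2E; have [_ ->] := D1 t y It By.
    by have [_ /(_ y By)] := eP' t It; move/le_trans; apply; exact: ler_norm.
move=> C; apply: DeriveDef; last exact: cvg_lim C.
by apply/cvg_ex; exists (\int[mu]_(y in B) 'D_v (F y) x).
Qed.

(** Integrals of dominated families form a class stable under derivation. Their directional
    derivatives are continuous by dominated convergence, so [C1_differentiable] gives
    differentiability. *)
Lemma dominated_sm F : dominated F -> sm U (fun x => \int[mu]_(y in B) F y x) /\
  forall vs x, U x -> dvs vs (fun x => \int[mu]_(y in B) F y x) x = \int[mu]_(y in B) dvs vs (F y) x.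
Proof.
move=> dF; split.
  apply: (@sm_coind _ _ _ _ (fun G => exists2 F, dominated F &
      G = (fun x => \int[mu]_(y in B) F y x))) => //; last by exists F.
  - move=> _ [A dA ->] x Ux; apply: (C1_differentiable fdV oU) => // v z Uz.
      by have [] := dominated_is_derive v dA Uz.
    apply: (@cvg_trans _ ((fun x => \int[mu]_(y in B) 'D_v (A y) x) @ z)).
      apply: near_eq_cvg; apply: (open_near oU Uz) => w Uw.
      by have [_ ->] := dominated_is_derive v dA Uw.
    have [_ ->] := dominated_is_derive v dA Uz.
    exact: (dominated_continuous (dominated_derive v dA) Uz).
  - move=> _ v [A dA ->]; exists (fun x => \int[mu]_(y in B) 'D_v (A y) x).
      by exists (fun y => 'D_v (A y)) => //; exact: dominated_derive.
    by move=> x Ux; have [_ ->] := dominated_is_derive v dA Ux.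
move=> vs; elim: vs F dF => [//|v vs IH] F dF x Ux /=.
rewrite -(IH (fun y => 'D_v (F y))) //; last exact: dominated_derive.
apply: (dvs_eq_on _ oU) => // z Uz.
by have [_ ->] := dominated_is_derive v dF Uz.
Qed.

End Dominated.
End UnderIntegral.

Section ParamIntegral.
Context {R : realType}.
Implicit Types V W : normedModType R.

Lemma dvs_slice V W (F : V * R -> W) t vs :
  dvs vs (fun x => F (x, t)) = (fun x => dvs (map (fun v => (v, 0)) vs) F (x, t)).
Proof.
elim: vs F => [//|v vs IH] F /=; rewrite -IH; congr (dvs vs _).
apply/funext => x; rewrite /derive; congr (lim (_ @ 0^')); apply/funext => h /=.
by congr (_ *: (F _ - _)); apply: injective_projections => //=; rewrite scaler0 add0r.
Qed.

Lemma open_setXT V (U : set V) : open U -> open (U `*` [set: R]).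
Proof.
move=> oU; have -> : U `*` [set: R] = fst @^-1` U by apply/seteqP; split => [p []|p].
by apply: open_comp => // p _; exact: cvg_fst.
Qed.

Lemma sm_slice V W (U : set V) (F : V * R -> W) t : sm (U `*` setT) F ->
  sm U (fun x => F (x, t)).
Proof.
move=> sF vs x Ux; rewrite dvs_slice.
apply: (@differentiable_comp _ _ _ _ (fun x => (x, t))).
  by apply: differentiable_pair; [exact: ex_diff|exact: differentiable_cst].
exact: sF.
Qed.

Lemma sm_slice_continuous V W (U : set V) (F : V * R -> W) x : sm (U `*` setT) F -> U x ->
  continuous (fun t => F (x, t)).
Proof.
move=> sF Ux t.
have c : {for t, continuous (fun t : R => (x, t))}.
  apply: differentiable_continuous.
  by apply: differentiable_pair; [exact: differentiable_cst|exact: ex_diff].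
apply: (@continuous_comp _ _ _ (fun t => (x, t)) F) => //.
by apply: sm_continuous sF _.
Qed.

(** The tube lemma: compactness of [K] turns local bounds at the points (x, t) into a bound on a
    common neighbourhood of [x]. *)
Lemma tube_bound V (U : set V) (F : V * R -> R) (K : set R) x :
  sm (U `*` setT) F -> U x -> compact K ->
  exists M, \forall z \near x, forall t, K t -> `|F (z, t)| <= M.
Proof.
move=> sF Ux cK.
have [M HM] : exists M, forall t, K t -> `|F (x, t)| <= M.
  have : compact ((fun t => F (x, t)) @` K).
    apply: continuous_compact => //; apply: continuous_subspaceT.
    exact: sm_slice_continuous sF Ux.
  move=> /compact_bounded[M [_ HM]]; exists (M + 1) => t Kt.
  by apply: (HM (M + 1)); [rewrite ltrDl|exists t].
exists (M + 1).
have /compact_near_coveringP cov := cK.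
apply: (cov _ _ (fun z t => `|F (z, t)| <= M + 1)) => t Kt.
have cF : {for (x, t), continuous F} by apply: sm_continuous sF _.
have /cvgrPdist_le /(_ 1 ltr01) [[A B] /= [xA tB] AB] := cF.
exists (B, A) => //= -[t' z] [/= Bt Az].
have /= := AB (z, t') (conj Az Bt).
move=> H; rewrite -[F (z, t')](subKr (F (x, t))) (le_trans (ler_normB _ _)) //.
by rewrite lerD // HM.
Qed.

Lemma dominated_param V (U : set V) (F : V * R -> R) a b : open U ->
  sm (U `*` setT) F ->
  dominated lebesgue_measure `[a, b] U (fun t x => F (x, t)).
Proof.
move=> oU sF; split=> [t _|vs x Ux|vs x Ux].
- exact: sm_slice.
- have -> : (fun t : R => dvs vs (fun z => F (z, t)) x) =
      (fun t => dvs (map (fun v => (v, 0)) vs) F (x, t)).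
    by apply/funext => t; rewrite (dvs_slice F t).
  apply: measurable_funTS; apply: continuous_measurable_fun.
  by apply: sm_slice_continuous Ux; exact: sm_dvs.
- have [M HM] := tube_bound (sm_dvs (map (fun v => (v, 0)) vs) sF) Ux (@segment_compact _ a b).
  exists (cst M); last first.
    by apply: filterS HM => z HM t abt; rewrite (dvs_slice F t); exact: HM.
  apply: measurable_bounded_integrable => //.
    exact/compact_finite_measure/segment_compact.
  exact: bounded_cst.
Qed.

Lemma param_int V (U : set V) (F : V * R -> R) a b : findim V -> open U ->
  sm (U `*` setT) F ->
  sm U (fun x => \int[lebesgue_measure]_(t in `[a, b]) F (x, t)) /\
  forall vs x, U x -> dvs vs (fun x => \int[lebesgue_measure]_(t in `[a, b]) F (x, t)) x =
    \int[lebesgue_measure]_(t in `[a, b]) dvs (map (fun v => (v, 0)) vs) F (x, t).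
Proof.
move=> fV oU sF.
have [//|H1 H2] := dominated_sm _ fV oU (dominated_param a b oU sF).
split=> // vs x Ux; rewrite H2 //.
by apply: eq_Rintegral => t _; rewrite (dvs_slice F t).
Qed.

Lemma sm_local_bound V (U : set V) (F : V -> R) x : sm U F -> U x ->
  \forall z \near x, `|F z| <= `|F x| + 1.
Proof.
move=> sF Ux; have /cvgrPdist_le /(_ 1 ltr01) := sm_continuous sF Ux.
apply: filterS => z H; rewrite -[F z](subKr (F x)) (le_trans (ler_normB _ _)) //.
by rewrite lerD.
Qed.

Lemma integrable_half (C : R) :
  (@counting nat R).-integrable setT (EFin \o (fun j => C / (2 ^ j.+1)%:R)).
Proof.
apply/integrableP; split=> //.
have E (j : nat) : `|(C / (2 ^ j.+1)%:R)%:E|%E =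
    (`|C| / (2 ^ j.+1)%:R)%:E.
  by rewrite /= normrM [X in (_ * X)%R]ger0_norm // invr_ge0.
under eq_integral do rewrite E.
have S : \big[+%E/0%E]_(0 <= k <oo) (`|C| / (2 ^ k.+1)%:R)%:E = (`|C|%:E)%E.
  have := @cvg_geometric_eseries_half R `|C| 0.
  have -> : (fun k => (`|C| / (2 ^ (k + 1))%:R)%:E) = (fun k => (`|C| / (2 ^ k.+1)%:R)%:E).
    by apply/funext => k; rewrite addn1.
  by move=> /cvg_lim H; rewrite [LHS]H // expr0 divr1.
have g0 k : (0%:E <= (`|C| / (2 ^ k.+1)%:R)%:E)%E by rewrite lee_fin divr_ge0.
rewrite integral_count; first by rewrite S ltry.
rewrite /summable; under eq_esum do rewrite gee0_abs //.
by rewrite -nneseries_esumT ?S ?ltry.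
Qed.

(* Series are integrals for the counting measure, so that [dominated_sm] applies. *)
Lemma series_sm V (U : set V) (F : nat -> V -> R) : findim V -> open U ->
  (forall j, sm U (F j)) ->
  (forall vs x, U x -> exists C, exists J, \forall z \near x,
    forall j, (J <= j)%N -> `|dvs vs (F j) z| <= C / (2 ^ j.+1)%:R) ->
  sm U (fun x => \int[@counting nat R]_j F j x) /\
  forall vs x, U x -> dvs vs (fun x => \int[@counting nat R]_j F j x) x =
    \int[@counting nat R]_j dvs vs (F j) x /\
    (@counting nat R).-integrable setT (EFin \o (fun j => dvs vs (F j) x)).
Proof.
move=> fV oU sF H.
suff D : dominated (@counting nat R) setT U F.
  have [S1 S2] := dominated_sm (@measurableT _ nat) fV oU D; split=> // vs x Ux; split; first exact: S2.
  have Dvs : dominated (@counting nat R) setT U (fun j => dvs vs (F j)).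
    elim: vs F D {sF H S1 S2} => //= v vs IH F D.
    by apply: (IH (fun j => 'D_v (F j))); exact: dominated_derive.
  exact: (dominated_integrable (@measurableT _ nat) Dvs Ux).
split=> [j _|vs x Ux|vs x Ux] //.
have [C [J CJ]] := H vs x Ux.
(* The geometric bound starts at [J]; the finitely many earlier terms, bounded near [x] by their
   value plus 1, are absorbed into the constant after multiplication by 2 ^ (j + 1). *)
pose D := `|C| + \sum_(j < J) (`|dvs vs (F j) x| + 1) * (2 ^ j.+1)%:R.
exists (fun j => D / (2 ^ j.+1)%:R); first exact: integrable_half.
have : \forall z \near x, forall j : 'I_J, `|dvs vs (F j) z| <= `|dvs vs (F j) x| + 1.
  apply: filter_forall => j; apply: sm_local_bound Ux; exact: sm_dvs.
apply: filterS2 CJ => z CJ zJ j _.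
have T (k : 'I_J) : 0 <= (`|dvs vs (F k) x| + 1) * (2 ^ k.+1)%:R.
  by rewrite mulr_ge0 // addr_ge0.
have [Jj|jJ] := leqP J j.
  apply: le_trans (CJ j Jj) _; rewrite ler_wpM2r // ?invr_ge0 //.
  by rewrite (le_trans (ler_norm _)) // lerDl sumr_ge0.
apply: le_trans (zJ (Ordinal jJ)) _ => /=.
rewrite ler_pdivlMr ?ltr0n ?expn_gt0 // /D (bigD1 (Ordinal jJ)) //= addrCA lerDl.
by rewrite addr_ge0 // sumr_ge0.
Qed.

Lemma sum_counting (g : nat -> R) J : (forall j, (J <= j)%N -> g j = 0) ->
  \int[@counting nat R]_j g j = \sum_(j < J) g j.
Proof.
move=> g0; rewrite /Rintegral integral_count.
  rewrite (@lim_near_cst _ _ _ _ _ (\sum_(j < J) (g j)%:E)%E) //; first by rewrite sumEFin.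
  exists J => // n /= Jn; rewrite /index_iota subn0 -(subnKC Jn) iotaD big_cat /=.
  rewrite -(big_mkord xpredT (fun j => (g j)%:E)) /index_iota subn0 add0n.
  rewrite [X in _ + X]big_seq [X in _ + X]big1 ?[LHS]adde0 // => j.
  by rewrite mem_iota => /andP[Jj _]; rewrite g0.
rewrite /summable -nneseries_esumT //.
rewrite (@lim_near_cst _ _ _ _ _ (\sum_(j < J) `|(g j)%:E|)%E) //.
  by rewrite sumEFin ltry.
exists J => // n /= Jn; rewrite /index_iota subn0 -(subnKC Jn) iotaD big_cat /=.
rewrite -(big_mkord xpredT (fun j => `|(g j)%:E|%E)) /index_iota subn0 add0n.
rewrite [X in _ + X]big_seq [X in _ + X]big1 ?[LHS]adde0 // => j.
by rewrite mem_iota => /andP[Jj _]; rewrite g0 // normr0.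
Qed.
End ParamIntegral.

(** * Complex-valued functions of real variables *)

Section ComplexValued.
Context {R : realType}.
Implicit Types V W Z : normedModType R.
Notation C := R[i].
Notation Re := complex.Re.
Notation Im := complex.Im.

Lemma ReDc (x y : C) : Re (x + y) = Re x + Re y. Proof. by case: x y => [? ?] []. Qed.
Lemma ImDc (x y : C) : Im (x + y) = Im x + Im y. Proof. by case: x y => [? ?] []. Qed.
Lemma ReMc (x y : C) : Re (x * y) = Re x * Re y - Im x * Im y.
Proof. by case: x y => [? ?] []. Qed.
Lemma ImMc (x y : C) : Im (x * y) = Re x * Im y + Im x * Re y.
Proof. by case: x y => [? ?] []. Qed.
Lemma ReVc (x : C) : Re x^-1 = Re x * ((Re x) ^+ 2 + (Im x) ^+ 2)^-1.
Proof. by case: x. Qed.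
Lemma ImVc (x : C) : Im x^-1 = - (Im x * ((Re x) ^+ 2 + (Im x) ^+ 2)^-1).
Proof. by case: x. Qed.
Lemma eqc (x y : C) : Re x = Re y -> Im x = Im y -> x = y.
Proof. by case: x y => [a b] [c d] /= -> ->. Qed.

(** Derivatives are taken over the real field, so a complex-valued function is carried by its real
    and imaginary parts. *)
Definition csm V (U : set V) (F : V -> C) :=
  sm U (fun x => Re (F x)) /\ sm U (fun x => Im (F x)).

Definition cdvs V (vs : seq V) (F : V -> C) (x : V) : C :=
  (dvs vs (fun y => Re (F y)) x) +i* (dvs vs (fun y => Im (F y)) x).

Definition cD V (v : V) (F : V -> C) := cdvs [:: v] F.

Lemma csm_cdvs V (U : set V) F vs : csm U F -> csm U (cdvs vs F).
Proof. by move=> [sR sI]; split; exact: sm_dvs. Qed.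

Lemma csm_cD V (U : set V) F v : csm U F -> csm U (cD v F).
Proof. exact: csm_cdvs. Qed.

Lemma csm_eq_on V (U : set V) (F G : V -> C) :
  open U -> (forall x, U x -> F x = G x) -> csm U F -> csm U G.
Proof.
by move=> oU FG [sR sI]; split; [apply: sm_eq_on sR|apply: sm_eq_on sI] => // x /FG ->.
Qed.

Lemma cdvs_eq_on V (U : set V) (F G : V -> C) vs :
  open U -> (forall x, U x -> F x = G x) -> forall x, U x -> cdvs vs F x = cdvs vs G x.
Proof.
move=> oU FG x Ux; apply: eqc => /=; apply: (dvs_eq_on _ oU) => // y /FG -> //.
Qed.

Lemma csm_subset V (U U' : set V) (F : V -> C) : U' `<=` U -> csm U F -> csm U' F.
Proof. by move=> UU [sR sI]; split; [exact: sm_subset sR|exact: sm_subset sI]. Qed.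

Lemma csm_cst V (U : set V) (c : C) : open U -> csm U (fun=> c).
Proof. by move=> oU; split; exact: sm_cst. Qed.

Lemma csm_rc V (U : set V) (F : V -> R) : open U -> sm U F -> csm U (fun x => (F x)%:C).
Proof. by move=> oU sF; split => //=; exact: sm_cst. Qed.

Lemma csmD V (U : set V) (F G : V -> C) : open U -> csm U F -> csm U G ->
  csm U (fun x => F x + G x).
Proof.
move=> oU [F1 F2] [G1 G2]; split.
  by under eq_fun do rewrite ReDc; exact: smD.
by under eq_fun do rewrite ImDc; exact: smD.
Qed.

Lemma csmM V (U : set V) (F G : V -> C) : open U -> csm U F -> csm U G ->
  csm U (fun x => F x * G x).
Proof.
move=> oU [F1 F2] [G1 G2]; split.
  by under eq_fun do rewrite ReMc; apply: smB => //; exact: smM.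
by under eq_fun do rewrite ImMc; apply: smD => //; exact: smM.
Qed.

Lemma csmN V (U : set V) (F : V -> C) : open U -> csm U F -> csm U (fun x => - F x).
Proof.
move=> oU sF; under eq_fun do rewrite -mulN1r.
by apply: csmM => //; exact: csm_cst.
Qed.

Lemma csmB V (U : set V) (F G : V -> C) : open U -> csm U F -> csm U G ->
  csm U (fun x => F x - G x).
Proof. by move=> oU sF sG; apply: csmD => //; exact: csmN. Qed.

Lemma csmX V (U : set V) (F : V -> C) n : open U -> csm U F -> csm U (fun x => F x ^+ n).
Proof.
move=> oU sF; elim: n => [|n IH]; first exact: csm_cst.
by under eq_fun do rewrite exprS; exact: csmM.
Qed.

Lemma csm_conj V (U : set V) (F : V -> C) : open U -> csm U F -> csm U (fun x => (F x)^*%C).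
Proof.
move=> oU [F1 F2]; split.
  by apply: sm_eq_on F1 => // x _; case: (F x).
by apply: sm_eq_on (smN oU F2) => // x _; case: (F x).
Qed.

Lemma norm2_neq0 (z : C) : z != 0 -> (Re z) ^+ 2 + (Im z) ^+ 2 != 0.
Proof.
case: z => a b; apply: contraNneq => /= /eqP.
by rewrite paddr_eq0 ?sqr_ge0 // !sqrf_eq0 => /andP[/eqP -> /eqP ->].
Qed.

Lemma smV V (U : set V) (F : V -> R) : open U -> (forall x, U x -> F x != 0) ->
  sm U F -> sm U (fun x => (F x)^-1).
Proof.
move=> oU F0 sF; apply: (@sm_comp _ _ _ _ _ _ (GRing.inv : R -> R) (@findim_R R) oU _ F0 sF sm_inv).
exact: open_neq.
Qed.

Lemma csmV V (U : set V) (F : V -> C) : open U -> (forall x, U x -> F x != 0) ->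
  csm U F -> csm U (fun x => (F x)^-1).
Proof.
move=> oU F0 [F1 F2].
have s : sm U (fun x => ((Re (F x)) ^+ 2 + (Im (F x)) ^+ 2)^-1).
  apply: smV => //; first by move=> x /F0; exact: norm2_neq0.
  by apply: smD => //; exact: smX.
split; [under eq_fun do rewrite ReVc|under eq_fun do rewrite ImVc]; first exact: smM.
by apply: smN => //; exact: smM.
Qed.

Lemma csm_comp V W (U : set V) (T : set W) (F : V -> W) (G : W -> C) :
  findim W -> open U -> open T -> (forall x, U x -> T (F x)) ->
  sm U F -> csm T G -> csm U (fun x => G (F x)).
Proof. by move=> fW oU oT UT sF [G1 G2]; split;
  [exact: (sm_comp fW oU oT UT sF G1)|exact: (sm_comp fW oU oT UT sF G2)]. Qed.

Lemma cDD V (U : set V) (F G : V -> C) v x : csm U F -> csm U G -> U x ->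
  cD v (fun x => F x + G x) x = cD v F x + cD v G x.
Proof.
move=> [F1 F2] [G1 G2] Ux; apply: eqc; rewrite /= /dvs /=.
  under eq_fun do rewrite ReDc.
  by rewrite deriveD //; [exact: sm_derivable F1 Ux|exact: sm_derivable G1 Ux].
under eq_fun do rewrite ImDc.
by rewrite deriveD //; [exact: sm_derivable F2 Ux|exact: sm_derivable G2 Ux].
Qed.

Lemma cDM V (U : set V) (F G : V -> C) v x : open U -> csm U F -> csm U G -> U x ->
  cD v (fun x => F x * G x) x = F x * cD v G x + G x * cD v F x.
Proof.
move=> oU [F1 F2] [G1 G2] Ux.
have M (A B : V -> R) : sm U A -> sm U B ->
    derivable (fun x => A x * B x) x v /\
    'D_v (fun x => A x * B x) x = A x * 'D_v B x + B x * 'D_v A x.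
  move=> sA sB; split; first exact: sm_derivable (smM oU sA sB) Ux.
  by rewrite deriveM //; [exact: sm_derivable sA Ux|exact: sm_derivable sB Ux].
have [M1 D1] := M _ _ F1 G1; have [M2 D2] := M _ _ F2 G2.
have [M3 D3] := M _ _ F1 G2; have [M4 D4] := M _ _ F2 G1.
apply: eqc; rewrite /= /dvs /=.
  under eq_fun do rewrite ReMc.
  by rewrite deriveB // D1 D2 !(ReDc, ReMc) /=; ring.
under eq_fun do rewrite ImMc.
by rewrite deriveD // D3 D4 !(ImDc, ImMc) /=; ring.
Qed.

Lemma cD_cst V (c : C) (v x : V) : cD v (fun=> c) x = 0.
Proof. by apply: eqc; rewrite /= /dvs /= derive_cst. Qed.

Lemma cDZ V (U : set V) (F : V -> C) c v x : open U -> csm U F -> U x ->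
  cD v (fun x => c * F x) x = c * cD v F x.
Proof.
by move=> oU sF Ux; rewrite (cDM _ oU (csm_cst c oU)) // cD_cst mulr0 addr0.
Qed.

Lemma cDX V (U : set V) (F : V -> C) n v x : open U -> csm U F -> U x ->
  cD v (fun x => F x ^+ n) x = n%:R * F x ^+ n.-1 * cD v F x.
Proof.
move=> oU sF Ux; elim: n => [|n IH]; first by rewrite !mul0r cD_cst.
under eq_fun do rewrite exprS.
rewrite (cDM _ oU sF (csmX n oU sF)) // IH.
case: n {IH} => [|n] /=; first by rewrite !expr0; ring.
by rewrite !exprS -[n.+2%:R]natr1; ring.
Qed.

Lemma cDV V (U : set V) (F : V -> C) v x : open U -> (forall x, U x -> F x != 0) ->
  csm U F -> U x -> cD v (fun x => (F x)^-1) x = - (cD v F x / F x ^+ 2).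
Proof.
move=> oU F0 sF Ux.
have : cD v (fun x => F x * (F x)^-1) x = 0.
  rewrite -[RHS](cD_cst 1 v x); apply: (cdvs_eq_on _ oU) => // y Uy.
  by rewrite divff // F0.
rewrite (cDM _ oU sF (csmV oU F0 sF)) // => H.
have Fx0 := F0 x Ux.
apply: (mulfI Fx0); rewrite -[LHS]addr0 -[X in _ + X]oppr0 -H; field.
exact: Fx0.
Qed.

Lemma derive_chain V W Z (F : V -> W) (G : W -> Z) x v :
  differentiable F x -> differentiable G (F x) ->
  'D_v (fun x => G (F x)) x = 'D_('D_v F x) G (F x).
Proof.
move=> dF dG; have dGF : differentiable (G \o F) x by exact: differentiable_comp.
by rewrite (deriveE _ dGF) (diff_comp dF dG) /= -(deriveE _ dF) (deriveE _ dG).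
Qed.

Lemma cD_chain V W (U : set V) (T : set W) (F : V -> W) (G : W -> C) x v :
  sm U F -> csm T G -> U x -> T (F x) ->
  cD v (fun x => G (F x)) x = cD ('D_v F x) G (F x).
Proof.
move=> sF [G1 G2] Ux Tx; have dF := sm_differentiable sF Ux.
by apply: eqc; rewrite /= /dvs /=; apply: (derive_chain _ dF);
  [exact: sm_differentiable G1 Tx|exact: sm_differentiable G2 Tx].
Qed.

Lemma derive_lin V (F : V -> R) (a b : R) u v x : differentiable F x ->
  'D_(a *: u + b *: v) F x = a * 'D_u F x + b * 'D_v F x.
Proof. by move=> dF; rewrite !(deriveE _ dF) linearP linearZ. Qed.

Lemma cD_lin V (U : set V) (F : V -> C) (a b : R) u v x : csm U F -> U x ->
  cD (a *: u + b *: v) F x = a%:C * cD u F x + b%:C * cD v F x.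
Proof.
move=> [F1 F2] Ux.
have d1 := sm_differentiable F1 Ux; have d2 := sm_differentiable F2 Ux.
apply: eqc; rewrite /cD /cdvs /dvs /= derive_lin //; ring.
Qed.

End ComplexValued.

Section ComplexIntegral.
Context {R : realType}.
Implicit Types V W Z : normedModType R.
Notation C := R[i].
Notation Re := complex.Re.
Notation Im := complex.Im.
Notation mu := (@lebesgue_measure R).

Definition cint (a b : R) (F : R -> C) : C :=
  (\int[mu]_(t in `[a, b]) Re (F t)) +i* (\int[mu]_(t in `[a, b]) Im (F t)).

Lemma continuous_integrable_itv (a b : R) (f : R -> R) : continuous f ->
  mu.-integrable `[a, b] (EFin \o f).
Proof.
move=> cf; apply: continuous_compact_integrable; first exact: segment_compact.
exact: continuous_subspaceT.
Qed.

Definition ccont (F : R -> C) := continuous (fun t => Re (F t)) /\ continuous (fun t => Im (F t)).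

Lemma csm_ccont (F : R -> C) : csm setT F -> ccont F.
Proof. by move=> [F1 F2]; split => t; [exact: (sm_continuous F1)|exact: (sm_continuous F2)]. Qed.

Lemma eq_cint a b (F G : R -> C) : (forall t, a <= t <= b -> F t = G t) -> cint a b F = cint a b G.
Proof.
move=> FG; apply: eqc => /=; apply: eq_Rintegral => t;
  by rewrite inE /= in_itv /= => /FG ->.
Qed.

(** The left endpoint is a null set. This is what allows polar coordinates, whose formulas divide by
    the radius. *)
Lemma eq_Rintegral_oc a b (f g : R -> R) : continuous f -> continuous g ->
  (forall t, a < t <= b -> f t = g t) ->
  \int[mu]_(t in `[a, b]) f t = \int[mu]_(t in `[a, b]) g t.
Proof.
move=> cf cg fg.
have I (h : R -> R) : continuous h -> mu.-integrable `]a, b] (EFin \o h).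
  move=> ch; apply: integrableS (continuous_integrable_itv a b ch) => //.
  exact: subset_itv_oc_cc.
rewrite -(Rintegral_itv_obnd_cbnd (I f cf)) -(Rintegral_itv_obnd_cbnd (I g cg)).
by apply: eq_Rintegral => t; rewrite inE /= in_itv /= => /fg ->.
Qed.

Lemma eq_cint_oc a b (F G : R -> C) : ccont F -> ccont G ->
  (forall t, a < t <= b -> F t = G t) -> cint a b F = cint a b G.
Proof.
move=> [F1 F2] [G1 G2] FG.
by apply: eqc => /=; apply: eq_Rintegral_oc => // t /FG ->.
Qed.

Lemma cintD a b (F G : R -> C) : ccont F -> ccont G ->
  cint a b (fun t => F t + G t) = cint a b F + cint a b G.
Proof.
move=> [F1 F2] [G1 G2]; apply: eqc; rewrite ?ReDc ?ImDc /=.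
  by under eq_Rintegral do rewrite ReDc; rewrite RintegralD //; exact: continuous_integrable_itv.
by under eq_Rintegral do rewrite ImDc; rewrite RintegralD //; exact: continuous_integrable_itv.
Qed.

Lemma cintZ a b c (F : R -> C) : ccont F -> cint a b (fun t => c * F t) = c * cint a b F.
Proof.
move=> [F1 F2].
have I (k : R) (f : R -> R) : continuous f -> mu.-integrable `[a, b] (EFin \o (fun t => k * f t)).
  move=> cf; apply: continuous_integrable_itv => t.
  by apply: cvgM; [exact: cvg_cst|exact: cf].
apply: eqc; rewrite ?ReMc ?ImMc /=.
  under eq_Rintegral do rewrite ReMc.
  rewrite RintegralB; [|by []|exact: I|exact: I].
  by rewrite !RintegralZl //; exact: continuous_integrable_itv.
under eq_Rintegral do rewrite ImMc.
rewrite RintegralD; [|by []|exact: I|exact: I].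
by rewrite !RintegralZl //; exact: continuous_integrable_itv.
Qed.

Lemma Rintegral_cst_itv a b (k : R) : a <= b ->
  \int[mu]_(t in `[a, b]) k = (b - a) * k.
Proof.
move=> ab; have -> : \int[mu]_(t in `[a, b]) k = k * fine (mu `[a, b]%classic).
  by apply: Rintegral_cst.
have -> : mu `[a, b]%classic = (b - a)%:E; last by rewrite mulrC.
rewrite lebesgue_measure_itv /= lte_fin; case: ltP => // ba.
by have -> : a = b; [apply/eqP; rewrite eq_le ab ba|rewrite subrr].
Qed.

Lemma cint_cst a b c : a <= b -> cint a b (fun=> c) = (b - a)%:C * c.
Proof.
by move=> ab; apply: eqc; rewrite ?ReMc ?ImMc /= Rintegral_cst_itv //; ring.
Qed.

Lemma Rintegral_FTC a b (F : R -> R) : a < b -> sm setT F ->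
  \int[mu]_(t in `[a, b]) 'D_1 F t = F b - F a.
Proof.
move=> ab sF.
have cF t : {for t, continuous F} by exact: (sm_continuous sF).
rewrite /Rintegral (@continuous_FTC2 _ _ F) //.
- have cD : continuous ('D_1 F : R -> R).
    by move=> t; have s := sm_derive (1 : R) sF; exact: (sm_continuous s).
  exact: continuous_subspaceT.
- split.
  + by move=> t _; apply: sm_derivable sF _.
  + by apply: cvg_at_right_filter; exact: cF.
  + by apply: cvg_at_left_filter; exact: cF.
- by move=> t _; rewrite derive1E.
Qed.

Lemma cint_FTC a b (F : R -> C) : a < b -> csm setT F ->
  cint a b (cD (1 : R) F) = F b - F a.
Proof.
move=> ab [F1 F2]; apply: eqc; rewrite /= ?ReDc ?ImDc /dvs /= Rintegral_FTC //.
  by case: (F a).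
by case: (F a).
Qed.

Lemma cint_param V (U : set V) (F : V * R -> C) a b : findim V -> open U ->
  csm (U `*` setT) F ->
  csm U (fun x => cint a b (fun t => F (x, t))) /\
  forall vs x, U x -> cdvs vs (fun x => cint a b (fun t => F (x, t))) x =
    cint a b (fun t => cdvs (map (fun v => (v, 0)) vs) F (x, t)).
Proof.
move=> fV oU [F1 F2]; have [A1 A2] := param_int a b fV oU F1.
have [B1 B2] := param_int a b fV oU F2.
by split=> // vs x Ux; rewrite /cdvs /cint /= A2 // B2.
Qed.

Lemma sm_slice2 V (U : set V) (F : V * R -> R) x : findim V -> open U ->
  sm (U `*` setT) F -> U x -> sm setT (fun t => F (x, t)).
Proof.
move=> fV oU sF Ux.
apply: (@sm_comp _ _ _ _ (U `*` setT) (fun t : R => (x, t)) F) => //.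
- by apply: findim_prod => //; exact: findim_R.
- exact: openT.
- exact: open_setXT.
- apply: sm_pair; [exact: openT|apply: sm_cst; exact: openT|apply: sm_id; exact: openT].
Qed.

Lemma csm_slice2 V (U : set V) (F : V * R -> C) x : findim V -> open U ->
  csm (U `*` setT) F -> U x -> csm setT (fun t => F (x, t)).
Proof. by move=> fV oU [F1 F2] Ux; split; [exact: (sm_slice2 fV oU F1)|exact: (sm_slice2 fV oU F2)]. Qed.

Lemma derive_affine V W (F : V -> W) v w x : (forall h : R, F (h *: v + x) = h *: w + F x) ->
  'D_v F x = w.
Proof.
move=> H; apply/lim_near_cst => //=; near=> h.
rewrite H addrK scalerA mulVf ?scale1r //; by near: h; exact: nbhs_dnbhs_neq.
Unshelve. all: by end_near. Qed.

Lemma cD_line_cst V (F : V -> C) v x : (forall h : R, F (h *: v + x) = F x) -> cD v F x = 0.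
Proof.
by move=> H; apply: eqc; apply: derive_affine => h; rewrite H scaler0 add0r.
Qed.

Lemma derive_pair V W Z (F : V -> W) (G : V -> Z) x v :
  differentiable F x -> differentiable G x ->
  'D_v (fun x => (F x, G x)) x = ('D_v F x, 'D_v G x).
Proof.
move=> dF dG; rewrite (deriveE _ (differentiable_pair dF dG)) (diff_pair dF dG).
by rewrite (deriveE _ dF) (deriveE _ dG).
Qed.

Lemma sm_sinF V (U : set V) (F : V -> R) : open U -> sm U F -> sm U (fun x => sin (F x)).
Proof.
move=> oU sF; apply: (@sm_comp _ _ _ _ setT F sin) => //; first exact: findim_R.
- exact: openT.
- exact: sm_sin.
Qed.

Lemma sm_cosF V (U : set V) (F : V -> R) : open U -> sm U F -> sm U (fun x => cos (F x)).
Proof.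
move=> oU sF; apply: (@sm_comp _ _ _ _ setT F cos) => //; first exact: findim_R.
- exact: openT.
- exact: sm_cos.
Qed.

Lemma csm_pair V (U : set V) (F G : V -> R) : sm U F -> sm U G -> csm U (fun x => F x +i* G x).
Proof. by []. Qed.

End ComplexIntegral.

Ltac solve_sm := repeat first
  [ assumption | exact: openT | exact: open_setXT | apply: sm_cst | apply: sm_id
  | apply: sm_fst | apply: sm_snd | apply: sm_pair | apply: smB | apply: smD | apply: smN
  | apply: smM | apply: smX | apply: sm_sinF | apply: sm_cosF | apply: sm_entry ].

(** * The equation (1 - zeta) d_1 k + i (1 + zeta) d_2 k = f *)

Section Kernel.
Context {R : realType}.
Implicit Types V W : normedModType R.
Notation C := R[i].
Notation Re := complex.Re.
Notation Im := complex.Im.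
Notation P := (R * R * R * R)%type.

(* A point of [P] is (x_1, x_2, Re zeta, Im zeta). *)
Definition zeta (p : P) : C := p.1.2 +i* p.2.
Definition norm2 (z : C) : R := (Re z) ^+ 2 + (Im z) ^+ 2.
Definition UP : set P := [set p | norm2 (zeta p) < 1].
Definition eX1 : P := (1, 0, 0, 0).
Definition eX2 : P := (0, 1, 0, 0).
Definition eZ1 : P := (0, 0, 1, 0).
Definition eZ2 : P := (0, 0, 0, 1).

Definition cis (t : R) : C := cos t +i* sin t.
Definition cisJ (t : R) : C := cos t +i* - sin t.
(** The value of w + z conj(w) at w = exp(i t). *)
Definition den (z : C) (t : R) : C := cis t + z * cisJ t.
(* The point at polar coordinates (r, t) around (x_1, x_2), up to the sign. *)
Definition yarc (p : P) (r t : R) : (R * R)%type :=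
  (p.1.1.1 - r * cos t, p.1.1.2 - r * sin t).

Lemma cisK t : cis t * cisJ t = 1.
Proof. by apply: eqc; rewrite ?ReMc ?ImMc /=; [rewrite -(cos2Dsin2 t)|]; ring. Qed.

(** A zero would give exp(i t) = - z exp(- i t), hence |z| = 1 on comparing moduli. *)
Lemma den_neq0 z t : norm2 z < 1 -> den z t != 0.
Proof.
case: z => a b; rewrite /norm2 /= => H; apply/eqP => E.
have E1 : cos t + (a * cos t + b * sin t) = 0.
  by have := congr1 (@complex.Re R) E; rewrite ReDc ReMc /= => <-; ring.
have E2 : sin t + (b * cos t - a * sin t) = 0.
  by have := congr1 (@complex.Im R) E; rewrite ImDc ImMc /= => <-; ring.
have := cos2Dsin2 t.
have -> : cos t ^+ 2 + sin t ^+ 2 = (a ^+ 2 + b ^+ 2) * (cos t ^+ 2 + sin t ^+ 2).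
  have c1 : cos t = - (a * cos t + b * sin t) by apply/eqP; rewrite -addr_eq0 E1.
  have s1 : sin t = - (b * cos t - a * sin t) by apply/eqP; rewrite -addr_eq0 E2.
  by rewrite [in LHS]c1 [in X in _ + X = _]s1; ring.
by rewrite cos2Dsin2 mulr1 => H1; move: H; rewrite H1 ltxx.
Qed.

Lemma csm_cis V (U : set V) (F : V -> R) : open U -> sm U F -> csm U (fun x => cis (F x)).
Proof. by move=> oU sF; apply: csm_pair; solve_sm. Qed.

Lemma csm_cisJ V (U : set V) (F : V -> R) : open U -> sm U F -> csm U (fun x => cisJ (F x)).
Proof. by move=> oU sF; apply: csm_pair; solve_sm. Qed.

Lemma csm_den V (U : set V) (Z : V -> C) (F : V -> R) : open U -> csm U Z -> sm U F ->
  csm U (fun x => den (Z x) (F x)).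
Proof.
by move=> oU sZ sF; apply: csmD => //; [exact: csm_cis|apply: csmM => //; exact: csm_cisJ].
Qed.

Lemma cD_cis t : cD (1 : R) cis t = 'i%C * cis t.
Proof.
have [_ c] := is_derive_cos t; have [_ s] := is_derive_sin t.
by apply: eqc; rewrite /dvs ?ReMc ?ImMc /= ?c ?s; ring.
Qed.

Lemma cD_cisJ t : cD (1 : R) cisJ t = - 'i%C * cisJ t.
Proof.
have [_ c] := is_derive_cos t; have [ds s] := is_derive_sin t.
apply: eqc; rewrite /dvs ?ReMc ?ImMc /= ?c; first by ring.
by rewrite deriveN // s; ring.
Qed.

Lemma cD_rc V (F : V -> R) (v x : V) : cD v (fun x => (F x)%:C) x = ('D_v F x)%:C.
Proof. by apply: eqc; rewrite /dvs //= derive_cst. Qed.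

Let pi2 : R := pi *+ 2.

Lemma cis2pi : cis pi2 = 1.
Proof. by apply: eqc; rewrite /= ?cos2pi // sin_mulr2n sinpi mulr0 mul0rn. Qed.

Lemma cisJ2pi : cisJ pi2 = 1.
Proof. by apply: eqc; rewrite /= ?cos2pi // sin_mulr2n sinpi mulr0 mul0rn oppr0. Qed.

Lemma cis0 : cis 0 = 1. Proof. by apply: eqc; rewrite /= ?cos0 ?sin0. Qed.
Lemma cisJ0 : cisJ 0 = 1. Proof. by apply: eqc; rewrite /= ?cos0 ?sin0 ?oppr0. Qed.

Lemma pi2_gt0 : 0 < pi2. Proof. by rewrite pmulrn_lgt0 // pi_gt0. Qed.

(** This is - i times the logarithmic derivative of [den z] in the angle. Its integral over the
    circle is thus 2 pi times the winding number of [den z] around 0, which is 1 for |z| < 1. *)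
Definition arcA (z : C) (t : R) : C := (cis t - z * cisJ t) / den z t.

Lemma csm_arcA V (U : set V) (Z : V -> C) (F : V -> R) : open U ->
  (forall x, U x -> norm2 (Z x) < 1) -> csm U Z -> sm U F ->
  csm U (fun x => arcA (Z x) (F x)).
Proof.
move=> oU HZ sZ sF; apply: csmM => //.
  by apply: csmB => //; [exact: csm_cis|apply: csmM => //; exact: csm_cisJ].
by apply: csmV => //; [move=> x Ux; apply: den_neq0; exact: HZ|exact: csm_den].
Qed.

Lemma open_sm_lt V (F : V -> R) (a : R) : sm setT F -> open [set x | F x < a].
Proof.
move=> sF; apply: (@open_comp _ _ F [set y | y < a]); last exact: open_lt.
by move=> x _; apply: sm_continuous sF _.
Qed.

(* The average of [arcA z] over the circle does not depend on z : its z-derivative is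
   a derivative in the angle. *)
Lemma cint_arcA z : norm2 z < 1 -> cint 0 pi2 (arcA z) = pi2%:C.
Proof.
move=> z1.
(* [z] is deformed to 0 through t z; [U] is open and contains [-1, 1], so both ends t = 0 and t = 1
   are interior. *)
pose U : set R := [set t | t ^+ 2 * norm2 z < 1].
have oU : open U by apply: open_sm_lt; solve_sm.
have sz : csm (U `*` [set: R]) (fun q => q.1%:C * z).
  apply: csmM; [exact: open_setXT| |apply: csm_cst; exact: open_setXT].
  by apply: csm_rc; [exact: open_setXT|solve_sm].
have n2 t : norm2 (t%:C * z) = t ^+ 2 * norm2 z.
  by rewrite /norm2 ReMc ImMc /=; ring.
have oUT : open (U `*` [set: R]) by exact: open_setXT.
have Uz q : (U `*` [set: R]) q -> norm2 (q.1%:C * z) < 1 by move=> [/= Uq _]; rewrite n2.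
have s2 : sm (U `*` [set: R]) (fun q => q.2) by solve_sm.
have sA : csm (U `*` [set: R]) (fun q => arcA (q.1%:C * z) q.2) by exact: csm_arcA.
have [sJ dJ] := cint_param 0 pi2 (@findim_R R) oU sA.
set J := (fun x => cint 0 pi2 _) in sJ dJ.
have oR : open [set: R] by exact: openT.
have DJ t : U t -> cD (1 : R) J t = 0.
  move=> Ut; rewrite /cD dJ //=.
  have dn0 s : den (t%:C * z) s != 0 by apply: den_neq0; rewrite n2.
  (* By [cisK] the t-derivative of [arcA (t z)] is - 2 z / den ^ 2, and [B] is a primitive of it in
     the angle, with equal values at 0 and 2 pi. *)
  pose B (s : R) := (- 'i%C * z) * (cisJ s * (den (t%:C * z) s)^-1).
  have sc : csm setT cisJ by apply: csm_cisJ; solve_sm.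
  have sc' : csm setT cis by apply: csm_cis; solve_sm.
  have sd : csm setT (den (t%:C * z)).
    by apply: csm_den; [|exact: csm_cst|solve_sm].
  have sdV : csm setT (fun s => (den (t%:C * z) s)^-1) by apply: csmV.
  have sB0 : csm setT (fun s => cisJ s * (den (t%:C * z) s)^-1) by apply: csmM.
  have sB : csm setT B by apply: csmM => //; exact: csm_cst.
  have dB s : cD (1 : R) B s = - (2 * z) * (den (t%:C * z) s)^-1 ^+ 2.
    rewrite /B (cDZ _ _ oR sB0) // (cDM _ oR sc sdV) // (cDV _ oR (fun s _ => dn0 s) sd) //.
    rewrite cD_cisJ.
    have -> : cD (1 : R) (den (t%:C * z)) s = 'i%C * cis s - 'i%C * (t%:C * z) * cisJ s.
      rewrite (cDD _ sc' (csmM oR (csm_cst (t%:C * z) oR) sc)) // (cDZ _ _ oR sc) //.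
      by rewrite cD_cis cD_cisJ; ring.
    set D := (den _ s)^-1; set a := cis s; set b := cisJ s.
    have D2 : D = D ^+ 2 * (a + t%:C * z * b).
      by rewrite expr2 -mulrA -[a + _]/(den (t%:C * z) s) mulVf // mulr1.
    rewrite -exprVn -/D [in X in _ + X]D2.
    transitivity (('i%C ^+ 2) * (a * b) * (2 * z * D ^+ 2)); first by ring.
    by rewrite sqr_i cisK; ring.
  transitivity (cint 0 pi2 (cD (1 : R) B)).
    apply: eq_cint => s _; rewrite dB.
    have Uts : (U `*` [set: R]) (t, s) by [].
    have s1 : csm (U `*` [set: R]) (fun q => cis q.2) by exact: csm_cis.
    have s1' : csm (U `*` [set: R]) (fun q => cisJ q.2) by exact: csm_cisJ.
    have d1 : cD ((1, 0) : R * R) (fun q => cis q.2) (t, s) = 0.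
      by apply: cD_line_cst => h /=; rewrite scaler0 add0r.
    have d1' : cD ((1, 0) : R * R) (fun q => cisJ q.2) (t, s) = 0.
      by apply: cD_line_cst => h /=; rewrite scaler0 add0r.
    have dz : cD ((1, 0) : R * R) (fun q => q.1%:C * z) (t, s) = z.
      have st : csm (U `*` [set: R]) (fun q => q.1%:C) by apply: csm_rc => //; solve_sm.
      rewrite (cDM _ oUT st (csm_cst z oUT)) // cD_cst mulr0 add0r cD_rc.
      have -> : 'D_((1, 0) : R * R) (fun q : R * R => q.1) (t, s) = 1.
        by apply: derive_affine.
      by rewrite mulr1.
    have szc := csmM oUT sz s1'.
    have dzc : cD ((1, 0) : R * R) (fun q => (q.1%:C * z) * cisJ q.2) (t, s) = z * cisJ s.
      by rewrite (cDM _ oUT sz s1') // d1' dz mulr0 add0r mulrC.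
    have sden : csm (U `*` [set: R]) (fun q => den (q.1%:C * z) q.2) by exact: csm_den.
    have den0 q : (U `*` [set: R]) q -> den (q.1%:C * z) q.2 != 0.
      by move=> /Uz; exact: den_neq0.
    have dden : cD ((1, 0) : R * R) (fun q => den (q.1%:C * z) q.2) (t, s) = z * cisJ s.
      by rewrite (cDD _ s1 szc) // d1 dzc add0r.
    have snum : csm (U `*` [set: R]) (fun q => cis q.2 - (q.1%:C * z) * cisJ q.2) by exact: csmB.
    have dnum : cD ((1, 0) : R * R) (fun q => cis q.2 - (q.1%:C * z) * cisJ q.2) (t, s) = - (z * cisJ s).
      rewrite (cDD _ s1 (csmN oUT szc)) // d1 add0r.
      have -> : (fun q : R * R => - (q.1%:C * z * cisJ q.2)) = (fun q => (-1) * (q.1%:C * z * cisJ q.2)).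
        by apply/funext => q; rewrite mulN1r.
      by rewrite (cDZ _ _ oUT szc) // dzc mulN1r.
    rewrite -[LHS]/(cD ((1, 0) : R * R) (fun q => arcA (q.1%:C * z) q.2) (t, s)).
    rewrite /arcA (cDM _ oUT snum (csmV oUT den0 sden)) // (cDV _ oUT den0 sden) // dnum dden /=.
    rewrite -exprVn; set D := (den _ s)^-1; set a := cis s; set b := cisJ s.
    have D2 : D = D ^+ 2 * (a + t%:C * z * b).
      by rewrite expr2 -mulrA -[a + _]/(den (t%:C * z) s) mulVf // mulr1.
    rewrite [in X in _ + X]D2.
    transitivity ((a * b) * (- (2 * z) * D ^+ 2)); first by ring.
    by rewrite cisK mul1r.
  rewrite cint_FTC //; last exact: pi2_gt0.
  by rewrite /B /den cis2pi cisJ2pi cis0 cisJ0 subrr.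
have U1 t : `|t| <= 1 -> U t.
  move=> t1; rewrite /U /=; apply: le_lt_trans z1.
  rewrite ler_piMl ?addr_ge0 ?sqr_ge0 // -real_normK ?num_real //.
  by rewrite -(expr1n _ 2) lerXn2r ?nnegrE.
have J10 : J 1 = J 0.
  have H (t : R) : `|t| <= `|1 : R| -> U (0 + t *: 1).
    by rewrite normr1 => t1; rewrite add0r [t *: _]mulr1; exact: U1.
  have [sJ1 sJ2] := sJ.
  have [t t1 E1] := @mvt_line _ _ (fun x => Re (J x)) 0 (1 : R) 1
    (fun t t1 => sm_derivable sJ1 (H t t1)).
  have [s s1 E2] := @mvt_line _ _ (fun x => Im (J x)) 0 (1 : R) 1
    (fun t t1 => sm_derivable sJ2 (H t t1)).
  move: E1 E2; rewrite add0r [1 *: _]mulr1.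
  have /(congr1 (@complex.Re R)) /= -> := DJ _ (H t t1).
  have /(congr1 (@complex.Im R)) /= -> := DJ _ (H s s1).
  by rewrite !mulr0 => /eqP; rewrite subr_eq0 => /eqP E1 /eqP; rewrite subr_eq0 => /eqP E2;
    apply: eqc; [exact: E1|exact: E2].
have -> : cint 0 pi2 (arcA z) = J 1.
  by apply: eq_cint => s _ /=; rewrite mul1r.
rewrite J10 /J (@eq_cint _ _ _ _ (fun=> 1)).
  by rewrite cint_cst ?(ltW pi2_gt0) // subr0 mulr1.
move=> s _ /=; rewrite /arcA /den !mul0r subr0 addr0 divff //.
by apply/eqP => c0; have := cisK s; rewrite c0 mul0r => /esym/eqP; rewrite oner_eq0.
Qed.
End Kernel.

(** * The Cauchy-type kernel in polar coordinates *)

Section PolarKernel.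
Context {R : realType}.
Implicit Types V W : normedModType R.
Notation C := R[i].
Notation P := (R * R * R * R)%type.
Notation pi2 := (pi *+ 2 : R).
Notation UPT := (@UP R `*` [set: (R * R)%type]).

Lemma cD_dirD V (U : set V) (F : V -> C) u v x : csm U F -> U x ->
  cD (u + v) F x = cD u F x + cD v F x.
Proof.
by move=> sF Ux; have := cD_lin 1 1 u v sF Ux; rewrite !scale1r => ->; rewrite !mul1r.
Qed.

Lemma open_UP : open (@UP R).
Proof. by apply: open_sm_lt; solve_sm. Qed.

Lemma findim_P : findim P.
Proof. by do 3!(apply: findim_prod; last exact: findim_R); exact: findim_R. Qed.

(** The data may depend on the base point as well as on the integration point, which makes room for
    powers of [Wt]. By [gL] this dependence is invisible to the operator, and by [gH] it keeps
    holomorphy in zeta. *)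
Variable g : P * (R * R) -> C.
Hypothesis sg : csm UPT g.
Hypothesis gL : forall p y, UP p ->
  (1 - zeta p) * cD (eX1, 0) g (p, y) + 'i%C * (1 + zeta p) * cD (eX2, 0) g (p, y) = 0.
Hypothesis gH : forall p y, UP p -> cD (eZ2, 0) g (p, y) = 'i%C * cD (eZ1, 0) g (p, y).

Definition Harc (q : P * R * R) : P * (R * R) := (q.1.1, yarc q.1.1 q.1.2 q.2).
(* The Jacobian of polar coordinates cancels against the homogeneity of the kernel
   1 / (w + zeta conj(w)), w = rho exp(i t). *)
Definition Phi (q : P * R * R) : C := g (Harc q) * (den (zeta q.1.1) q.2)^-1.
Definition Kg (r : R) (p : P) : C :=
  cint 0 r (fun rho => cint 0 pi2 (fun t => Phi (p, rho, t))).

Notation D3 := ((@UP R `*` [set: R]) `*` [set: R]).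

Let oU := open_UP.
Let oU2 : open (@UP R `*` [set: R]). Proof. exact: open_setXT. Qed.
Let oU3 : open D3. Proof. exact: open_setXT. Qed.
Let oUT : open UPT.
Proof.
have -> : UPT = fst @^-1` (@UP R) by apply/seteqP; split => [p []|p].
by apply: open_comp => // p _; exact: cvg_fst.
Qed.

Lemma sm_Harc : sm D3 Harc.
Proof. by solve_sm. Qed.

Lemma findim_PP : findim (P * (R * R))%type.
Proof. by apply: findim_prod; [exact: findim_P|apply: findim_prod; exact: findim_R]. Qed.

Lemma csm_gH : csm D3 (fun q => g (Harc q)).
Proof.
apply: (csm_comp findim_PP oU3 oUT _ sm_Harc sg).
by move=> q [[? _] _].
Qed.

Lemma csm_zeta : csm D3 (fun q => zeta q.1.1).
Proof. by apply: csm_pair; solve_sm. Qed.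

Lemma csm_den3 : csm D3 (fun q => den (zeta q.1.1) q.2).
Proof. by apply: csm_den => //; [exact: csm_zeta|solve_sm]. Qed.

Lemma den3_neq0 (q : P * R * R) : D3 q -> den (zeta q.1.1) q.2 != 0.
Proof. by move=> [[Up _] _]; exact: den_neq0. Qed.

Lemma csm_Phi : csm D3 Phi.
Proof.
apply: csmM => //; first exact: csm_gH.
by apply: csmV => //; [exact: den3_neq0|exact: csm_den3].
Qed.

Lemma findim_PR : findim (P * R)%type.
Proof. by apply: findim_prod; [exact: findim_P|exact: findim_R]. Qed.

Lemma Kg_csm r : csm (@UP R) (Kg r) /\
  forall vs p, UP p -> cdvs vs (Kg r) p =
    cint 0 r (fun rho => cint 0 pi2 (fun t => cdvs (map (fun v => (v, 0, 0)) vs) Phi (p, rho, t))).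
Proof.
have [I1 I2] := cint_param 0 pi2 findim_PR oU2 csm_Phi.
have [K1 K2] := cint_param 0 r findim_P oU I1.
split=> // vs p Up; rewrite K2 //; apply: eq_cint => rho _.
by rewrite I2 // -map_comp.
Qed.

(** Moving the base point also moves the integration point, which is a translate of it: hence two
    derivatives of [g]. The denominator depends on zeta and the angle only. *)
Lemma cD_Phi_X (v : P) (w : R * R) p rho t : UP p ->
  (forall h : R, zeta (h *: v + p) = zeta p) ->
  (forall h : R, yarc (h *: v + p) rho t = h *: w + yarc p rho t) ->
  cD (v, 0, 0) Phi (p, rho, t) =
  (den (zeta p) t)^-1 * (cD (v, 0) g (p, yarc p rho t) + cD (0, w) g (p, yarc p rho t)).
Proof.
move=> Up zv yv; have D3q : D3 (p, rho, t) by [].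
have dV0 : cD (v, 0, 0) (fun q : P * R * R => (den (zeta q.1.1) q.2)^-1) (p, rho, t) = 0.
  by apply: cD_line_cst => h /=; rewrite !scaler0 !add0r zv.
rewrite (cDM _ oU3 csm_gH (csmV oU3 den3_neq0 csm_den3)) // dV0 mulr0 add0r.
have Tq : UPT (Harc (p, rho, t)) by [].
rewrite (cD_chain _ sm_Harc sg D3q Tq); congr (_ * _).
have -> : 'D_(v, 0, 0) Harc (p, rho, t) = (v, 0) + (0, w).
  apply: derive_affine => h; rewrite /Harc /= !scaler0 !add0r yv.
  by apply: injective_projections; rewrite /= ?addr0 ?add0r.
have Uq : UPT (Harc (p, rho, t)) by [].
exact: cD_dirD sg Uq.
Qed.

Lemma cD_Phi_Z p rho t : UP p ->
  cD (eZ2, 0, 0) Phi (p, rho, t) = 'i%C * cD (eZ1, 0, 0) Phi (p, rho, t).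
Proof.
move=> Up; have D3q : D3 (p, rho, t) by [].
have Tq : UPT (Harc (p, rho, t)) by [].
have dg v : (forall h : R, yarc (h *: v + p) rho t = yarc p rho t) ->
    cD (v, 0, 0) (fun q => g (Harc q)) (p, rho, t) = cD (v, 0) g (p, yarc p rho t).
  move=> yv; rewrite (cD_chain _ sm_Harc sg D3q Tq).
  suff -> : 'D_(v, 0, 0) Harc (p, rho, t) = (v, 0) by [].
  apply: derive_affine => h; rewrite /Harc /= !scaler0 !add0r yv.
  by apply: injective_projections; rewrite /= ?scaler0 ?add0r.
have sc : csm D3 (fun q => cisJ q.2) by apply: csm_cisJ; solve_sm.
have sc' : csm D3 (fun q => cis q.2) by apply: csm_cis; solve_sm.
have dc (v : P) : cD (v, 0, 0) (fun q : P * R * R => cisJ q.2) (p, rho, t) = 0.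
  by apply: cD_line_cst => h /=; rewrite !scaler0 !add0r.
have dc' (v : P) : cD (v, 0, 0) (fun q : P * R * R => cis q.2) (p, rho, t) = 0.
  by apply: cD_line_cst => h /=; rewrite !scaler0 !add0r.
have dz (v : P) : cD (v, 0, 0) (fun q : P * R * R => zeta q.1.1) (p, rho, t) = zeta v.
  by apply: eqc; apply: derive_affine.
have dd (v : P) : cD (v, 0, 0) (fun q => den (zeta q.1.1) q.2) (p, rho, t) = cisJ t * zeta v.
  rewrite (cDD _ sc' (csmM oU3 csm_zeta sc)) // dc' add0r.
  by rewrite (cDM _ oU3 csm_zeta sc) // dc dz mulr0 add0r.
have sdV := csmV oU3 den3_neq0 csm_den3.
rewrite !(cDM _ oU3 csm_gH sdV) // !(cDV _ oU3 den3_neq0 csm_den3) // !dd.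
rewrite !dg; [|by move=> h; rewrite /yarc /= !scaler0 !add0r..].
rewrite gH //= .
have -> : zeta eZ2 = 'i%C by [].
have -> : zeta eZ1 = 1 by [].
by ring.
Qed.

Definition Lg (v : P * R * R) (p : P) (rho : R) : C :=
  cint 0 pi2 (fun t => cD v Phi (p, rho, t)).

Lemma cD_Kg r v p : UP p -> cD v (Kg r) p = cint 0 r (Lg (v, 0, 0) p).
Proof. by move=> Up; have [_ H] := Kg_csm r; exact: (H [:: v]). Qed.

Lemma csm_Lg v p : UP p -> csm setT (Lg v p).
Proof.
move=> Up; have [I1 _] := cint_param 0 pi2 findim_PR oU2 (csm_cD v csm_Phi).
exact: csm_slice2 findim_P oU I1 Up.
Qed.

Lemma csm_cD_Phi_t v p rho : UP p -> csm setT (fun t => cD v Phi (p, rho, t)).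
Proof.
by move=> Up; exact: (csm_slice2 (x := (p, rho)) findim_PR oU2 (csm_cD v csm_Phi)).
Qed.

Lemma cD_Kg_Z r p : UP p -> cD eZ2 (Kg r) p = 'i%C * cD eZ1 (Kg r) p.
Proof.
move=> Up; rewrite !cD_Kg // -(cintZ 0 r 'i%C (csm_ccont (csm_Lg (eZ1, 0, 0) Up))).
apply: eq_cint => rho _; rewrite /Lg.
rewrite -(cintZ 0 pi2 'i%C (csm_ccont (csm_cD_Phi_t (eZ1, 0, 0) rho Up))).
by apply: eq_cint => t _; exact: cD_Phi_Z.
Qed.

Lemma cisE (t : R) : cis t = (cos t)%:C + 'i%C * (sin t)%:C.
Proof. by apply: eqc; rewrite ?ReDc ?ImDc ?ReMc ?ImMc /=; ring. Qed.

Lemma cisJE (t : R) : cisJ t = (cos t)%:C - 'i%C * (sin t)%:C.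
Proof.
have -> : - ('i%C * (sin t)%:C) = (-1) * ('i%C * (sin t)%:C) by rewrite mulN1r.
by apply: eqc; rewrite ?ReDc ?ImDc ?ReMc ?ImMc /=; ring.
Qed.

(** The operator divided by [den], in polar coordinates: the radial derivative has coefficient
    [arcA], whereas the coefficient of the angular derivative does not depend on the angle, so that
    this part integrates to 0 over the circle. *)
Lemma arc_identity (z D g1 g2 : C) (t : R) : D * den z t = 1 ->
  D * ((1 - z) * g1 + 'i%C * (1 + z) * g2) =
  (cis t - z * cisJ t) * D * ((cos t)%:C * g1 + (sin t)%:C * g2)
  - 'i%C * ((sin t)%:C * g1 - (cos t)%:C * g2).
Proof.
move=> HD; set c := (cos t)%:C; set s := (sin t)%:C.
have cs : c ^+ 2 + s ^+ 2 = 1.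
  apply: eqc; rewrite !expr2 ?ReDc ?ImDc ?ReMc ?ImMc /=; last by ring.
  by rewrite -(cos2Dsin2 t); ring.
have -> : 'i%C * (s * g1 - c * g2) = (D * den z t) * ('i%C * (s * g1 - c * g2)).
  by rewrite HD mul1r.
rewrite /den cisE cisJE -/c -/s.
transitivity (D * ((1 - z) * (c ^+ 2 + s ^+ 2) * g1 + 'i%C * (1 + z) * (c ^+ 2 + s ^+ 2) * g2)).
  by rewrite cs !mulr1.
(* For [ring] the imaginary unit is a mere letter; the relation i ^ 2 = -1 is therefore inserted by
   hand in the two places where it is used. *)
transitivity (D * ((1 - z) * (c ^+ 2 - 'i%C ^+ 2 * s ^+ 2) * g1 +
   ('i%C * (1 + z) * (c ^+ 2 + s ^+ 2) + (1 + 'i%C ^+ 2) * ((1 - z) * (c * s))) * g2)).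
  by rewrite sqr_i subrr mul0r addr0 mulN1r opprK.
by ring.
Qed.

Lemma arc_algebra (z rho g1 g2 G1 G2 : C) (t : R) : den z t != 0 -> rho != 0 ->
  (1 - z) * G1 + 'i%C * (1 + z) * G2 = 0 ->
  (1 - z) * ((den z t)^-1 * (G1 + g1)) + 'i%C * (1 + z) * ((den z t)^-1 * (G2 + g2)) =
  -1 * (arcA z t * - ((cos t)%:C * g1 + (sin t)%:C * g2)) +
  - 'i%C / rho * (rho * ((sin t)%:C * g1 - (cos t)%:C * g2)).
Proof.
move=> dn0 rho0 G0; have gE := arc_identity g1 g2 (mulVf dn0).
rewrite /arcA; set D := (den z t)^-1 in gE *.
transitivity (D * ((1 - z) * G1 + 'i%C * (1 + z) * G2) +
  D * ((1 - z) * g1 + 'i%C * (1 + z) * g2)); first by ring.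
rewrite G0 mulr0 add0r gE.
transitivity ((cis t - z * cisJ t) * D * ((cos t)%:C * g1 + (sin t)%:C * g2) -
   'i%C * (rho^-1 * rho) * ((sin t)%:C * g1 - (cos t)%:C * g2)).
  by rewrite mulVf // mulr1.
by ring.
Qed.

Definition eY1 : P * (R * R) := (0, (1, 0)).
Definition eY2 : P * (R * R) := (0, (0, 1)).

Lemma cD_g_pair p y (a b : R) : UP p ->
  cD ((0, (a, b)) : P * (R * R)) g (p, y) = a%:C * cD eY1 g (p, y) + b%:C * cD eY2 g (p, y).
Proof.
move=> Up; have Tq : UPT (p, y) by [].
have -> : ((0, (a, b)) : P * (R * R)) = a *: eY1 + b *: eY2; last exact: cD_lin sg Tq.
apply: injective_projections; rewrite /= ?scaler0 ?addr0 //.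
apply: injective_projections; rewrite /= ?scaler0 ?addr0 ?add0r //.
  by rewrite [_ *: _]mulr1.
by rewrite [_ *: _]mulr1.
Qed.

Lemma derive_cosM (a r t : R) : 'D_1 (fun t : R => a - r * cos t) t = r * sin t.
Proof.
have [_ E] := is_deriveB (is_derive_cst a t (1 : R)) (is_deriveZ r (is_derive_cos t)).
by rewrite -[LHS]/('D_1 (cst a - r \*: cos) t) E sub0r scalerN opprK.
Qed.

Lemma derive_sinM (a r t : R) : 'D_1 (fun t : R => a - r * sin t) t = - (r * cos t).
Proof.
have [_ E] := is_deriveB (is_derive_cst a t (1 : R)) (is_deriveZ r (is_derive_sin t)).
by rewrite -[LHS]/('D_1 (cst a - r \*: sin) t) E sub0r.
Qed.

Lemma zeta_eX (v : P) p h : zeta v = 0 -> zeta (h *: v + p) = zeta p.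
Proof.
move=> [v1 v2]; apply: eqc => /=; rewrite ?v1 ?v2 scaler0 add0r //.
Qed.

Lemma yarc_eX (v : P) p rho t h : yarc (h *: v + p) rho t = h *: v.1.1 + yarc p rho t.
Proof. by apply: injective_projections; rewrite /= addrA. Qed.

(* Polar coordinates around the base point turn the integrand of the equation into
   an exact derivative. *)
Lemma cD_Kg_X r p : UP p -> 0 < r -> (forall t, g (p, yarc p r t) = 0) ->
  (1 - zeta p) * cD eX1 (Kg r) p + 'i%C * (1 + zeta p) * cD eX2 (Kg r) p =
  pi2%:C * g (p, p.1.1).
Proof.
move=> Up r0 gr; rewrite !cD_Kg //.
set z := zeta p.
have oTT : open ([set: R] `*` [set: R]) by apply: open_setXT; exact: openT.
have oR : open [set: R] by exact: openT.
have smap : sm ([set: R] `*` [set: R]) (fun q => (p, yarc p q.1 q.2)) by solve_sm.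
have sGm : csm ([set: R] `*` [set: R]) (fun q => g (p, yarc p q.1 q.2)).
  by apply: (csm_comp findim_PP oTT oUT _ smap sg).
have sAm : csm ([set: R] `*` [set: R]) (fun q => arcA z q.2).
  by apply: csm_arcA => //; [exact: csm_cst|solve_sm].
pose MF (q : R * R) := arcA z q.2 * g (p, yarc p q.1 q.2).
have sMF : csm ([set: R] `*` [set: R]) MF by exact: csmM.
(* [M] is the circle integral of the data with weight [arcA]: it vanishes at radius [r] by [gr], and
   at radius 0 it is 2 pi times the value at the centre, by [cint_arcA]. *)
pose M rho := cint 0 pi2 (fun t => MF (rho, t)).
have [sM dM] : csm setT M /\ _ := cint_param 0 pi2 (@findim_R R) oR sMF.
transitivity (cint 0 r (fun rho => (-1) * cD (1 : R) M rho)).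
  have c0 v : ccont (Lg v p) by exact: csm_ccont (csm_Lg v Up).
  have cZ k v : csm setT (fun rho => k * Lg v p rho).
    by apply: csmM => //; [exact: csm_cst|exact: csm_Lg].
  rewrite -(cintZ _ _ _ (c0 (eX1, 0, 0))) -(cintZ _ _ _ (c0 (eX2, 0, 0))).
  rewrite -(cintD _ _ (csm_ccont (cZ _ _)) (csm_ccont (cZ _ _))).
  (* The radius 0 is excluded because the angular term carries a factor 1 / rho. *)
  apply: eq_cint_oc.
  - by apply: csm_ccont; exact: csmD.
  - by apply: csm_ccont; apply: csmM => //; [exact: csm_cst|exact: csm_cD].
  move=> rho /andP[rho0 _].
  have rhoC0 : rho%:C != 0 by apply/eqP => /complexI rho00; move: rho0; rewrite rho00 ltxx.
  have c1 v : ccont (fun t => cD v Phi (p, rho, t)) by exact: csm_ccont (csm_cD_Phi_t v rho Up).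
  have cZ1 k v : csm setT (fun t => k * cD v Phi (p, rho, t)).
    by apply: csmM => //; [exact: csm_cst|exact: csm_cD_Phi_t].
  rewrite /Lg -(cintZ _ _ _ (c1 (eX1, 0, 0))) -(cintZ _ _ _ (c1 (eX2, 0, 0))).
  rewrite -(cintD _ _ (csm_ccont (cZ1 _ _)) (csm_ccont (cZ1 _ _))).
  pose Gt (t : R) := g (p, yarc p rho t).
  have sGt : csm setT Gt by exact: (csm_slice2 (x := rho) (@findim_R R) oR sGm).
  have sMFt : csm setT (fun t => cD ((1, 0) : R * R) MF (rho, t)).
    exact: (csm_slice2 (x := rho) (@findim_R R) oR (csm_cD ((1, 0) : R * R) sMF)).
  have dGt t : cD (1 : R) Gt t = rho%:C *
      ((sin t)%:C * cD eY1 g (p, yarc p rho t) - (cos t)%:C * cD eY2 g (p, yarc p rho t)).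
    have sc : sm setT (fun t : R => (p, yarc p rho t)) by solve_sm.
    have Tq : UPT (p, yarc p rho t) by [].
    rewrite (cD_chain (1 : R) sc sg I Tq).
    have [dc c] := is_derive_cos t; have [ds s] := is_derive_sin t.
    have dc' := (derivable1_diffP _ _).1 dc; have ds' := (derivable1_diffP _ _).1 ds.
    have -> : 'D_1 (fun t : R => (p, yarc p rho t)) t = (0, (rho * sin t, - (rho * cos t))).
      have d1 : sm setT (fun t : R => p.1.1.1 - rho * cos t) by solve_sm.
      have d2 : sm setT (fun t : R => p.1.1.2 - rho * sin t) by solve_sm.
      have {}d1 := sm_differentiable d1 (I : [set: R] t).
      have {}d2 := sm_differentiable d2 (I : [set: R] t).
      rewrite (derive_pair _ (differentiable_cst p t) (differentiable_pair d1 d2)).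
      by rewrite (derive_pair _ d1 d2) derive_cst derive_cosM derive_sinM.
    rewrite cD_g_pair // rmorphN !rmorphM /= mulNr -!mulrA mulrBr.
    by [].
  have dMF t : cD ((1, 0) : R * R) MF (rho, t) = arcA z t *
      (- ((cos t)%:C * cD eY1 g (p, yarc p rho t) + (sin t)%:C * cD eY2 g (p, yarc p rho t))).
    have Tq : UPT (p, yarc p rho t) by [].
    have dA : cD ((1, 0) : R * R) (fun q : R * R => arcA z q.2) (rho, t) = 0.
      by apply: cD_line_cst => h /=; rewrite !scaler0 !add0r.
    rewrite (cDM _ oTT sAm sGm) // dA mulr0 addr0; congr (_ * _).
    rewrite (cD_chain _ smap sg _ Tq) //.
    have -> : 'D_(1, 0) (fun q : R * R => (p, yarc p q.1 q.2)) (rho, t) = (0, (- cos t, - sin t)).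
      apply: derive_affine => h; rewrite /= scaler0 add0r [h *: 1]mulr1 /yarc.
      apply: injective_projections; rewrite /= ?scaler0 ?add0r //.
      by apply: injective_projections; rewrite /= /GRing.scale /=; ring.
    by rewrite cD_g_pair // !rmorphN /= !mulNr opprD.
  transitivity (cint 0 pi2 (fun t => (-1) * cD ((1, 0) : R * R) MF (rho, t) +
      (- 'i%C * (rho%:C)^-1) * cD (1 : R) Gt t)).
    apply: eq_cint => t _; rewrite dGt dMF.
    have dd := den_neq0 t Up.
    rewrite (@cD_Phi_X eX1 (1, 0)) //; [|by move=> h; exact: zeta_eX|by move=> h; exact: yarc_eX].
    rewrite (@cD_Phi_X eX2 (0, 1)) //; [|by move=> h; exact: zeta_eX|by move=> h; exact: yarc_eX].
    rewrite -/eY1 -/eY2 -/z.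
    exact: (arc_algebra _ _ dd rhoC0 (gL (yarc p rho t) Up)).
  rewrite cintD; last 2 first.
  - by apply: csm_ccont; apply: csmM => //; exact: csm_cst.
  - by apply: csm_ccont; apply: csmM => //; [exact: csm_cst|exact: csm_cD].
  rewrite !cintZ; last 2 first.
  - by apply: csm_ccont; exact: csm_cD.
  - exact: csm_ccont.
  rewrite (cint_FTC (@pi2_gt0 R) sGt).
  (* The angular term is the integral of a derivative over a full period. *)
  have -> : Gt pi2 - Gt 0 = 0.
    by rewrite /Gt /yarc cos2pi cos0 sin_mulr2n sinpi mulr0 mul0rn sin0 subrr.
  rewrite mulr0 addr0; congr (_ * _).
  by rewrite /cD dM.
rewrite cintZ; last by apply: csm_ccont; exact: csm_cD.
rewrite cint_FTC //.
have -> : M r = 0.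
  rewrite /M (@eq_cint _ _ _ _ (fun=> 0)) ?cint_cst ?mulr0 ?(ltW (@pi2_gt0 R)) //.
  by move=> t _; rewrite /MF /= gr mulr0.
have -> : M 0 = pi2%:C * g (p, p.1.1).
  rewrite /M (@eq_cint _ _ _ _ (fun t => g (p, p.1.1) * arcA z t)).
    rewrite cintZ; first by rewrite (cint_arcA Up) mulrC.
    apply: csm_ccont; apply: csm_arcA => //; [exact: csm_cst|solve_sm].
  move=> t _; rewrite /MF /yarc /= !mul0r !subr0 mulrC.
  by case: p.1.1.
by rewrite sub0r mulN1r opprK.
Qed.

End PolarKernel.

(** * Smooth cutoff functions *)

Section Cutoff.
Context {R : realType}.
Implicit Types V W : normedModType R.

(** The polynomial in 1 / t makes exp(- 1 / t) part of a family stable under derivation: [p] becomes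
    X ^ 2 (p - p'). *)
Definition flat (p : {poly R}) (t : R) : R :=
  if 0 < t then p.[t^-1] * expR (- t^-1) else 0.

(** Each monomial satisfies s ^ n <= n! exp(s), by one term of the exponential series. *)
Lemma poly_expR_bound (p : {poly R}) :
  exists2 B, 0 <= B & forall s, 0 <= s -> `|p.[s] * expR (- s)| <= B.
Proof.
exists (\sum_(i < size p) `|p`_i| * (i`!)%:R); first by apply: sumr_ge0 => i _; rewrite mulr_ge0.
move=> s s0; rewrite normrM [X in _ * X]ger0_norm ?expR_ge0 // horner_coef.
rewrite -ler_pdivlMr ?expR_gt0 // -expRN opprK mulr_suml.
apply: le_trans (ler_norm_sum _ _ _) _; apply: ler_sum => i _.
rewrite normrM -mulrA ler_wpM2l // ger0_norm ?exprn_ge0 //.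
case: (val i) => [|n]; first by rewrite expr0 fact0 mul1r -{1}expR0 ler_expR.
rewrite mulrC -ler_pdivrMr ?ltr0n ?fact_gt0 //.
by apply: le_trans (expR_ge1Dxn n s0); rewrite lerDr.
Qed.

Lemma is_derive_flat p t : is_derive t (1 : R) (flat p) (flat ('X^2 * (p - p^`())) t).
Proof.
have [t0|t0|->] := ltgtP t 0.
- have E : \forall z \near t, (cst 0 : R -> R) z = flat p z.
    near=> z; rewrite /flat ifF //; apply/negbTE; rewrite -leNgt.
    by near: z; apply: (open_near (@open_lt R 0) t0) => y /ltW.
  rewrite /flat ifF; last by apply/negbTE; rewrite -leNgt ltW.
  exact: near_eq_is_derive E (is_derive_cst 0 t 1).
- have E : \forall z \near t, (fun z : R => p.[z^-1] * expR (- z^-1)) z = flat p z.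
    near=> z; rewrite /flat ifT //.
    by near: z; apply: (open_near (@open_gt R 0) t0) => y.
  have tn0 : t != 0 by rewrite gt_eqF.
  have dV : is_derive t (1 : R) (fun z : R => z^-1) (- t^-2).
    by apply: DeriveDef; [exact: derivableV|rewrite deriveV // derive_id /GRing.scale /= mulr1].
  have dp : is_derive t (1 : R) (fun z : R => p.[z^-1]) (p^`().[t^-1] * - t^-2).
    by apply: (@is_derive1_comp _ (horner p) (fun z : R => z^-1)).
  have de : is_derive t (1 : R) (fun z : R => expR (- z^-1)) (expR (- t^-1) * - - t^-2).
    by apply: (@is_derive1_comp _ expR (fun z : R => - z^-1)).
  rewrite /flat t0.
  apply: (near_eq_is_derive E).
  have := is_deriveM dp de.
  congr (is_derive _ _ _ _); rewrite /GRing.scale /= !hornerE /=.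
  by rewrite -exprVn; ring.
- have -> : flat ('X^2 * (p - p^`())) 0 = 0 by rewrite /flat ltxx.
  (* At 0 the difference quotient for h > 0 is h times the function of 1 / h attached to X ^ 2 p,
     which is bounded. *)
  have [B B0 HB] := poly_expR_bound ('X^2 * p).
  have C : h^-1 *: (flat p (h *: 1 + 0) - flat p 0) @[h --> 0^'] --> (0 : R).
    apply/cvgr0Pnorm_le => e e0; near=> h.
    have h0 : h != 0 by near: h; exact: nbhs_dnbhs_neq.
    rewrite addr0 [h *: 1]mulr1 /flat ltxx subr0; case: ifPn => [hgt0|]; last first.
      by rewrite scaler0 normr0 ltW.
    have := HB h^-1; rewrite invr_ge0 (ltW hgt0) => /(_ isT).
    rewrite !hornerE /= => H.
    have -> : h^-1 *: (p.[h^-1] * expR (- h^-1)) = h * ((h^-1 ^+ 2 * p.[h^-1]) * expR (- h^-1)).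
      by rewrite /GRing.scale /=; field.
    rewrite normrM; apply: le_trans (_ : `|h| * B <= _); first by rewrite ler_wpM2l.
    apply: le_trans (_ : `|h| * (B + 1) <= _); first by rewrite ler_wpM2l // lerDl.
    rewrite -ler_pdivlMr ?ltr_wpDl //.
    by near: h; apply: dnbhs0_le; rewrite divr_gt0 // ltr_wpDl.
  by apply: DeriveDef; [apply/cvg_ex; exists 0|exact: cvg_lim C].
Unshelve. all: by end_near. Qed.

Lemma sm_flat p : sm setT (flat p).
Proof.
apply: (@sm_coind1 _ _ (fun F => exists p, F = flat p)) => //; last by exists p.
- exact: openT.
- move=> _ v [q ->]; exists (v *: q); apply/funext => t; rewrite /flat hornerZ.
  by case: ifP; rewrite ?mulr0 ?mulrA.
- move=> _ [q ->]; exists (flat ('X^2 * (q - q^`()))); first by eexists.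
  by move=> t _; exact: is_derive_flat.
Qed.

Definition step (t : R) : R := flat 1 t * (flat 1 t + flat 1 (1 - t))^-1.

Lemma flat1_ge0 t : 0 <= flat 1 t.
Proof. by rewrite /flat; case: ifP => // _; rewrite hornerE mul1r expR_ge0. Qed.

Lemma flat1_gt0 t : 0 < t -> 0 < flat 1 t.
Proof. by rewrite /flat => ->; rewrite hornerE mul1r expR_gt0. Qed.

Lemma flat1_le0 t : t <= 0 -> flat 1 t = 0.
Proof. by rewrite /flat leNgt => /negbTE ->. Qed.

Lemma step_den t : flat 1 t + flat 1 (1 - t) != 0.
Proof.
apply: lt0r_neq0; have [t0|t0] := ltP 0 t.
  by rewrite ltr_pwDl ?flat1_gt0 ?flat1_ge0.
by rewrite ltr_pwDr ?flat1_ge0 // flat1_gt0 // subr_gt0 (le_lt_trans t0).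
Qed.

Lemma step_le0 t : t <= 0 -> step t = 0.
Proof. by move=> t0; rewrite /step flat1_le0 // mul0r. Qed.

Lemma step_ge1 t : 1 <= t -> step t = 1.
Proof.
move=> t1; have := step_den t; rewrite /step (@flat1_le0 (1 - t)) ?subr_le0 // addr0.
by move=> ?; rewrite divff.
Qed.

Lemma sm_step V (U : set V) (F : V -> R) : open U -> sm U F -> sm U (fun x => step (F x)).
Proof.
move=> oU sF.
have sf (G : V -> R) : sm U G -> sm U (fun x => flat 1 (G x)).
  move=> sG; apply: (@sm_comp _ _ _ _ setT G (flat 1)) => //; first exact: findim_R.
    exact: openT.
  exact: sm_flat.
apply: smM => //; first exact: sf.
apply: smV => //; first by move=> x _; exact: step_den.
by apply: smD => //; apply: sf => //; apply: smB => //; exact: sm_cst.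
Qed.

End Cutoff.

(** * Decay of the derivatives of high powers *)

Section PowerDecay.
Context {R : realType}.
Implicit Types V W : normedModType R.
Notation C := R[i].
Notation Re := complex.Re.
Notation Im := complex.Im.

Definition nc (z : C) : R := ComplexField.Normc.normc z.

Lemma ncE z : nc z = Num.sqrt (norm2 z). Proof. by case: z. Qed.
Lemma nc_ge0 z : 0 <= nc z. Proof. by rewrite ncE sqrtr_ge0. Qed.
Lemma ncM x y : nc (x * y) = nc x * nc y. Proof. exact: ComplexField.Normc.normcM. Qed.
Lemma ncD x y : nc (x + y) <= nc x + nc y. Proof. exact: le_normcD. Qed.
Lemma ncN x : nc (- x) = nc x. Proof. exact: normcN. Qed.
Lemma nc0 : nc 0 = 0. Proof. exact: ComplexField.Normc.normc0. Qed.
Lemma nc1 : nc 1 = 1. Proof. exact: ComplexField.Normc.normc1. Qed.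
Lemma ncX x n : nc (x ^+ n) = nc x ^+ n.
Proof. by elim: n => [|n IH]; rewrite ?nc1 // !exprS ncM IH. Qed.
Lemma nc_rc (a : R) : nc a%:C = `|a|.
Proof. by rewrite ncE /norm2 /= expr0n /= addr0 sqrtr_sqr. Qed.

Lemma norm_Re_le z : `|Re z| <= nc z.
Proof.
by rewrite ncE -sqrtr_sqr ler_wsqrtr // /norm2 lerDl sqr_ge0.
Qed.

Lemma norm_Im_le z : `|Im z| <= nc z.
Proof.
by rewrite ncE -sqrtr_sqr ler_wsqrtr // /norm2 lerDr sqr_ge0.
Qed.

Lemma nc_le z : nc z <= `|Re z| + `|Im z|.
Proof.
rewrite ncE -[leRHS]ger0_norm ?addr_ge0 // -sqrtr_sqr ler_wsqrtr // /norm2.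
rewrite sqrrD !real_normK ?num_real //.
by rewrite lerD2r lerDl mulrn_wge0 // mulr_ge0.
Qed.

Lemma sm_bounded V (U K : set V) (F : V -> R) : sm U F -> compact K -> K `<=` U ->
  exists M, forall x, K x -> `|F x| <= M.
Proof.
move=> sF cK KU.
have : compact (F @` K).
  apply: continuous_compact => //; apply: continuous_in_subspaceT => x /set_mem Kx.
  by apply: sm_continuous sF _; exact: KU.
move=> /compact_bounded[M [_ HM]]; exists (M + 1) => x Kx.
by apply: (HM (M + 1)); [rewrite ltrDl|exists x].
Qed.

Lemma csm_bounded V (U K : set V) (F : V -> C) : csm U F -> compact K -> K `<=` U ->
  exists2 M, 0 <= M & forall x, K x -> nc (F x) <= M.
Proof.
move=> [F1 F2] cK KU; have [M1 H1] := sm_bounded F1 cK KU; have [M2 H2] := sm_bounded F2 cK KU.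
exists (`|M1| + `|M2|) => [|x Kx]; first by rewrite addr_ge0.
apply: le_trans (nc_le _) _; rewrite lerD //.
  by rewrite (le_trans (H1 x Kx)) // ler_norm.
by rewrite (le_trans (H2 x Kx)) // ler_norm.
Qed.

(** Growth slower than every exponential: this class contains the constants and absorbs the
    exponents that differentiation of a power brings down. *)
Definition subgeo (c : nat -> R) :=
  forall s, 0 < s -> s < 1 -> exists B, forall N, `|c N| * s ^+ N <= B.

Lemma bernoulli_ge (x : R) n : 0 <= x -> 1 + n%:R * x <= (1 + x) ^+ n.
Proof.
move=> x0; elim: n => [|n IH]; first by rewrite mul0r addr0 expr0.
rewrite exprS; apply: le_trans (_ : (1 + x) * (1 + n%:R * x) <= _).
  rewrite -[n.+1%:R]natr1 mulrDl mul1r mulrDr mulr1.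
  have : 0 <= x * (n%:R * x) by rewrite !mulr_ge0.
  lra.
by rewrite ler_wpM2l // addr_ge0.
Qed.

Lemma sqrt_lt01 (s : R) : 0 < s -> s < 1 -> 0 < Num.sqrt s /\ Num.sqrt s < 1.
Proof. by move=> s0 s1; rewrite sqrtr_gt0 s0; split=> //; rewrite -sqrtr1 ltr_sqrt. Qed.

Lemma natr_geo (s : R) : 0 < s -> s < 1 -> exists B, forall N, N%:R * s ^+ N <= B.
Proof.
move=> s0 s1; pose x := s^-1 - 1.
have x0 : 0 < x by rewrite subr_gt0 invf_gt1.
exists x^-1 => N; have := bernoulli_ge N (ltW x0).
rewrite [1 + x](_ : _ = s^-1); last by rewrite /x; ring.
rewrite exprVn => H; rewrite -ler_pdivlMr ?invr_gt0 ?exprn_gt0 //.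
rewrite -[x^-1 / _]mulrC; rewrite ler_pdivlMr //.
apply: le_trans H.
by rewrite lerDr.
Qed.

(** With s = r ^ 2, one factor r ^ N absorbs [c] and the other one absorbs N. *)
Lemma subgeo_mul c l : subgeo c -> subgeo (fun N => c N * (N - l)%:R).
Proof.
move=> sc s s0 s1; have [r0 r1] := sqrt_lt01 s0 s1.
have [B HB] := sc _ r0 r1; have [D HD] := natr_geo r0 r1.
exists (`|B| * `|D|) => N.
rewrite -[s in s ^+ N](sqr_sqrtr (ltW s0)) -exprM mulnC exprM expr2 normrM.
rewrite [X in X * _ <= _]mulrC.
have -> : `|(N - l)%:R| * `|c N| * (Num.sqrt s ^+ N * Num.sqrt s ^+ N) =
  (`|c N| * Num.sqrt s ^+ N) * (`|(N - l)%:R| * Num.sqrt s ^+ N) by ring.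
apply: ler_pM; rewrite ?mulr_ge0 ?exprn_ge0 ?(ltW r0) //.
  exact: le_trans (HB N) (ler_norm _).
apply: le_trans (ler_norm D); apply: le_trans (HD N).
by rewrite ler_wpM2r ?exprn_ge0 ?(ltW r0) // normr_nat ler_nat leq_subr.
Qed.

Lemma subgeo_small c (q A e : R) l : subgeo c -> 0 < q -> q < 1 -> 0 <= A -> 0 < e ->
  \forall N \near \oo, `|c N| * A * q ^+ (N - l) <= e.
Proof.
move=> sc q0 q1 A0 e0; have [r0 r1] := sqrt_lt01 q0 q1.
have [B HB] := sc _ r0 r1.
have ql : 0 < q ^+ l by rewrite exprn_gt0.
(* With r = sqrt(q), one factor r ^ N bounds [c] and goes into [D], the other tends to 0; the
   summand 1 only makes [D] positive. *)
pose D := `|B| * A / q ^+ l + 1.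
have qlV : 0 <= (q ^+ l)^-1 by rewrite invr_ge0 ltW.
have D0 : 0 < D by rewrite ltr_wpDl // !mulr_ge0.
have c0 : (fun N => Num.sqrt q ^+ N) @ \oo --> (0 : R).
  by apply: cvg_expr; rewrite ger0_norm // ltW.
have /cvgr0Pnorm_le /(_ (e / D)) c1 := c0.
near=> N.
have lN : (l <= N)%N by near: N; exact: nbhs_infty_ge.
have sN : Num.sqrt q ^+ N <= e / D.
  apply: le_trans (ler_norm _) _; near: N; apply: c1; exact: divr_gt0.
have -> : `|c N| * A * q ^+ (N - l) = (`|c N| * Num.sqrt q ^+ N) * (A / q ^+ l) * Num.sqrt q ^+ N.
  have -> : q ^+ (N - l) = q ^+ N / q ^+ l by rewrite -{2}(subnK lN) exprD mulfK // gt_eqF.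
  rewrite -[q in q ^+ N](sqr_sqrtr (ltW q0)) -exprM mulnC exprM expr2.
  by ring.
apply: le_trans (_ : D * (e / D) <= _); last by rewrite mulrC divfK // gt_eqF.
apply: ler_pM; rewrite ?exprn_ge0 ?(ltW r0) //.
  by rewrite !mulr_ge0 ?exprn_ge0 ?invr_ge0 ?(ltW r0) // ltW.
rewrite /D -[X in _ <= X + 1]mulrA; apply: le_trans (_ : `|B| * (A / q ^+ l) <= _); last by rewrite lerDl.
rewrite ler_wpM2r ?mulr_ge0 ?invr_ge0 ?(ltW ql) //.
exact: le_trans (HB N) (ler_norm _).
Unshelve. all: by end_near. Qed.

Lemma cdvs_add V (U : set V) (F G : V -> C) vs x : open U -> csm U F -> csm U G -> U x ->
  cdvs vs (fun x => F x + G x) x = cdvs vs F x + cdvs vs G x.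
Proof.
move=> oU; elim: vs F G => [|v vs IH] F G sF sG Ux.
  by apply: eqc; rewrite /= ?ReDc ?ImDc.
rewrite -[LHS]/(cdvs vs (cD v (fun x => F x + G x)) x).
rewrite (@cdvs_eq_on _ _ U _ (fun x => cD v F x + cD v G x)) //; first last.
  by move=> y Uy; rewrite (cDD _ sF sG).
by rewrite IH //; exact: csm_cD.
Qed.

Section Decay.
Variables (V : normedModType R) (U K Z : set V) (W : V -> C) (q : R).
Hypotheses (oU : open U) (oZ : open Z) (cK : compact K) (KU : K `<=` U).
Hypotheses (q0 : 0 < q) (q1 : q < 1) (sW : csm U W).
Hypothesis Wq : forall x, K x -> ~ Z x -> nc (W x) <= q.

(* On [Z] the factor [phi] vanishes, elsewhere [W] is small ; differentiating only costs
   powers of the exponent. *)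
Lemma power_decay vs phi c l e : csm U phi -> (forall x, Z x -> phi x = 0) ->
  subgeo c -> 0 < e ->
  \forall N \near \oo, forall x, K x ->
    nc (cdvs vs (fun x => (c N)%:C * phi x * W x ^+ (N - l)) x) <= e.
Proof.
elim: vs phi c l e => [|v vs IH] phi c l e sphi phiZ sc e0.
  have [A A0 HA] := csm_bounded sphi cK KU.
  apply: filterS (subgeo_small l sc q0 q1 A0 e0) => N HN x Kx.
  have -> : cdvs [::] (fun x => (c N)%:C * phi x * W x ^+ (N - l)) x =
      (c N)%:C * phi x * W x ^+ (N - l) by apply: eqc.
  have [Zx|Zx] := pselect (Z x).
    by rewrite phiZ // mulr0 mul0r nc0 ltW.
  rewrite !ncM ncX nc_rc; apply: le_trans HN.
  apply: ler_pM; rewrite ?mulr_ge0 ?exprn_ge0 ?nc_ge0 //.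
    by rewrite ler_wpM2l // HA.
  by rewrite lerXn2r ?nnegrE ?nc_ge0 ?(ltW q0) // Wq.
have sWD : csm U (fun x => phi x * cD v W x) by apply: csmM => //; exact: csm_cD.
have ZD x : Z x -> cD v phi x = 0.
  move=> Zx; rewrite -[RHS](cD_cst 0 v x); apply: (cdvs_eq_on _ oZ) => //.
have ZWD x : Z x -> phi x * cD v W x = 0 by move=> Zx; rewrite phiZ // mul0r.
have e20 : 0 < e / 2 by rewrite divr_gt0.
have H1 := IH _ _ l _ (csm_cD v sphi) ZD sc e20.
have H2 := IH _ _ l.+1 _ sWD ZWD (subgeo_mul l sc) e20.
apply: filterS2 H1 H2 => N H1 H2 x Kx.
have Ux := KU Kx.
have sX k : csm U (fun x => W x ^+ k) by exact: csmX.
have sk (k : R) G : csm U G -> csm U (fun x => k%:C * G x).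
  by move=> sG; apply: csmM => //; exact: csm_cst.
(* The Leibniz rule reproduces the shape of the statement twice: with the derivative of [phi], which
   still vanishes on the open set [Z], and with phi times the derivative of [W], coefficient c N (N
   - l) and shift l + 1. Truncated subtraction is consistent, as this coefficient is 0 for N <=
   l. *)
have E : cdvs (v :: vs) (fun x => (c N)%:C * phi x * W x ^+ (N - l)) x =
   cdvs vs (fun x => (c N)%:C * cD v phi x * W x ^+ (N - l)) x +
   cdvs vs (fun x => (c N * (N - l)%:R)%:C * (phi x * cD v W x) * W x ^+ (N - l.+1)) x.
  rewrite -(cdvs_add _ oU); first last.
  - exact: Ux.
  - by apply: csmM => //; exact: sk.
  - by apply: csmM => //; apply: sk; exact: csm_cD.
  rewrite -[LHS]/(cdvs vs (cD v (fun x => (c N)%:C * phi x * W x ^+ (N - l))) x).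
  apply: (cdvs_eq_on _ oU) => // y Uy.
  rewrite (cDM _ oU (sk _ _ sphi) (sX _)) // (cDZ _ _ oU sphi) // (cDX _ _ oU sW) //.
  by rewrite subnS rmorphM /= rmorph_nat; ring.
rewrite E; apply: le_trans (ncD _ _) _; rewrite [e]splitr lerD //; first exact: H1.
exact: H2.
Qed.

End Decay.
End PowerDecay.

(** * Annular pieces of the data and the correcting factor *)

Section Pieces.
Context {R : realType}.
Implicit Types V W : normedModType R.
Notation C := R[i].
Notation P := (R * R * R * R)%type.
Notation UPT := (@UP R `*` [set: (R * R)%type]).

Definition zc (y : R * R) : C := y.1 +i* y.2.
Definition zcJ (y : R * R) : C := y.1 +i* - y.2.
Definition n2y (y : R * R) : R := y.1 ^+ 2 + y.2 ^+ 2.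
Definition uu (z : C) (y : R * R) : C := zc y + z * zcJ y.
(** A smooth substitute for 1 / y. With 1 / y itself, [Wt] would be u(p) / y - zeta conj(y) / y,
    whose modulus tends to |zeta| < 1 when y goes to infinity. *)
Definition Qt (y : R * R) : C := zcJ y * ((1 + n2y y)^-1)%:C.
(* [Wt (p, y)] is 1 when [y] is the base point of [p]; it depends on [p] only through
   zeta and u = z + zeta conj(z), hence [gg_L] and [gg_H]. *)
Definition Wt (a : P * (R * R)) : C :=
  1 + (uu (zeta a.1) a.1.1.1 - uu (zeta a.1) a.2) * Qt a.2.

Lemma n2y_ge0 y : 0 <= n2y y. Proof. by rewrite addr_ge0 ?sqr_ge0. Qed.

Lemma n2y1_neq0 y : 1 + n2y y != 0.
Proof. by apply: lt0r_neq0; rewrite ltr_pwDl ?n2y_ge0. Qed.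

Lemma sm_n2y V (U : set V) (F : V -> R * R) : open U -> sm U F -> sm U (fun x => n2y (F x)).
Proof. by move=> oU sF; solve_sm. Qed.

Lemma csm_Wt V (U : set V) (F : V -> P) (G : V -> R * R) : open U -> sm U F -> sm U G ->
  csm U (fun x => Wt (F x, G x)).
Proof.
move=> oU sF sG.
have sz : csm U (fun x => zeta (F x)) by apply: csm_pair; solve_sm.
have szc (H : V -> R * R) : sm U H -> csm U (fun x => zc (H x)).
  by move=> sH; apply: csm_pair; solve_sm.
have szcJ (H : V -> R * R) : sm U H -> csm U (fun x => zcJ (H x)).
  by move=> sH; apply: csm_pair; solve_sm.
have su (H : V -> R * R) : sm U H -> csm U (fun x => uu (zeta (F x)) (H x)).
  by move=> sH; apply: csmD => //; [exact: szc|apply: csmM => //; exact: szcJ].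
apply: csmD => //; first exact: csm_cst.
apply: csmM => //.
  by apply: csmB => //; apply: su => //; solve_sm.
apply: csmM => //; first exact: szcJ.
apply: csm_rc => //; apply: smV => //; first by move=> x _; exact: n2y1_neq0.
by apply: smD => //; [exact: sm_cst|exact: sm_n2y].
Qed.

Lemma cD_affine V (F : V -> C) v w x : (forall h : R, F (h *: v + x) = h%:C * w + F x) ->
  cD v F x = w.
Proof.
move=> H; apply: eqc; apply: derive_affine => h; rewrite H ?ReDc ?ImDc ?ReMc ?ImMc /=;
  by rewrite /GRing.scale /=; ring.
Qed.

(* The growth of [T] makes [Wt] smaller than 1 - 1 / (8 (r + 1)) in modulus over [KK r], see [Wt_small]. *)
Definition T (r : nat) : R := ((32 * r.+1 ^ 2)%:R) ^+ 2.
Definition Theta (r : nat) (y : R * R) : R := 1 - step (n2y y - T r.+1).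
(** Differences of successive cutoffs, so that sums telescope. For r > 0 the piece lives where T r <
    |y|^2 < T (r + 1) + 1: the lower bound is the range of [Wt_small], the upper one makes the
    radial integral finite. The piece 0 is a whole disk and gets no smallness estimate. *)
Definition chi (r : nat) (y : R * R) : R :=
  if r is s.+1 then Theta r y - Theta s y else Theta r y.

Lemma T_le r s : (r <= s)%N -> T r <= T s.
Proof.
move=> rs; rewrite /T lerXn2r ?nnegrE ?ler0n // ler_nat.
by rewrite leq_mul2l /= leq_exp2r // ltnS.
Qed.

Lemma chi_near r y : (0 < r)%N -> n2y y <= T r -> chi r y = 0.
Proof.
case: r => // r _ yT; rewrite /chi /Theta !step_le0 ?subrr ?subr_le0 //.
by apply: le_trans yT (T_le _).
Qed.

Lemma chi_far r y : T r.+1 + 1 <= n2y y -> chi r y = 0.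
Proof.
move=> yT; have H s : (s <= r)%N -> Theta s y = 0.
  move=> sr; rewrite /Theta step_ge1 ?subrr // lerBrDr addrC.
  by apply: le_trans yT; rewrite lerD2r T_le.
by case: r H {yT} => [|r] H; rewrite /chi !H // subrr.
Qed.

Lemma sum_chi J y : n2y y <= T J.+1 -> \sum_(r < J.+1) chi r y = 1.
Proof.
move=> yT; have -> : \sum_(r < J.+1) chi r y = Theta J y.
  elim: J {yT} => [|J IH]; first by rewrite big_ord1.
  by rewrite big_ord_recr /= IH addrC subrK.
by rewrite /Theta step_le0 ?subr0 // subr_le0.
Qed.

Lemma sm_chi V (U : set V) (F : V -> R * R) r : open U -> sm U F -> sm U (fun x => chi r (F x)).
Proof.
move=> oU sF; have sT s : sm U (fun x => Theta s (F x)).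
  apply: smB => //; first exact: sm_cst.
  by apply: sm_step => //; apply: smB => //; [exact: sm_n2y|exact: sm_cst].
by case: r => [|r]; [exact: sT|apply: smB].
Qed.

Variable f : R * R -> R.
Hypothesis sf : sm setT f.

Definition phi (r : nat) (y : R * R) : R := chi r y * f y.
Definition gg (r N : nat) (a : P * (R * R)) : C := (phi r a.2)%:C * Wt a ^+ N.

Lemma sm_fF V (U : set V) (F : V -> R * R) : open U -> sm U F -> sm U (fun x => f (F x)).
Proof.
move=> oU sF; apply: (@sm_comp _ _ _ _ setT F f) => //; last exact: openT.
by apply: findim_prod; exact: findim_R.
Qed.

Lemma csm_phi V (U : set V) (F : V -> R * R) r : open U -> sm U F ->
  csm U (fun x => (phi r (F x))%:C).
Proof.
by move=> oU sF; apply: csm_rc => //; apply: smM => //; [exact: sm_chi|exact: sm_fF].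
Qed.

Lemma open_UPT : open UPT.
Proof.
have -> : UPT = fst @^-1` (@UP R) by apply/seteqP; split => [p []|p].
by apply: open_comp; [move=> p _; exact: cvg_fst|exact: open_UP].
Qed.

Lemma csm_Wt0 : csm UPT Wt.
Proof.
have := @csm_Wt _ UPT fst snd open_UPT (sm_fst open_UPT (sm_id open_UPT)) (sm_snd open_UPT (sm_id open_UPT)).
by apply: csm_eq_on; [exact: open_UPT|case].
Qed.

Lemma csm_phi0 r : csm UPT (fun a => (phi r a.2)%:C).
Proof. by apply: csm_phi; [exact: open_UPT|exact: sm_snd open_UPT (sm_id open_UPT)]. Qed.

Lemma csm_gg r N : csm UPT (gg r N).
Proof.
apply: csmM; [exact: open_UPT|exact: csm_phi0|apply: csmX; [exact: open_UPT|exact: csm_Wt0]].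
Qed.

Lemma cD_gg r N (v : P) p y : UP p ->
  cD (v, 0) (gg r N) (p, y) =
  (phi r y)%:C * (N%:R * Wt (p, y) ^+ N.-1) * cD (v, 0) Wt (p, y).
Proof.
move=> Up; have Tq : UPT (p, y) by [].
have d0 : cD (v, 0) (fun a : P * (R * R) => (phi r a.2)%:C) (p, y) = 0.
  by apply: cD_line_cst => h /=; rewrite scaler0 add0r.
have sX := csmX N open_UPT csm_Wt0.
rewrite (cDM _ open_UPT (csm_phi0 r) sX Tq) d0 mulr0 addr0.
by rewrite (cDX N _ open_UPT csm_Wt0 Tq) /= mulrA.
Qed.

Lemma cD_Wt_X1 p y : cD (eX1, 0) Wt (p, y) = (1 + zeta p) * Qt y.
Proof.
apply: cD_affine => h; rewrite /Wt /= !scaler0 !add0r.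
have -> : zeta (h *: eX1 + p) = zeta p by apply: zeta_eX.
have -> : uu (zeta p) (h *: (1, 0) + p.1.1) = h%:C * (1 + zeta p) + uu (zeta p) p.1.1.
  rewrite /uu; have -> : zc (h *: (1, 0) + p.1.1) = h%:C + zc p.1.1.
    by apply: eqc; rewrite ?ReDc ?ImDc /= ?scaler0 ?[h *: 1]mulr1.
  have -> : zcJ (h *: (1, 0) + p.1.1) = h%:C + zcJ p.1.1.
    by apply: eqc; rewrite ?ReDc ?ImDc /= ?scaler0 ?[h *: 1]mulr1 ?add0r.
  by ring.
by ring.
Qed.

Lemma cD_Wt_X2 p y : cD (eX2, 0) Wt (p, y) = 'i%C * (1 - zeta p) * Qt y.
Proof.
apply: cD_affine => h; rewrite /Wt /= !scaler0 !add0r.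
have -> : zeta (h *: eX2 + p) = zeta p by apply: zeta_eX.
have -> : uu (zeta p) (h *: (0, 1) + p.1.1) = h%:C * ('i%C * (1 - zeta p)) + uu (zeta p) p.1.1.
  rewrite /uu; have -> : zc (h *: (0, 1) + p.1.1) = h%:C * 'i%C + zc p.1.1.
    by apply: eqc; rewrite ?ReDc ?ImDc ?ReMc ?ImMc /= ?scaler0 ?[h *: 1]mulr1; ring.
  have -> : zcJ (h *: (0, 1) + p.1.1) = - (h%:C * 'i%C) + zcJ p.1.1.
    rewrite -mulrN; apply: eqc; rewrite ?ReDc ?ImDc ?ReMc ?ImMc /= ?scaler0 ?[h *: 1]mulr1; ring.
  by ring.
by ring.
Qed.

Lemma zeta_affine h (v p : P) : zeta (h *: v + p) = h%:C * zeta v + zeta p.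
Proof.
by apply: eqc; rewrite ?ReDc ?ImDc ?ReMc ?ImMc /= /GRing.scale /=; ring.
Qed.

Lemma cD_Wt_Z (v : P) p y : v.1.1 = 0 ->
  cD (v, 0) Wt (p, y) = zeta v * ((zcJ p.1.1 - zcJ y) * Qt y).
Proof.
move=> v0; apply: cD_affine => h; rewrite /Wt /= !scaler0 !add0r v0 scaler0 add0r zeta_affine.
by rewrite /uu; ring.
Qed.

Lemma gg_L r N p y : UP p ->
  (1 - zeta p) * cD (eX1, 0) (gg r N) (p, y) + 'i%C * (1 + zeta p) * cD (eX2, 0) (gg r N) (p, y) = 0.
Proof.
move=> Up; rewrite !cD_gg // cD_Wt_X1 cD_Wt_X2.
set k := (phi r y)%:C * _; set z := zeta p; set Q := Qt y.
transitivity ((1 + 'i%C ^+ 2) * ((1 - z) * (1 + z) * k * Q)); first by ring.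
by rewrite sqr_i subrr mul0r.
Qed.

Lemma gg_H r N p y : UP p -> cD (eZ2, 0) (gg r N) (p, y) = 'i%C * cD (eZ1, 0) (gg r N) (p, y).
Proof.
move=> Up; rewrite !cD_gg // !cD_Wt_Z //.
have -> : zeta eZ2 = 'i%C by [].
have -> : zeta eZ1 = 1 by [].
set k := (phi r y)%:C * _; set Q := Qt y; by ring.
Qed.

Lemma gg_diag r N p : gg r N (p, p.1.1) = (phi r p.1.1)%:C.
Proof. by rewrite /gg /Wt /= subrr mul0r addr0 expr1n mulr1. Qed.

(** With x the base point and w the vector of polar coordinates [rho], [t], the difference of the
    two sides is |2 x - w| ^ 2 / 2. *)
Lemma n2y_yarc (p : P) rho t : rho ^+ 2 / 2 - n2y p.1.1 <= n2y (yarc p rho t).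
Proof.
rewrite /n2y /yarc /=; set a := p.1.1.1; set b := p.1.1.2.
have := cos2Dsin2 t; set c := cos t; set s := sin t => cs.
have : 0 <= (a *+ 2 - rho * c) ^+ 2 + (b *+ 2 - rho * s) ^+ 2 by rewrite addr_ge0 ?sqr_ge0.
have -> : rho ^+ 2 = (rho * c) ^+ 2 + (rho * s) ^+ 2 by rewrite !exprMn -mulrDr cs mulr1.
move=> H; rewrite -subr_ge0.
have -> : (a - rho * c) ^+ 2 + (b - rho * s) ^+ 2 -
    (((rho * c) ^+ 2 + (rho * s) ^+ 2) / 2 - (a ^+ 2 + b ^+ 2)) =
    2^-1 * ((a *+ 2 - rho * c) ^+ 2 + (b *+ 2 - rho * s) ^+ 2) by field.
by rewrite mulr_ge0.
Qed.

(** A radius past which the circles around a base point with |x|^2 <= M miss the piece r. The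
    summand 2 ensures rho >= 2, hence rho ^ 2 / 2 >= rho, and the bound can be linear instead of a
    square root. *)
Definition rad (r : nat) (M : R) : R := 2 * (M + T r.+1 + 1) + 2.

Lemma T_ge0 r : 0 <= T r. Proof. by rewrite sqr_ge0. Qed.

Lemma gg_far r N (p : P) M rho t : n2y p.1.1 <= M -> rad r M <= rho ->
  gg r N (p, yarc p rho t) = 0.
Proof.
move=> pM rM; rewrite /gg /phi /= chi_far ?mul0r //.
apply: le_trans (n2y_yarc p rho t).
have T0 := T_ge0 r.+1; have p0 := n2y_ge0 p.1.1.
have r2 : 2 <= rho by apply: le_trans rM; rewrite /rad; lra.
have : rho * 2 <= rho ^+ 2 by rewrite expr2 ler_wpM2l //; lra.
by move: rM; rewrite /rad; lra.
Qed.

End Pieces.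

(** * Estimates for the correcting factor and for integrals *)

Section Estimates.
Context {R : realType}.
Implicit Types V W : normedModType R.
Notation C := R[i].
Notation P := (R * R * R * R)%type.
Notation UPT := (@UP R `*` [set: (R * R)%type]).
Notation pi2 := (pi *+ 2 : R).
Notation mu := (@lebesgue_measure R).
Notation D3 := ((@UP R `*` [set: R]) `*` [set: R]).
Notation Re := complex.Re.
Notation Im := complex.Im.

(** A compact exhaustion of [UP]; the distance of zeta to the unit circle is controlled by the same
    index as the size of x, since one index r governs piece, compact set and rate. *)
Definition KK (r : nat) : set P :=
  [set p | [/\ `|p.1.1.1| <= r%:R, `|p.1.1.2| <= r%:R & norm2 (zeta p) <= 1 - r.+1%:R^-1]].

Lemma KK_UP r : KK r `<=` @UP R.
Proof.
move=> p [_ _ H]; apply: le_lt_trans H _.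
by rewrite ltrBlDr ltrDl invr_gt0.
Qed.

Lemma closed_sm_le V (F : V -> R) (a : R) : sm setT F -> closed [set x | F x <= a].
Proof.
move=> sF; apply: (@closed_comp _ _ F [set y | y <= a]); last exact: closed_le.
by move=> x _; apply: sm_continuous sF _.
Qed.

Lemma KK_compact r : compact (KK r).
Proof.
pose B : set P := ((`[- r%:R, r%:R]%classic `*` `[- r%:R, r%:R]%classic) `*` `[- 1, 1]%classic) `*` `[- 1, 1]%classic.
apply: (@subclosed_compact _ _ B).
- have -> : KK r = [set p : P | p.1.1.1 <= r%:R] `&` [set p : P | - p.1.1.1 <= r%:R] `&`
      [set p : P | p.1.1.2 <= r%:R] `&` [set p : P | - p.1.1.2 <= r%:R] `&`
      [set p | norm2 (zeta p) <= 1 - r.+1%:R^-1].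
    apply/seteqP; split => p /=.
      by move=> [+ + H]; rewrite !ler_norml => /andP[? ?] /andP[? ?]; repeat split => //; rewrite lerNl.
    by move=> [[[[h1 h2] h3] h4] h5]; split=> //; rewrite ler_norml lerNl; apply/andP.
  do 4!(apply: closedI; first (repeat apply: closedI); try by apply: closed_sm_le; solve_sm).
- by repeat apply: compact_setX; exact: segment_compact.
- move=> p [+ + H]; rewrite !ler_norml => h1 h2.
  have r1 : norm2 (zeta p) <= 1.
    by apply: le_trans H _; rewrite lerBlDr lerDl invr_ge0.
  have H1 (a b : R) : a ^+ 2 + b ^+ 2 <= 1 -> -1 <= a <= 1.
    move=> ab; rewrite -ler_norml -(@ler_pXn2r _ 2) ?nnegrE // real_normK ?num_real // expr1n.
    by apply: le_trans ab; rewrite lerDl sqr_ge0.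
  repeat split; rewrite /= in_itv //=; first exact: H1 r1.
  by apply: (H1 _ p.1.2); rewrite addrC.
Qed.

(** Multiplied by 1 + |y|^2, [Wt] becomes 1 - zeta conj(y)^2 + u(x) conj(y). The quadratic term is
    at most (1 - d) |y|^2, and for |y| above the threshold a part of the gain d |y|^2 absorbs the
    linear term. *)
Lemma Wt_small r p (y : R * R) : KK r p -> T r <= n2y y -> nc (Wt (p, y)) <= 1 - (8 * r.+1%:R)^-1.
Proof.
move=> [x1 x2 zp] yT; pose r1 : R := r.+1%:R.
have r11 : 1 <= r1 by rewrite ler1n.
have r10 : 0 < r1 by apply: lt_le_trans r11.
(* On [KK r] one has |zeta|^2 <= 1 - 2 d <= (1 - d)^2; the gain claimed in the end is d / 4. *)
pose d := (2 * r1)^-1.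
have d0 : 0 < d by rewrite invr_gt0 mulr_gt0.
have dr : d * r1 = 2^-1 by rewrite /d; field; rewrite gt_eqF.
pose z := zeta p; pose Z := nc z; pose Y := nc (zc y); pose X := nc (zc p.1.1).
have Y2 : Y ^+ 2 = n2y y by rewrite /Y ncE sqr_sqrtr ?addr_ge0 ?sqr_ge0.
have YJ : nc (zcJ y) = Y by rewrite /Y !ncE /norm2 /= sqrrN.
have Z0 : 0 <= Z := nc_ge0 _; have Y0 : 0 <= Y := nc_ge0 _; have X0 : 0 <= X := nc_ge0 _.
have Z2 : Z ^+ 2 = norm2 z by rewrite /Z ncE sqr_sqrtr ?addr_ge0 ?sqr_ge0.
have d1 : d <= 2^-1 by rewrite -dr ler_peMr // ltW.
have Zd : Z <= 1 - d.
  rewrite -(@ler_pXn2r _ 2) ?nnegrE //; last by lra.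
  rewrite Z2; apply: le_trans zp _.
  have -> : (r.+1%:R)^-1 = d *+ 2 :> R by rewrite -/r1 /d mulr2n; field; rewrite gt_eqF.
  by rewrite sqrrB expr1n mul1r lerDl sqr_ge0.
have YT : 32 * r1 ^+ 2 <= Y.
  have r2 : 0 <= 32 * r1 ^+ 2 by rewrite mulr_ge0 ?sqr_ge0.
  rewrite -(@ler_pXn2r _ 2) ?nnegrE //.
  by rewrite Y2; apply: le_trans yT; rewrite /T natrM natrX.
have Xr : X <= 2 * r1.
  have r2 : 0 <= 2 * r1 by rewrite mulr_ge0 // ltW.
  rewrite -(@ler_pXn2r _ 2) ?nnegrE //.
  have -> : X ^+ 2 = p.1.1.1 ^+ 2 + p.1.1.2 ^+ 2 by rewrite /X ncE sqr_sqrtr ?addr_ge0 ?sqr_ge0.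
  have sq (a : R) : `|a| <= r%:R -> a ^+ 2 <= r1 ^+ 2.
    move=> ar; rewrite -[a ^+ 2]real_normK ?num_real //.
    rewrite ler_pXn2r ?nnegrE ?(ltW r10) //; apply: le_trans ar _.
    by rewrite /r1 ler_nat.
  by have := sq _ x1; have := sq _ x2; have := sqr_ge0 r1; lra.
have JE : zc y * zcJ y = (n2y y)%:C.
  by apply: eqc; rewrite ?ReMc ?ImMc /= /n2y; ring.
have n1 : (1 + n2y y)%:C * ((1 + n2y y)^-1)%:C = 1.
  by rewrite -rmorphM /= divff ?n2y1_neq0.
have -> : Wt (p, y) = ((1 + n2y y)^-1)%:C * (1 - z * zcJ y ^+ 2 + uu z p.1.1 * zcJ y).
  rewrite /Wt /Qt /= -/z.
  transitivity ((1 + n2y y)%:C * ((1 + n2y y)^-1)%:C +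
     (uu z p.1.1 - uu z y) * (zcJ y * ((1 + n2y y)^-1)%:C)); first by rewrite n1.
  by rewrite rmorphD /= -JE /uu; ring.
have n0 : 0 < 1 + n2y y by rewrite ltr_pwDl ?n2y_ge0.
rewrite ncM nc_rc ger0_norm ?invr_ge0 ?(ltW n0) // mulrC ler_pdivrMr //.
have B1 : nc (1 - z * zcJ y ^+ 2 + uu z p.1.1 * zcJ y) <= 1 + Z * Y ^+ 2 + (X + Z * X) * Y.
  apply: le_trans (ncD _ _) _; apply: lerD.
    by apply: le_trans (ncD _ _) _; rewrite nc1 ncN ncM ncX YJ.
  rewrite ncM YJ ler_wpM2r //; apply: le_trans (ncD _ _) _.
  by rewrite ncM lerD2l ler_wpM2l // /X !ncE /norm2 /= sqrrN.
apply: le_trans B1 _; rewrite -Y2.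
have -> : (8 * r.+1%:R)^-1 = d / 4 :> R by rewrite -/r1 /d; field; rewrite gt_eqF.
have A1 : Z * Y ^+ 2 <= (1 - d) * Y ^+ 2 by rewrite ler_wpM2r ?sqr_ge0.
have A2 : (X + Z * X) * Y <= 4 * r1 * Y.
  rewrite ler_wpM2r //; have : Z * X <= 1 * X by rewrite ler_wpM2r //; lra.
  by lra.
have A3 : 32 * r1 ^+ 2 * Y <= Y ^+ 2 by rewrite expr2 ler_wpM2r.
have A4 : 1 <= Y ^+ 2.
  have r12 : 1 <= r1 ^+ 2 by rewrite exprn_ege1.
  by apply: exprn_ege1; lra.
(* Origin of the constant 32 in [T]: with |y| >= 32 r1 ^ 2, d |y|^2 is at least four times the bound
   4 r1 |y| of the linear term. *)
have A5 : d * (32 * r1 ^+ 2 * Y) = 16 * r1 * Y.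
  have -> : d * (32 * r1 ^+ 2 * Y) = 32 * (d * r1) * r1 * Y by ring.
  by rewrite dr; field.
have A6 : d * (32 * r1 ^+ 2 * Y) <= d * Y ^+ 2 by rewrite ler_wpM2l // ltW.
have A7 : d * 1 <= d * Y ^+ 2 by rewrite ler_wpM2l // ltW.
by lra.
Qed.

(** Real and imaginary parts are estimated separately, hence the factor 2. *)
Lemma nc_cint_le a b (F : R -> C) B : ccont F -> a <= b ->
  (forall t, a <= t <= b -> nc (F t) <= B) -> nc (cint a b F) <= 2 * ((b - a) * B).
Proof.
move=> [F1 F2] ab FB.
have H (h : R -> R) : continuous h -> (forall t, a <= t <= b -> `|h t| <= B) ->
    `|\int[mu]_(t in `[a, b]) h t| <= (b - a) * B.
  move=> ch hB; have ih := continuous_integrable_itv a b ch.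
  apply: le_trans (le_normr_Rintegral _ ih) _ => //.
  rewrite -(Rintegral_cst_itv B ab); apply: le_Rintegral => //.
  - exact: (integrable_norm ih).
  - by apply: continuous_integrable_itv => t; exact: cvg_cst.
apply: le_trans (nc_le _) _; rewrite mulr_natl mulr2n lerD //=; apply: H => // t tab.
  exact: le_trans (norm_Re_le _) (FB t tab).
exact: le_trans (norm_Im_le _) (FB t tab).
Qed.

Lemma cint_extend a b c (F : R -> C) : ccont F -> a <= b -> b <= c ->
  (forall t, b <= t -> F t = 0) -> cint a b F = cint a c F.
Proof.
move=> [F1 F2] ab bc F0.
have H (h : R -> R) : continuous h -> (forall t, b <= t -> h t = 0) ->
    \int[mu]_(t in `[a, b]) h t = \int[mu]_(t in `[a, c]) h t.
  move=> ch h0.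
  have E : `[a, c]%classic = `[a, b]%classic `|` `]b, c]%classic.
    by apply: itv_bndbnd_setU; rewrite bnd_simp.
  rewrite E Rintegral_setU //; last 2 first.
  - by rewrite -E; exact: continuous_integrable_itv.
  - apply/disj_setPS => t [] /=; rewrite !in_itv /= => /andP[_ tb] /andP[bt _].
    by move: (le_lt_trans tb bt); rewrite ltxx.
  rewrite [X in _ = _ + X](_ : _ = 0) ?addr0 //.
  rewrite (@eq_Rintegral _ _ _ mu _ (cst 0)) ?Rintegral_cst ?mul0r // => t.
  by rewrite inE /= in_itv /= => /andP[/ltW /h0].
by apply: eqc => /=; apply: H => // t /F0 ->.
Qed.

End Estimates.

(** * The solution attached to one annular piece *)

Section Solution.
Context {R : realType}.
Implicit Types V W : normedModType R.
Notation C := R[i].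
Notation P := (R * R * R * R)%type.
Notation UPT := (@UP R `*` [set: (R * R)%type]).
Notation pi2 := (pi *+ 2 : R).
Notation D3 := ((@UP R `*` [set: R]) `*` [set: R]).
Notation Re := complex.Re.
Notation Im := complex.Im.

Variable f : R * R -> R.
Hypothesis sf : sm setT f.

Let sg r N : csm UPT (gg f r N) := csm_gg sf r N.
Let gL r N p y (Up : UP p) := gg_L sf r N y Up.

Definition kr (r N : nat) (p : P) : C := Kg (gg f r N) (rad r (n2y p.1.1 + 1)) p.

Definition OM (M : R) : set P := @UP R `&` [set p | n2y p.1.1 < M].

Lemma open_OM M : open (OM M).
Proof. by apply: openI; [exact: open_UP|apply: open_sm_lt; apply: sm_n2y; solve_sm]. Qed.

Lemma rad_gt0 r (M : R) : 0 <= M -> 0 < rad r M.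
Proof. by move=> M0; have := @T_ge0 R r.+1; rewrite /rad; lra. Qed.

Lemma rad_le r (M M' : R) : M <= M' -> rad r M <= rad r M'.
Proof. by move=> MM; rewrite /rad; lra. Qed.

Lemma kr_OM r N M p : OM M p -> kr r N p = Kg (gg f r N) (rad r (M + 1)) p.
Proof.
move=> [Up pM]; rewrite /kr /Kg; have n0 := n2y_ge0 p.1.1.
have [I1 _] := cint_param 0 pi2 findim_PR (open_setXT open_UP) (csm_Phi (sg r N)).
apply: cint_extend.
- exact: csm_ccont (csm_slice2 findim_P open_UP I1 Up).
- by rewrite ltW // rad_gt0 // addr_ge0.
- by rewrite rad_le // lerD2r ltW.
move=> rho rr; rewrite (@eq_cint _ _ _ _ (fun=> 0)) ?cint_cst ?mulr0 ?(ltW (@pi2_gt0 R)) //.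
move=> t _; rewrite /Phi /Harc /= (gg_far _ _ _ _ rr) ?mul0r //.
by rewrite lerDl.
Qed.

Lemma cdvs_kr r N M vs p : OM M p ->
  cdvs vs (kr r N) p = cdvs vs (Kg (gg f r N) (rad r (M + 1))) p.
Proof.
by move=> Op; apply: (cdvs_eq_on _ (@open_OM M)) => // q; exact: kr_OM.
Qed.

Lemma cD_kr r N M v p : OM M p ->
  cD v (kr r N) p = cD v (Kg (gg f r N) (rad r (M + 1))) p.
Proof. exact: cdvs_kr. Qed.

Lemma csm_local V (U : set V) (F : V -> C) :
  (forall x, U x -> exists2 A : set V, A x & csm A F) -> csm U F.
Proof. by move=> H; split; apply: sm_local => x /H[A Ax [F1 F2]]; exists A. Qed.

Lemma OM_self (p : P) : UP p -> OM (n2y p.1.1 + 1) p.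
Proof. by move=> Up; split=> //=; rewrite ltrDl. Qed.

Lemma csm_kr r N : csm (@UP R) (kr r N).
Proof.
apply: csm_local => p Up; exists (OM (n2y p.1.1 + 1)); first exact: OM_self.
have [K1 _] := Kg_csm (sg r N) (rad r (n2y p.1.1 + 1 + 1)).
apply: (csm_eq_on (@open_OM _) _ (csm_subset _ K1)); first by move=> q /kr_OM ->.
by move=> q [].
Qed.

Lemma kr_X r N p : UP p ->
  (1 - zeta p) * cD eX1 (kr r N) p + 'i%C * (1 + zeta p) * cD eX2 (kr r N) p =
  pi2%:C * (phi f r p.1.1)%:C.
Proof.
move=> Up; have Op := OM_self Up; rewrite (cD_kr r N eX1 Op) (cD_kr r N eX2 Op).
rewrite (cD_Kg_X (sg r N) (@gL r N) Up) ?gg_diag //.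
  by rewrite rad_gt0 // !addr_ge0 // sqr_ge0.
by move=> t; apply: (gg_far _ _ _ (M := n2y p.1.1 + 1 + 1)) => //; rewrite -addrA lerDl.
Qed.

Lemma kr_Z r N p : UP p -> cD eZ2 (kr r N) p = 'i%C * cD eZ1 (kr r N) p.
Proof.
move=> Up; have Op := OM_self Up; rewrite (cD_kr r N eZ1 Op) (cD_kr r N eZ2 Op).
by apply: (cD_Kg_Z (sg r N)) => // q y Uq; exact: gg_H.
Qed.

(** Derivatives pass under the integral, and [power_decay] bounds the integrand uniformly on a
    compact set of triples (p, rho, t). *)
Lemma kr_small r vs (e : R) : (0 < r)%N -> 0 < e ->
  \forall N \near \oo, forall p, KK r p -> nc (cdvs vs (kr r N) p) <= e.
Proof.
(* On [KK r] both coordinates are at most r in absolute value, so |x|^2 <= 2 r ^ 2 < M and one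
   radius serves for the whole compact set. *)
move=> r0 e0; pose M : R := 2 * r%:R ^+ 2 + 1; pose R0 := rad r (M + 1).
have M0 : 0 <= M by rewrite addr_ge0 // mulr_ge0 // sqr_ge0.
have R00 : 0 < R0 by rewrite rad_gt0 // addr_ge0.
have KM p : KK r p -> OM M p.
  move=> Kp; split; first exact: KK_UP Kp.
  have [x1 x2 _] := Kp.
  have sq (a : R) : `|a| <= r%:R -> a ^+ 2 <= r%:R ^+ 2.
    by move=> ar; rewrite -[a ^+ 2]real_normK ?num_real // ler_pXn2r ?nnegrE.
  by rewrite /= /n2y /M; have := sq _ x1; have := sq _ x2; lra.
pose K3 : set (P * R * R) := (KK r `*` `[0, R0]%classic) `*` `[0, pi2]%classic.
have cK3 : compact K3.
  by apply: compact_setX; [apply: compact_setX; [exact: KK_compact|]|]; exact: segment_compact.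
have K3D : K3 `<=` D3 by move=> [[p a] b] [[/KK_UP]].
pose psi (q : P * R * R) : C := (phi f r (yarc q.1.1 q.1.2 q.2))%:C * (den (zeta q.1.1) q.2)^-1.
have oD3 : open D3 by apply: open_setXT; apply: open_setXT; exact: open_UP.
have sy : sm D3 (fun q => yarc q.1.1 q.1.2 q.2) by solve_sm.
have spsi : csm D3 psi.
  apply: csmM => //; first exact: csm_phi.
  by apply: csmV => //; [exact: den3_neq0|exact: csm_den3].
have sW : csm D3 (fun q => Wt (Harc q)) by apply: csm_Wt => //; solve_sm.
(* The hole of the annulus: the piece vanishes there by [chi_near], and outside it [Wt_small]
   applies. *)
pose Z3 : set (P * R * R) := D3 `&` [set q | n2y (yarc q.1.1 q.1.2 q.2) < T r].
have oZ3 : open Z3.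
  apply: openI => //; apply: open_sm_lt; apply: sm_n2y; first exact: openT.
  by solve_sm.
pose q : R := 1 - (8 * r.+1%:R)^-1.
have r1 : 1 <= r.+1%:R :> R by rewrite ler1n.
have q1 : q < 1 by rewrite ltrBlDr ltrDl invr_gt0 mulr_gt0 // (lt_le_trans ltr01).
have q0 : 0 < q.
  by rewrite subr_gt0 invf_lt1 ?mulr_gt0 ?(lt_le_trans ltr01) //; lra.
have sub1 : subgeo (fun=> 1 : R).
  move=> s s0 s1; exists 1 => N; rewrite normr1 mul1r exprn_ile1 // ltW //.
(* [nc_cint_le] is applied to the angle and to the radius, each time costing 2 and the length of the
   interval. *)
pose e' := e / (2 * (R0 * (2 * pi2))).
have pi20 := @pi2_gt0 R.
have e'0 : 0 < e' by rewrite divr_gt0 // !mulr_gt0.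
have KD := @power_decay _ _ D3 K3 Z3 (fun q => Wt (Harc q)) q oD3 oZ3 cK3 K3D q0 q1 sW _
  (map (fun v => (v, 0, 0)) vs) psi (fun=> 1) 0 e' spsi _ sub1 e'0.
apply: filterS (KD _ _); first last.
- move=> x [_ xT]; rewrite /psi /phi chi_near ?mul0r //; exact: ltW.
- move=> [[p a] b] [[Kp _] _] nZ.
  have yT : T r <= n2y (yarc p a b).
    rewrite leNgt; apply/negP => lt; apply: nZ; split; last exact: lt.
    by split=> //; split=> //; exact: KK_UP Kp.
  exact: (Wt_small Kp yT).
move=> N HN p Kp; have Up := KK_UP Kp.
rewrite (cdvs_kr r N vs (KM p Kp)).
have [_ ->] // := Kg_csm (sg r N) R0.
have -> : Phi (gg f r N) = (fun x => 1%:C * psi x * Wt (Harc x) ^+ (N - 0)).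
  by apply/funext => x; rewrite /Phi /gg /psi subn0 /Harc /=; ring.
set vs3 := map _ vs in HN *; set G := (fun x => _) in HN *.
have sG : csm D3 (cdvs vs3 G).
  apply: csm_cdvs; apply: csmM => //; last exact: csmX.
  by apply: csmM => //; exact: csm_cst.
have sL : csm setT (fun rho => cint 0 pi2 (fun t => cdvs vs3 G (p, rho, t))).
  have [I1 _] := cint_param 0 pi2 findim_PR (open_setXT open_UP) sG.
  exact: csm_slice2 findim_P open_UP I1 Up.
apply: le_trans (nc_cint_le (B := 2 * (pi2 * e')) (csm_ccont sL) (ltW R00) _) _.
  move=> rho rR.
  have st : csm setT (fun t => cdvs vs3 G (p, rho, t)).
    exact: (csm_slice2 (x := (p, rho)) findim_PR (open_setXT open_UP) sG).
  apply: le_trans (nc_cint_le (B := e') (csm_ccont st) (ltW pi20) _) _; last by rewrite subr0.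
  by move=> t tp; apply: HN; split; [split|]; rewrite //= in_itv.
rewrite subr0 le_eqVlt; apply/orP; left; apply/eqP.
have H (a w : R) : 0 < a -> 0 < w -> 2 * (a * (2 * (w * (e / (2 * (a * (2 * w))))))) = e.
  by move=> a0 w0; field; rewrite !gt_eqF.
exact: H.
Qed.

End Solution.

(** * Summation of the pieces *)

Section Series.
Context {R : realType}.
Implicit Types V W : normedModType R.
Notation C := R[i].
Notation P := (R * R * R * R)%type.
Notation pi2 := (pi *+ 2 : R).
Notation Re := complex.Re.
Notation Im := complex.Im.
Notation cnt := (@counting nat R).

(** Only finitely many lists over ['I_n] have length at most [m], so one exponent N can serve for
    all derivatives of order at most [m] in basis directions. *)
Lemma near_lists n (Q : seq 'I_n -> nat -> Prop) m :
  (forall s, \forall N \near \oo, Q s N) ->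
  \forall N \near \oo, forall s, (size s <= m)%N -> Q s N.
Proof.
elim: m Q => [|m IH] Q H.
  by apply: filterS (H [::]) => N QN [|i s].
have H1 : \forall N \near \oo, forall i : 'I_n, forall s, (size s <= m)%N -> Q (i :: s) N.
  by apply: filter_forall => i; apply: IH => s; exact: H.
by apply: filterS2 H1 (H [::]) => N Q1 Q0 [|i s] //= sm; exact: Q1.
Qed.

Lemma csm_sumZ V (U : set V) n (a : 'I_n -> C) (F : 'I_n -> V -> C) : open U ->
  (forall i, csm U (F i)) -> csm U (fun x => \sum_i a i * F i x).
Proof.
move=> oU; elim: n a F => [|n IH] a F sF.
  by apply: csm_eq_on (csm_cst 0 oU) => // x _; rewrite big_ord0.
apply: (@csm_eq_on _ _ _ (fun x => a ord0 * F ord0 x + \sum_i a (lift ord0 i) * F (lift ord0 i) x)) => //.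
  by move=> x _; rewrite big_ord_recl.
by apply: csmD => //; [apply: csmM => //; exact: csm_cst|exact: IH].
Qed.

Lemma cdvsZ V (U : set V) (F : V -> C) (a : C) vs x : open U -> csm U F -> U x ->
  cdvs vs (fun x => a * F x) x = a * cdvs vs F x.
Proof.
move=> oU; elim: vs F => [|v vs IH] F sF Ux.
  by apply: eqc; rewrite ?ReMc ?ImMc /=  ?ReMc ?ImMc.
rewrite -[LHS]/(cdvs vs (cD v (fun x => a * F x)) x).
rewrite (@cdvs_eq_on _ _ U _ (fun x => a * cD v F x)) //; first last.
  by move=> y Uy; rewrite (cDZ _ _ oU sF).
by rewrite IH //; exact: csm_cD.
Qed.

Lemma cdvs_sumZ V (U : set V) n (a : 'I_n -> C) (F : 'I_n -> V -> C) vs x : open U ->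
  (forall i, csm U (F i)) -> U x ->
  cdvs vs (fun x => \sum_i a i * F i x) x = \sum_i a i * cdvs vs (F i) x.
Proof.
move=> oU; elim: n a F => [|n IH] a F sF Ux.
  rewrite big_ord0 (@cdvs_eq_on _ _ U _ (fun=> 0)) //; last by move=> y _; rewrite big_ord0.
  elim: vs => [|v vs IHv]; first by apply: eqc.
  rewrite -[LHS]/(cdvs vs (cD v (fun=> 0)) x) -[RHS]IHv.
  by apply: (cdvs_eq_on _ oU) => // y _; rewrite cD_cst.
rewrite big_ord_recl.
rewrite (@cdvs_eq_on _ _ U _ (fun x => a ord0 * F ord0 x + \sum_i a (lift ord0 i) * F (lift ord0 i) x)) //;
  last by move=> y _; rewrite big_ord_recl.
rewrite (cdvs_add _ oU _ (csm_sumZ _ oU (fun i => sF (lift ord0 i)))) //; last first.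
  by apply: csmM => //; exact: csm_cst.
by rewrite (cdvsZ _ _ oU) // IH.
Qed.

(** Iterated derivatives are multilinear in the directions, so basis directions control all others,
    with a constant independent of the function and the point. The choice of an exponent can only
    meet finitely many conditions, hence this reduction. *)
Lemma multilinear_bound V (U : set V) n (b : 'I_n -> V) (c : 'I_n -> V -> R) vs : open U ->
  (forall v, v = \sum_i c i v *: b i) ->
  exists2 B : R, 0 <= B & forall (F : V -> C) x M, csm U F -> U x ->
    (forall s, size s = size vs -> nc (cdvs (map b s) F x) <= M) -> nc (cdvs vs F x) <= B * M.
Proof.
move=> oU bE; elim: vs => [|v vs [B B0 IH]].
  by exists 1 => // F x M sF Ux H; rewrite mul1r; exact: (H [::]).
exists (\sum_i `|c i v| * B) => [|F x M sF Ux H].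
  by apply: sumr_ge0 => i _; rewrite mulr_ge0.
have sb i : csm U (cD (b i) F) by exact: csm_cD.
have E : cdvs (v :: vs) F x = \sum_i (c i v)%:C * cdvs vs (cD (b i) F) x.
  rewrite -(cdvs_sumZ _ _ oU) // -[LHS]/(cdvs vs (cD v F) x).
  apply: (cdvs_eq_on _ oU) => // y Uy; rewrite [in LHS](bE v).
  have [F1 F2] := sF.
  have d1 := sm_differentiable F1 Uy; have d2 := sm_differentiable F2 Uy.
  apply: eqc.
    rewrite /= /dvs /= (deriveE _ d1) linear_sum raddf_sum /=; apply: eq_bigr => i _.
    by rewrite mul0r subr0 linearZ /= -(deriveE _ d1).
  rewrite /= /dvs /= (deriveE _ d2) linear_sum raddf_sum /=; apply: eq_bigr => i _.
  by rewrite mul0r addr0 linearZ /= -(deriveE _ d2).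
rewrite E mulr_suml.
have ncsum (G : 'I_n -> C) : nc (\sum_i G i) <= \sum_i nc (G i).
  elim/big_ind2: _ => [|x1 x2 y1 y2 h1 h2|//]; first by rewrite nc0.
  by apply: le_trans (ncD _ _) _; exact: lerD.
apply: le_trans (ncsum _) _; apply: ler_sum => i _.
rewrite ncM nc_rc -mulrA ler_wpM2l //; apply: IH => // s ss.
by apply: (H (i :: s)); rewrite /= ss.
Qed.

Lemma KK_le r s : (r <= s)%N -> @KK R r `<=` KK s.
Proof.
move=> rs p [h1 h2 h3]; split.
- by apply: le_trans h1 _; rewrite ler_nat.
- by apply: le_trans h2 _; rewrite ler_nat.
- apply: le_trans h3 _; rewrite lerD2l lerN2 lef_pV2 ?posrE ?ltr0n //.
  by rewrite ler_nat ltnS.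
Qed.

Lemma KK_near (p : P) : UP p -> exists r0, \forall z \near p, KK r0 z.
Proof.
move=> Up; have e0 : 0 < 1 - norm2 (zeta p) by rewrite subr_gt0.
have [r0 H] : exists r0 : nat, [/\ `|p.1.1.1| < r0%:R, `|p.1.1.2| < r0%:R &
    r0.+1%:R^-1 < 1 - norm2 (zeta p)].
  near \oo => r0; exists r0; split.
  - by near: r0; exact: nbhs_infty_gtr.
  - by near: r0; exact: nbhs_infty_gtr.
  - by near: r0; exact: (near_infty_natSinv_lt (PosNum e0)).
exists r0; have [h1 h2 h3] := H.
pose A : set P := [set z | z.1.1.1 < r0%:R] `&` [set z | - z.1.1.1 < r0%:R] `&`
  [set z | z.1.1.2 < r0%:R] `&` [set z | - z.1.1.2 < r0%:R] `&`
  [set z | norm2 (zeta z) < 1 - r0.+1%:R^-1].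
have oA : open A by repeat apply: openI; apply: open_sm_lt; solve_sm.
apply: (open_near oA).
  move: h1 h2; rewrite !ltr_norml => /andP[? ?] /andP[? ?].
  by repeat split => //=; rewrite 1?ltrNl // ltrBrDr addrC -ltrBrDr.
move=> z [[[[a1 a2] a3] a4] a5]; split; last exact: ltW.
  by rewrite ler_norml lerNl !ltW.
by rewrite ler_norml lerNl !ltW.
Unshelve. all: by end_near. Qed.

Definition csum (F : nat -> C) : C :=
  (\int[cnt]_j Re (F j)) +i* (\int[cnt]_j Im (F j)).

Definition cintegrable (F : nat -> C) :=
  cnt.-integrable setT (EFin \o (fun j => Re (F j))) /\
  cnt.-integrable setT (EFin \o (fun j => Im (F j))).

Lemma csumD F G : cintegrable F -> cintegrable G ->
  csum (fun t => F t + G t) = csum F + csum G.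
Proof.
move=> [F1 F2] [G1 G2]; apply: eqc; rewrite ?ReDc ?ImDc /=.
  by under eq_Rintegral do rewrite ReDc; rewrite RintegralD.
by under eq_Rintegral do rewrite ImDc; rewrite RintegralD.
Qed.

Lemma cintegrableZ c F : cintegrable F -> cintegrable (fun t => c * F t).
Proof.
have Z (k : R) (h : nat -> R) : cnt.-integrable setT (EFin \o h) ->
    cnt.-integrable setT (EFin \o (fun j => k * h j)).
  by move=> ih; apply: (integrableZl _ k ih).
move=> [F1 F2]; split.
  have -> : (fun j => Re (c * F j)) = (fun j => Re c * Re (F j) - Im c * Im (F j)).
    by apply/funext => j; rewrite ReMc.
  have h1 := Z (Re c) _ F1; have h2 := Z (Im c) _ F2.
  exact: (integrableB _ h1 h2).
have -> : (fun j => Im (c * F j)) = (fun j => Re c * Im (F j) + Im c * Re (F j)).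
  by apply/funext => j; rewrite ImMc.
have h1 := Z (Re c) _ F2; have h2 := Z (Im c) _ F1.
exact: (integrableD _ h1 h2).
Qed.

Lemma csumZ c F : cintegrable F -> csum (fun t => c * F t) = c * csum F.
Proof.
have Z (k : R) (h : nat -> R) : cnt.-integrable setT (EFin \o h) ->
    cnt.-integrable setT (EFin \o (fun j => k * h j)).
  by move=> ih; apply: (integrableZl _ k ih).
move=> [F1 F2]; apply: eqc; rewrite ?ReMc ?ImMc /=.
  under eq_Rintegral do rewrite ReMc.
  rewrite RintegralB; [|by []|exact: Z|exact: Z].
  by rewrite !RintegralZl.
under eq_Rintegral do rewrite ImMc.
rewrite RintegralD; [|by []|exact: Z|exact: Z].
by rewrite !RintegralZl.
Qed.

Lemma csum_series V (U : set V) (F : nat -> V -> C) : findim V -> open U ->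
  (forall j, csm U (F j)) ->
  (forall vs p, U p -> exists B, exists J, \forall z \near p,
    forall j, (J <= j)%N -> nc (cdvs vs (F j) z) <= B / (2 ^ j.+1)%:R) ->
  csm U (fun p => csum (fun j => F j p)) /\
  forall v p, U p -> cD v (fun p => csum (fun j => F j p)) p = csum (fun j => cD v (F j) p) /\
    cintegrable (fun j => cD v (F j) p).
Proof.
move=> fV oU sF bound.
have [SR DR] := series_sm fV oU (fun j => (sF j).1) (fun vs p Up =>
  let: ex_intro B (ex_intro J H) := bound vs p Up in
  ex_intro _ B (ex_intro _ J (filterS (fun z h j Jj => le_trans (norm_Re_le _) (h j Jj)) H))).
have [SI DI] := series_sm fV oU (fun j => (sF j).2) (fun vs p Up =>
  let: ex_intro B (ex_intro J H) := bound vs p Up in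
  ex_intro _ B (ex_intro _ J (filterS (fun z h j Jj => le_trans (norm_Im_le _) (h j Jj)) H))).
split=> [|v p Up]; first by split; [exact: SR|exact: SI].
have [R1 R2] := DR [:: v] p Up; have [I1 I2] := DI [:: v] p Up.
by split; [apply: eqc; [exact: R1|exact: I1]|split; [exact: R2|exact: I2]].
Qed.

Variable f : R * R -> R.
Hypothesis sf : sm setT f.

(* Mittag-Leffler: each piece is made small on a compact set by a high power of [Wt], and the pieces are summed. *)
Lemma dbar_solution : exists2 k : P -> C, csm (@UP R) k & forall p, UP p ->
  (1 - zeta p) * cD eX1 k p + 'i%C * (1 + zeta p) * cD eX2 k p = (f p.1.1)%:C /\
  cD eZ2 k p = 'i%C * cD eZ1 k p.
Proof.
have [n [b [c [cc cE]]]] := @findim_P R.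
have oU := @open_UP R.
(* A diagonal choice: the exponent of the piece r handles derivatives of order at most r on [KK r],
   so every fixed order and compact set is covered by all but finitely many pieces. *)
have /choice[Nr HN] : forall r : nat, exists N : nat, (0 < r)%N ->
    forall s, (size s <= r)%N -> forall p, KK r p ->
    nc (cdvs (map b s) (kr f r N) p) <= 1 / (2 ^ r.+1)%:R.
  move=> r; case: (posnP r) => [->|r0]; first by exists 0%N.
  have e0 : 0 < 1 / (2 ^ r.+1)%:R :> R by rewrite divr_gt0 // ltr0n expn_gt0.
  have [N _ HN] := near_lists r (fun s => kr_small sf (map b s) r0 e0).
  by exists N => _ s sr; apply: (HN N (leqnn N)).
pose k_ r := kr f r (Nr r).
have sk r : csm (@UP R) (k_ r) by exact: csm_kr.
have bound vs p : UP p -> exists B, exists J, \forall z \near p,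
    forall j, (J <= j)%N -> nc (cdvs vs (k_ j) z) <= B / (2 ^ j.+1)%:R.
  move=> Up; have [B B0 HB] := multilinear_bound vs oU cE.
  have [r0 Hr0] := KK_near Up.
  (* The index must exceed that of a compact neighbourhood, the order of the derivative, and 0, as
     the piece 0 has no estimate. *)
  exists B, (maxn (maxn r0 (size vs)) 1); apply: filterS Hr0 => z Kz j.
  rewrite !geq_max => /andP[/andP[rj sj] j1].
  rewrite -[B]mulr1 -mulrA; apply: HB => //; first exact: KK_UP Kz.
  by move=> s ss; apply: HN => //; [rewrite ss|exact: KK_le rj _ Kz].
pose k p := csum (fun j => k_ j p).
have [sk0 Dk] := csum_series findim_P oU sk bound.
have pi20 : (pi2%:C : C) != 0.
  by apply/eqP => /complexI H; have := @pi2_gt0 R; rewrite H ltxx.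
have krX j p : UP p -> (1 - zeta p) * cD eX1 (k_ j) p + 'i%C * (1 + zeta p) * cD eX2 (k_ j) p =
    pi2%:C * (phi f j p.1.1)%:C.
  by move=> Up; exact: kr_X.
have krZ j p : UP p -> cD eZ2 (k_ j) p = 'i%C * cD eZ1 (k_ j) p.
  by move=> Up; exact: kr_Z.
have kE : k = (fun p => csum (fun j => k_ j p)) by [].
rewrite -kE in sk0 Dk.
move: k_ k {kE} sk sk0 Dk krX krZ bound => k_ k sk sk0 Dk krX krZ _.
exists (fun p => (pi2%:C)^-1 * k p); first by apply: csmM => //; exact: csm_cst.
move=> p Up; have D v : cD v (fun p => (pi2%:C)^-1 * k p) p = (pi2%:C)^-1 * cD v k p.
  exact: (cDZ _ _ oU sk0 Up).
rewrite !D.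
have [-> i1] := Dk eX1 p Up; have [-> i2] := Dk eX2 p Up.
have [-> i3] := Dk eZ1 p Up; have [-> _] := Dk eZ2 p Up.
split; last first.
  have -> : csum (fun j => cD eZ2 (k_ j) p) = 'i%C * csum (fun j => cD eZ1 (k_ j) p).
    rewrite -(csumZ _ i3); apply: (f_equal csum); apply/funext => j; exact: krZ.
  exact: mulrCA.
rewrite mulrCA [X in _ + X]mulrCA -mulrDr.
rewrite -(csumZ _ i1) -(csumZ _ i2) -(csumD (cintegrableZ _ i1) (cintegrableZ _ i2)).
apply: (mulfI pi20); rewrite mulrA mulfV ?pi20 // mul1r.
transitivity (csum (fun j => pi2%:C * (phi f j p.1.1)%:C)).
  by apply: (f_equal csum); apply/funext => j; exact: krX.
set y := p.1.1.
(* Since J <= T J, the pieces of index above [J] vanish at y and the sum of the right-hand sides is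
   finite; it telescopes to f by [sum_chi]. *)
have [J yJ] : exists J, n2y y <= J%:R.
  near \oo => J; exists J; near: J; exact: nbhs_infty_ger.
have yT j : (J <= j)%N -> n2y y <= T j.
  move=> Jj; apply: le_trans yJ (le_trans (y := (32 * j.+1 ^ 2)%:R) _ _).
    by rewrite ler_nat expnS expn1; nia.
  by rewrite /T expr2 ler_peMl // ler1n muln_gt0 expn_gt0.
have fin j : (J.+1 <= j)%N -> phi f j y = 0.
  by move=> Jj; rewrite /phi chi_near ?mul0r // ?(leq_ltn_trans _ Jj) // yT // ltnW.
apply: eqc; rewrite /= ?mul0r ?mulr0 ?subr0 ?addr0.
  under eq_Rintegral do rewrite subr0.
  rewrite (sum_counting (J := J.+1)) => [|j Jj]; last by rewrite fin ?mulr0.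
  rewrite -mulr_sumr -mulr_suml sum_chi ?mul1r //; exact/yT/leqnSn.
under eq_Rintegral do rewrite mul0r addr0.
by rewrite (sum_counting (J := 0)) ?big_ord0.
Unshelve. all: by end_near. Qed.

End Series.

(** * The neutral metric *)

Section Geometry.
Context {R : realType}.

Lemma sum3 (M : nmodType) (F : 'I_3 -> M) : \sum_(i < 3) F i = F 0 + F 1 + F 2.
Proof.
rewrite !big_ord_recl big_ord0 addr0 !addrA; congr (_ + F _ + F _); exact: val_inj.
Qed.

Lemma sum4 (M : nmodType) (F : 'I_4 -> M) : \sum_(i < 4) F i = F 0 + F 1 + F 2 + F 3.
Proof.
rewrite !big_ord_recl big_ord0 addr0 !addrA; congr (_ + F _ + F _ + F _); exact: val_inj.
Qed.

Lemma all3 (Q : 'I_3 -> Prop) : Q 0 -> Q 1 -> Q 2 -> forall i, Q i.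
Proof.
move=> q0 q1 q2 [[|[|[|//]]] h].
- by have -> : Ordinal h = 0 by exact: val_inj.
- by have -> : Ordinal h = 1 by exact: val_inj.
- by have -> : Ordinal h = 2 by exact: val_inj.
Qed.

Lemma all4 (Q : 'I_4 -> Prop) : Q 0 -> Q 1 -> Q 2 -> Q 3 -> forall i, Q i.
Proof.
move=> q0 q1 q2 q3 [[|[|[|[|//]]]] h].
- by have -> : Ordinal h = 0 by exact: val_inj.
- by have -> : Ordinal h = 1 by exact: val_inj.
- by have -> : Ordinal h = 2 by exact: val_inj.
- by have -> : Ordinal h = 3 by exact: val_inj.
Qed.

Definition antimx (a b c d e g : R) : 'M[R]_4 := \matrix_(i, j)
  nth 0 (nth [::] [:: [:: 0; a; b; c]; [:: - a; 0; d; e]; [:: - b; - d; 0; g]; [:: - c; - e; - g; 0]] i) j.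

Lemma antimxP (s : 'M[R]_4) : s^T = - s ->
  s = antimx (s 0 1) (s 0 2) (s 0 3) (s 1 2) (s 1 3) (s 2 3).
Proof.
move=> /matrixP sT.
have d i j : s j i = - s i j by have := sT i j; rewrite !mxE.
have z i : s i i = 0.
  have h := d i i; have h2 : s i i *+ 2 = 0 by rewrite mulr2n {1}h addNr.
  by move/eqP: h2; rewrite mulrn_eq0 /= => /eqP.
by apply/matrixP; apply: all4; apply: all4; rewrite !mxE /= ?z // d.
Qed.

Lemma det2 (K : comNzRingType) (A : 'M[K]_2) : \det A = A 0 0 * A 1 1 - A 0 1 * A 1 0.
Proof.
rewrite (expand_det_row _ 0) !big_ord_recl big_ord0 /cofactor !det_mx11 /= !mxE.
have -> : lift 0 0 = 1 :> 'I_2 by exact: val_inj.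
have -> : lift 1 0 = 0 :> 'I_2 by exact: val_inj.
by rewrite /=; ring.
Qed.

Lemma det3 (K : comNzRingType) (A : 'M[K]_3) : \det A =
  A 0 0 * (A 1 1 * A 2 2 - A 1 2 * A 2 1)
  - A 0 1 * (A 1 0 * A 2 2 - A 1 2 * A 2 0)
  + A 0 2 * (A 1 0 * A 2 1 - A 1 1 * A 2 0).
Proof.
rewrite (expand_det_row _ 0) sum3 /cofactor !det2 /= !mxE.
have -> : lift 0 0 = 1 :> 'I_3 by exact: val_inj.
have -> : lift 0 1 = 2 :> 'I_3 by exact: val_inj.
have -> : lift 1 0 = 0 :> 'I_3 by exact: val_inj.
have -> : lift 1 1 = 2 :> 'I_3 by exact: val_inj.
have -> : lift 2 0 = 0 :> 'I_3 by exact: val_inj.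
have -> : lift 2 1 = 1 :> 'I_3 by exact: val_inj.
by rewrite /=; ring.
Qed.

Lemma det4 (K : comNzRingType) (A : 'M[K]_4) :
  let m i j k l := A 2 i * A 3 j * (A 0 k * A 1 l - A 0 l * A 1 k) in
  \det A = m 2 3 0 1 - m 3 2 0 1 - m 1 3 0 2 + m 3 1 0 2 + m 1 2 0 3 - m 2 1 0 3
    + m 0 3 1 2 - m 3 0 1 2 - m 0 2 1 3 + m 2 0 1 3 + m 0 1 2 3 - m 1 0 2 3.
Proof.
rewrite (expand_det_row _ 0) sum4 /cofactor !det3 /= !mxE.
have l1 : lift 0 0 = 1 :> 'I_4 by exact: val_inj.
have l2 : lift 0 1 = 2 :> 'I_4 by exact: val_inj.
have l3 : lift 0 2 = 3 :> 'I_4 by exact: val_inj.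
have l4 : lift 1 0 = 0 :> 'I_4 by exact: val_inj.
have l5 : lift 1 1 = 2 :> 'I_4 by exact: val_inj.
have l6 : lift 1 2 = 3 :> 'I_4 by exact: val_inj.
have l7 : lift 2 0 = 0 :> 'I_4 by exact: val_inj.
have l8 : lift 2 1 = 1 :> 'I_4 by exact: val_inj.
have l9 : lift 2 2 = 3 :> 'I_4 by exact: val_inj.
have l10 : lift 3 0 = 0 :> 'I_4 by exact: val_inj.
have l11 : lift 3 1 = 1 :> 'I_4 by exact: val_inj.
have l12 : lift 3 2 = 2 :> 'I_4 by exact: val_inj.
rewrite !(l1, l2, l3, l4, l5, l6, l7, l8, l9, l10, l11, l12) /=; ring.
Qed.

(** The Vandermonde product of the four indices is alternating and equals 12 at (0, 1, 2, 3). The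
    identity is checked over the integers on all quadruples; its polynomial form is what makes the
    Hodge star computable by [field]. *)
Lemma levi_civitaE (i j k l : 'I_4) : levi_civita_symbol R i j k l * 12 =
  (j%:R - i%:R) * (k%:R - i%:R) * (l%:R - i%:R) * (k%:R - j%:R) * (l%:R - j%:R) * (l%:R - k%:R).
Proof.
have I n : n%:R = (n%:Z)%:~R :> R by [].
rewrite !I -!rmorphB -!rmorphM /=.
pose A : 'M[int]_4 := \matrix_(a < 4, b < 4) (b == tnth [tuple i; j; k; l] a)%:R.
have -> : levi_civita_symbol R i j k l = (\det A)%:~R.
  rewrite -det_map_mx; congr (\det _); apply/matrixP => a b; rewrite !mxE.
  by case: (b == _).
rewrite -rmorphM; congr (_%:~R).
rewrite det4 /= !mxE !(tnth_nth 0) /=; clear A I.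
by case: i => [[|[|[|[|//]]]] hi]; case: j => [[|[|[|[|//]]]] hj];
   case: k => [[|[|[|[|//]]]] hk]; case: l => [[|[|[|[|//]]]] hl].
Qed.

End Geometry.

Section Neutral.
Context {R : realType}.
Variable f : 'rV[R]_4 -> R.

(** Missing rows and entries are 0, and short lists rely on this. *)
Definition lmx (l : seq (seq R)) : 'M[R]_4 := \matrix_(i, j) nth 0 (nth [::] l i) j.

Definition nmx (a : R) : 'M[R]_4 :=
  lmx [:: [:: a; 0; 1; 0]; [:: 0; a; 0; 1]; [:: 1; 0; 0; 0]; [:: 0; 1; 0; 0]].

Lemma block22E (A B C D : 'M[R]_2) : (block_mx A B C D : 'M[R]_(2 + 2)) =
  lmx [:: [:: A 0 0; A 0 1; B 0 0; B 0 1]; [:: A 1 0; A 1 1; B 1 0; B 1 1];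
          [:: C 0 0; C 0 1; D 0 0; D 0 1]; [:: C 1 0; C 1 1; D 1 0; D 1 1]].
Proof.
have l0 : (0 : 'I_4) = @lshift 2 2 0 by exact: val_inj.
have l1 : (1 : 'I_4) = @lshift 2 2 1 by exact: val_inj.
have r0 : (2 : 'I_4) = @rshift 2 2 0 by exact: val_inj.
have r1 : (3 : 'I_4) = @rshift 2 2 1 by exact: val_inj.
apply/matrixP; apply: all4; apply: all4; rewrite [RHS]mxE /=;
  rewrite ?r1 ?r0 ?l0 ?l1 ?block_mxEul ?block_mxEur ?block_mxEdl ?block_mxEdr //.
Qed.

Lemma neutral_metricE x : neutral_metric f x = nmx (f x).
Proof. by rewrite /neutral_metric block22E !mxE /= !mulr1n !mulr0n. Qed.

Lemma det_nmx a : \det (nmx a) = 1.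
Proof. by rewrite det4 /= !mxE /=; ring. Qed.

Lemma unit_nmx a : nmx a \in unitmx.
Proof. by rewrite unitmxE det_nmx unitr1. Qed.

Lemma mul4 (A B : 'M[R]_4) i j :
  (A *m B) i j = A i 0 * B 0 j + A i 1 * B 1 j + A i 2 * B 2 j + A i 3 * B 3 j.
Proof. by rewrite mxE sum4. Qed.

Lemma invmx_nmx a : invmx (nmx a) =
  lmx [:: [:: 0; 0; 1; 0]; [:: 0; 0; 0; 1]; [:: 1; 0; - a; 0]; [:: 0; 1; 0; - a]].
Proof.
apply: (mulIr (unit_nmx a)); rewrite -[LHS]/(_ *m _) -[RHS]/(_ *m _) mulVmx ?unit_nmx //.
by apply/matrixP; apply: all4; apply: all4; rewrite mul4 !mxE /=; ring.
Qed.

Lemma nmx_conj a b c d e g h : nmx a *m antimx b c d e g h *m (nmx a)^T =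
  antimx (a ^+ 2 * b + a * (d - e) + h) (- c) (a * b - e) (- a * b - d) (- g) b.
Proof.
by apply/matrixP; apply: all4; apply: all4; rewrite !mul4 !mxE /=; ring.
Qed.

Lemma bmetricE (G s t : 'M[R]_4) :
  bmetric G s t = 4^-1 * \sum_i \sum_j s i j * (G *m t *m G^T) i j.
Proof.
rewrite /bmetric; congr (_ * _); apply: eq_bigr => i _; apply: eq_bigr => j _.
rewrite mxE mulr_sumr exchange_big; apply: eq_bigr => l _.
by rewrite !mxE mulr_suml mulr_sumr; apply: eq_bigr => k _; ring.
Qed.

Lemma hodge_star_nmx a b c d e g h : hodge_star (nmx a) (antimx b c d e g h) =
  antimx b g (- a * b - d) (a * b - e) c (a ^+ 2 * b + a * (d - e) + h).
Proof.
rewrite /hodge_star det_nmx normr1 sqrtr1 invr1 mul1r nmx_conj.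
set t := antimx _ _ _ _ _ _.
(* The factor 1 / 2 of the star and the 12 of [levi_civitaE] combine into 24. *)
have H k l : 2^-1 * (\sum_i \sum_j levi_civita_symbol R i j k l * t i j) =
    24^-1 * (\sum_(i < 4) \sum_(j < 4) (j%:R - i%:R) * (k%:R - i%:R) * (l%:R - i%:R) *
      (k%:R - j%:R) * (l%:R - j%:R) * (l%:R - k%:R) * t i j).
  have -> : 24^-1 = 2^-1 * 12^-1 :> R by field.
  rewrite -mulrA; congr (_ * _); rewrite mulr_sumr; apply: eq_bigr => i _.
  rewrite mulr_sumr; apply: eq_bigr => j _.
  by rewrite -levi_civitaE; field.
have m1 : (1 %% 4)%N = 1%N by [].
have m3 : (2 %% 4)%N = 2%N by [].
have m4 : (3 %% 4)%N = 3%N by [].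
apply/matrixP; apply: all4; apply: all4; rewrite !mxE H !sum4 !mxE /= ?m1 ?addn1 ?m3 ?add1n ?m4; by field.
Qed.

End Neutral.

(** * Anti-self-dual bivectors in the parallel frame *)

Section Fibre.
Context {R : realType}.
Implicit Types (y w : 'rV[R]_3).

Definition lrow n (l : seq R) : 'rV[R]_n := \row_j nth 0 l j.

(* y_1 s_1 + y_2 s_2 + y_3 s_3 in the coordinate basis where f = a; the s_i are parallel,
   since [hlift_sig] only accounts for the derivative of the entry - f y_1. *)
Definition sig (a : R) y : 'M[R]_4 :=
  antimx 0 (y 0 1) (y 0 0 + y 0 2) (y 0 2 - y 0 0) (- y 0 1) (- (a * y 0 0)).

Definition ycoord (s : 'M[R]_4) : 'rV[R]_3 :=
  lrow 3 [:: (s 0 3 - s 1 2) / 2; s 0 2; (s 0 3 + s 1 2) / 2].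

Definition qform y w : R := y 0 0 * w 0 0 - y 0 1 * w 0 1 - y 0 2 * w 0 2.

Lemma ycoord_sig a y : ycoord (sig a y) = y.
Proof. by apply/rowP; apply: all3; rewrite !mxE /=; field. Qed.

Lemma antimx_inj a b c d e g a' b' c' d' e' g' :
  antimx a b c d e g = antimx a' b' c' d' e' g' :> 'M[R]_4 ->
  [/\ a = a', b = b', c = c', d = d' & e = e' /\ g = g'].
Proof.
move=> /matrixP H; have := (H 0 1, H 0 2, H 0 3, H 1 2, H 1 3, H 2 3).
by rewrite !mxE /= => -[[[[[-> ->] ->] ->] ->] ->].
Qed.

Lemma tr_antimx a b c d e g : (antimx a b c d e g)^T = - antimx a b c d e g :> 'M[R]_4.
Proof. by apply/matrixP; apply: all4; apply: all4; rewrite !mxE /= ?opprK ?oppr0. Qed.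

Lemma opp_antimx a b c d e g :
  - antimx a b c d e g = antimx (- a) (- b) (- c) (- d) (- e) (- g) :> 'M[R]_4.
Proof. by apply/matrixP; apply: all4; apply: all4; rewrite !mxE /= ?oppr0. Qed.

Lemma add_antimx a b c d e g a' b' c' d' e' g' :
  antimx a b c d e g + antimx a' b' c' d' e' g' =
  antimx (a + a') (b + b') (c + c') (d + d') (e + e') (g + g') :> 'M[R]_4.
Proof. by apply/matrixP; apply: all4; apply: all4; rewrite !mxE /= ?addr0 // opprD. Qed.

Lemma lambda_minusP a s : lambda_minus (nmx a) s <-> s = sig a (ycoord s).
Proof.
split=> [[sT]|->]; last first.
  split; first exact: tr_antimx.
  by rewrite hodge_star_nmx opp_antimx !mxE /=; congr antimx; field.
rewrite (antimxP sT) hodge_star_nmx opp_antimx => /antimx_inj[h1 h2 h3 h4 [h5 h6]].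
have s0 : s 0 1 = 0 by lra.
rewrite /sig !mxE /= s0; rewrite s0 in h6; congr antimx; try lra.
Qed.

Lemma bmetric_antimx a b c d e g h b' c' d' e' g' h' :
  bmetric (nmx a) (antimx b c d e g h) (antimx b' c' d' e' g' h') =
  2^-1 * (b * (a ^+ 2 * b' + a * (d' - e') + h') - c * c' + d * (a * b' - e')
    - e * (a * b' + d') - g * g' + h * b') :> R.
Proof. by rewrite bmetricE nmx_conj !sum4 !mxE /=; field. Qed.

Lemma bmetric_sig a y w : bmetric (nmx a) (sig a y) (sig a w) = qform y w.
Proof. by rewrite bmetric_antimx /qform; field. Qed.

Lemma wedge_antimx (X Y : 'rV[R]_4) : wedge X Y =
  antimx (X 0 0 * Y 0 1 - Y 0 0 * X 0 1) (X 0 0 * Y 0 2 - Y 0 0 * X 0 2)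
    (X 0 0 * Y 0 3 - Y 0 0 * X 0 3) (X 0 1 * Y 0 2 - Y 0 1 * X 0 2)
    (X 0 1 * Y 0 3 - Y 0 1 * X 0 3) (X 0 2 * Y 0 3 - Y 0 2 * X 0 3).
Proof.
by apply/matrixP; apply: all4; apply: all4; rewrite wedgeE [RHS]mxE /=; ring.
Qed.

Lemma row4M (X : 'rV[R]_4) (A : 'M[R]_4) i j :
  (X *m A) i j = X i 0 * A 0 j + X i 1 * A 1 j + X i 2 * A 2 j + X i 3 * A 3 j.
Proof. by rewrite mxE sum4. Qed.

Definition Ksig (a : R) y (X : 'rV[R]_4) : 'rV[R]_4 := lrow 4
  [:: - y 0 1 * X 0 0 - (y 0 0 + y 0 2) * X 0 1;
      (y 0 0 - y 0 2) * X 0 0 + y 0 1 * X 0 1;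
      y 0 1 * (a * X 0 0 + X 0 2) + (y 0 2 - y 0 0) * (a * X 0 1 + X 0 3) + a * y 0 0 * X 0 1;
      (y 0 0 + y 0 2) * (a * X 0 0 + X 0 2) - y 0 1 * (a * X 0 1 + X 0 3) - a * y 0 0 * X 0 0].

Lemma Kend_sig a y (X : 'rV[R]_4) : Kend (nmx a) (sig a y) X = Ksig a y X.
Proof.
rewrite /Kend; apply: (canLR (mulmxK (unit_nmx a))).
by apply/rowP; apply: all4; rewrite mxE wedge_antimx bmetric_antimx row4M !mxE /=; field.
Qed.

(** The square roots of the frame cancel in the s_i, which are the basis vectors of [sig]; hence
    [vprod] becomes [cross3] of the coordinates. *)
Lemma sframe_sig (f : 'rV[R]_4 -> R) x i : 0 < f x ->
  sframe (neutral_frame f x) i = sig (f x) (delta_mx 0 i).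
Proof.
move=> fx; rewrite /neutral_frame block22E.
have r0 : Num.sqrt (f x) != 0 by rewrite sqrtr_eq0 -ltNge.
have -> : f x = Num.sqrt (f x) ^+ 2 by rewrite sqr_sqrtr // ltW.
rewrite sqrtr_sqr ger0_norm ?sqrtr_ge0 //.
move: (Num.sqrt _) r0 => r r0.
rewrite !mxE /= !mulr1n !mulr0n.
set E := lmx _.
have RE a b : row a E 0 b = E a b by rewrite mxE.
move: i; apply: all3; rewrite /sframe (tnth_nth 0) /= !wedge_antimx ?opp_antimx add_antimx !RE;
  rewrite /sig !mxE /=; congr antimx; by field.
Qed.

Lemma scoord_sig (f : 'rV[R]_4 -> R) x y : 0 < f x ->
  scoord (nmx (f x)) (neutral_frame f x) (sig (f x) y) = y.
Proof.
move=> fx; apply/rowP => i; rewrite mxE sframe_sig // !bmetric_sig.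
by move: i; apply: all3; rewrite /qform !mxE /=; field.
Qed.

Lemma sig_lin a (c : 'I_3 -> R) : \sum_(i < 3) c i *: sig a (delta_mx 0 i) = sig a (\row_i c i).
Proof.
by rewrite sum3; apply/matrixP; apply: all4; apply: all4; rewrite !mxE /=; ring.
Qed.

Lemma vprod_sig (f : 'rV[R]_4 -> R) x y w : 0 < f x ->
  vprod (nmx (f x)) (neutral_frame f x) (sig (f x) y) (sig (f x) w) = sig (f x) (cross3 y w).
Proof.
move=> fx; rewrite /vprod !scoord_sig //.
transitivity (\sum_(i < 3) cross3 y w 0 i *: sig (f x) (delta_mx 0 i)).
  by apply: eq_bigr => i _; rewrite sframe_sig.
by rewrite sig_lin; congr sig; apply/rowP => i; rewrite !mxE.
Qed.

End Fibre.

(** * The Levi-Civita connection and the complex structure in coordinates *)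

Section Connection.
Context {R : realType}.
Variable f : 'rV[R]_4 -> R.
Hypothesis sf : sm setT f.
Hypothesis f_dep : forall x x' : 'rV[R]_4, x 0 0 = x' 0 0 -> x 0 1 = x' 0 1 -> f x = f x'.
Implicit Types (x X : 'rV[R]_4) (y Y : 'rV[R]_3).
Notation d x i := ('D_(delta_mx 0 i) f x).

Lemma derive_metric x v j l : 'D_v (fun z => neutral_metric f z j l) x =
  lmx [:: [:: 'D_v f x; 0; 0; 0]; [:: 0; 'D_v f x]] j l.
Proof.
have -> : (fun z => neutral_metric f z j l) = (fun z => nmx (f z) j l).
  by apply/funext => z; rewrite neutral_metricE.
have c0 (F : 'rV[R]_4 -> R) a : (forall z, F z = a) -> 'D_v F x = 0.
  move=> H; have -> : F = cst a by apply/funext => y; exact: H.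
  exact: derive_cst.
by move: j l; apply: all4; apply: all4; rewrite [RHS]mxE /=;
  first [by apply: (@c0 _ 0) => z; rewrite mxE|by apply: (@c0 _ 1) => z; rewrite mxE
        |by apply: (f_equal (fun F => 'D_v F x)); apply/funext => z; rewrite mxE].
Qed.

Lemma derive_dep x (v : 'rV[R]_4) : v 0 0 = 0 -> v 0 1 = 0 -> 'D_v f x = 0.
Proof.
move=> v0 v1; apply: cvg_lim => //; apply: cvg_near_cst; near=> h.
by rewrite /= (@f_dep (h *: v + x) x) ?subrr ?scaler0 // !mxE ?v0 ?v1 mulr0 add0r.
Unshelve. all: by end_near. Qed.

Lemma d23 x : d x 2 = 0 /\ d x 3 = 0.
Proof. by split; apply: derive_dep; rewrite mxE. Qed.

Lemma derive_f x X : 'D_X f x = X 0 0 * d x 0 + X 0 1 * d x 1.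
Proof.
have df : differentiable f x by exact: sm_differentiable sf _.
have XE : X = X 0 0 *: delta_mx 0 0 + (X 0 1 *: delta_mx 0 1 + (X 0 2 *: delta_mx 0 2 + X 0 3 *: delta_mx 0 3)).
  by rewrite [LHS]matrix_sum_delta big_ord1 sum4 !addrA.
rewrite [in LHS]XE (deriveE _ df) linearP !linearD /= !linearZ /= -!(deriveE _ df).
by have [-> ->] := d23 x; rewrite !scaler0 !addr0.
Qed.

Definition Ldv (D : 'I_4 -> R) (i j l : 'I_4) : R :=
  nth 0 (nth [::] [:: [:: D i; 0; 0; 0]; [:: 0; D i]] j) l
  + nth 0 (nth [::] [:: [:: D j; 0; 0; 0]; [:: 0; D j]] i) l
  - nth 0 (nth [::] [:: [:: D l; 0; 0; 0]; [:: 0; D l]] i) j.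

Definition chr4 (D : 'I_4 -> R) (k i j : 'I_4) : R :=
  2^-1 * nth 0 [:: 0; 0; Ldv D i j 0; Ldv D i j 1] k.

Lemma chr4E a (D : 'I_4 -> R) (k i j : 'I_4) : D 2 = 0 -> D 3 = 0 ->
  2^-1 * \sum_(l < 4) invmx (nmx a) k l *
     (lmx [:: [:: D i; 0; 0; 0]; [:: 0; D i]] j l + lmx [:: [:: D j; 0; 0; 0]; [:: 0; D j]] i l
     - lmx [:: [:: D l; 0; 0; 0]; [:: 0; D l]] i j) = chr4 D k i j.
Proof.
move=> d2 d3; rewrite (eq_bigr (fun l => invmx (nmx a) k l * Ldv D i j l)) => [|l _]; last first.
  by rewrite !mxE.
have [L2 L3] : Ldv D i j 2 = 0 /\ Ldv D i j 3 = 0.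
  by move: i j; apply: all4; apply: all4; rewrite /Ldv /= ?d2 ?d3; split; ring.
rewrite sum4 L2 L3 invmx_nmx !mulr0 !addr0 /chr4; congr (_ * _).
by move: k; apply: all4; rewrite !mxE /=; ring.
Qed.

Lemma conn4 X (D : 'I_4 -> R) (i j : 'I_4) : D 2 = 0 -> D 3 = 0 ->
  X 0 0 * chr4 D i 0 j + X 0 1 * chr4 D i 1 j + X 0 2 * chr4 D i 2 j + X 0 3 * chr4 D i 3 j =
  (let a := (X 0 0 * D 0 + X 0 1 * D 1) / 2 in let c := (X 0 0 * D 1 - X 0 1 * D 0) / 2 in
  lmx [:: [::]; [::]; [:: a; c; 0; 0]; [:: - c; a; 0; 0]]) i j.
Proof.
move=> d2 d3.
by move: i j; apply: all4; apply: all4; rewrite [RHS]mxE /= /chr4 /Ldv /= ?d2 ?d3; field.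
Qed.

(** As f depends on x_1 and x_2 only, d_3 and d_4 are parallel and the covariant derivatives of d_1
    and d_2 lie in their span: a single 2 x 2 block remains, a scaling plus a rotation. *)
Lemma conn_mxE x X :
  let a := 'D_X f x / 2 in let c := (X 0 0 * d x 1 - X 0 1 * d x 0) / 2 in
  conn_mx (neutral_metric f) x X =
  lmx [:: [::]; [::]; [:: a; c; 0; 0]; [:: - c; a; 0; 0]].
Proof.
rewrite /= derive_f.
have [d2 d3] := d23 x.
have chr k i j : christoffel (neutral_metric f) x k i j = chr4 (fun i => d x i) k i j.
  rewrite /christoffel neutral_metricE -(@chr4E (f x)) //; congr (_ * _).
  by apply: eq_bigr => l _; rewrite !derive_metric.
apply/matrixP => i j; rewrite mxE sum4 !chr.
exact: (conn4 X (D := fun i => d x i)).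
Qed.

(** The rotation part c of the connection cancels on anti-self-dual bivectors; only the scaling
    contributes, in the entry that contains f. *)
Lemma lift4 (e c a : R) y :
  let A := lmx [:: [::]; [::]; [:: e / 2; c; 0; 0]; [:: - c; e / 2; 0; 0]] in
  - (A *m sig a y + sig a y *m A^T) = antimx 0 0 0 0 0 (- (y 0 0 * e)).
Proof.
move=> A; apply/matrixP => i j; rewrite mxE mxE !mul4 !mxE.
by move: i j; apply: all4; apply: all4; rewrite /=; field.
Qed.

Lemma hlift_sig x y X : hlift (neutral_metric f) (x, sig (f x) y) X =
  (X, antimx 0 0 0 0 0 (- (y 0 0 * 'D_X f x))).
Proof.
by rewrite /hlift /= conn_mxE lift4.
Qed.

Hypothesis f_pos : forall x, 0 < f x.

Lemma J1_sig x y X Y : J1 (neutral_metric f) (neutral_frame f) (x, sig (f x) y)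
    (X, sig (f x) Y + antimx 0 0 0 0 0 (- (y 0 0 * 'D_X f x))) =
  (Ksig (f x) y X, sig (f x) (cross3 y Y) +
     antimx 0 0 0 0 0 (- (y 0 0 * 'D_(Ksig (f x) y X) f x))).
Proof.
rewrite /J1 neutral_metricE Kend_sig !hlift_sig /= addrK vprod_sig //.
by rewrite -[LHS]/(_ + 0, _ + _) addr0 addrC.
Qed.

Lemma twistor_spaceP p : twistor_space (neutral_metric f) p <->
  p.2 = sig (f p.1) (ycoord p.2) /\ hyperboloid (ycoord p.2).
Proof.
rewrite /twistor_space /= neutral_metricE lambda_minusP.
have Q y : qform y y = y 0 0 ^+ 2 - y 0 1 ^+ 2 - y 0 2 ^+ 2 by rewrite /qform -!expr2.
by split=> -[h1 h2]; split => //; move: h2; rewrite h1 bmetric_sig Q ycoord_sig.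
Qed.

End Connection.

(** * Biholomorphic maps *)

Section SmoothMaps.
Context {R : realType}.
Implicit Types V W Z : normedModType R.

Lemma sm_compW V W Z (U : set V) (T : set W) (F : V -> W) (G : W -> Z) :
  findim W -> findim Z -> open U -> open T -> (forall x, U x -> T (F x)) ->
  sm U F -> sm T G -> sm U (fun x => G (F x)).
Proof.
move=> fW [n [b [c [cc cE]]]] oU oT UT sF sG.
apply: (@sm_eq_on _ _ _ _ (fun x => \sum_i c i (G (F x)) *: b i)); [done|by []|].
apply: sm_sum => // i; apply: sm_scalel => //.
by apply: (sm_comp fW oU oT UT sF (G := fun w => c i (G w))); exact: sm_lincomp.
Qed.

Definition curve_in V (S : set V) (c : R -> V) := sm setT c /\ forall t, S (c t).

Lemma tangent_mapP V W (S : set V) (F : V -> W) p v w : tangent_map S F p v w <->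
  exists2 c, curve_in S c & [/\ c 0 = p, 'D_1 c 0 = v & 'D_1 (fun t => F (c t)) 0 = w].
Proof.
split=> [[c [/smooth_onP sc Sc c0 dc dF]]|[c [sc Sc] [c0 dc dF]]].
  by exists c.
by exists c; split=> //; exact/smooth_onP.
Qed.

Lemma smooth_mapP V W (S : set V) (F : V -> W) : smooth_map S F <->
  forall p, S p -> exists U : set V, exists G : V -> W,
    [/\ open U, U p, sm U G & forall q, U q -> S q -> F q = G q].
Proof.
split=> H p /H[U [G [oU Up /smooth_onP sG E]]]; exists U, G; split=> //;
  exact/smooth_onP.
Qed.

Lemma open_curve V (U : set V) (c : R -> V) : open U -> sm setT c -> open (c @^-1` U).
Proof. by move=> oU sc; apply: open_comp => // t _; exact: sm_continuous sc _. Qed.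

Lemma smooth_map_curve V W (S : set V) (F : V -> W) (c : R -> V) :
  findim V -> findim W -> smooth_map S F -> curve_in S c -> sm setT (fun t => F (c t)).
Proof.
move=> fV fW /smooth_mapP sF [sc Sc]; apply: sm_local => t _.
have [U [G [oU Up sG E]]] := sF _ (Sc t); exists (c @^-1` U) => //.
have oc := open_curve oU sc.
apply: (@sm_eq_on _ _ _ _ (fun t => G (c t))) => //; first by move=> s Us; rewrite E.
by apply: (sm_compW fV fW oc oU _ _ sG) => //; exact: sm_subset sc.
Qed.

(** A local smooth extension shows that the derivative of [F] along a curve of [S] depends on the
    velocity alone, so curves with the same velocity can be exchanged. *)
Lemma smooth_map_diff V W (S : set V) (F : V -> W) p : smooth_map S F -> S p ->
  exists L : V -> W, forall c, curve_in S c -> c 0 = p ->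
    'D_1 (fun t => F (c t)) 0 = L ('D_1 c 0).
Proof.
move=> /smooth_mapP sF /sF[U [G [oU Up sG E]]].
exists (fun v => 'D_v G p) => c [sc Sc] c0; rewrite -c0 in Up *.
have dc : differentiable c (0 : R) by exact: sm_differentiable sc _.
rewrite -(derive_chain (1 : R) dc (sm_differentiable sG Up)).
apply: near_eq_derive; apply: (open_near (open_curve oU sc)) => // t Ut.
by rewrite E.
Qed.

Lemma smooth_mapT V W Z (S : set V) (T : set W) (F : V -> W) (G : W -> Z) :
  findim W -> findim Z -> (forall p, S p -> T (F p)) -> smooth_map S F -> smooth_map T G ->
  smooth_map S (fun p => G (F p)).
Proof.
move=> fW fZ ST /smooth_mapP sF /smooth_mapP sG; apply/smooth_mapP => p Sp.
have [U [F' [oU Up sF' EF]]] := sF _ Sp.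
have [U2 [G' [oU2 Up2 sG' EG]]] := sG _ (ST _ Sp).
have oA : open (U `&` F' @^-1` U2).
  rewrite openE => x [Ux U2x]; apply: filterI; first exact: open_nbhs_nbhs.
  by apply: (sm_continuous sF' Ux); exact: open_nbhs_nbhs.
exists (U `&` F' @^-1` U2), (fun x => G' (F' x)); split=> //.
- by split=> //=; rewrite -EF.
- by apply: (sm_compW fW fZ oA oU2 _ _ sG') => [x []|] //; apply: sm_subset sF' => x [].
- by move=> q [Uq U2q] Sq; rewrite EF // -EG // -EF //; exact: ST.
Qed.

(* The inverse [G] needs only be smooth: its derivative is then inverse to that of [F]. *)
Lemma biholomorphicI V W (S : set V) J (T : set W) J' (F : V -> W) (G : W -> V) :
  findim V -> findim W -> holomorphic S J T J' F -> smooth_map T G -> (forall q, T q -> S (G q)) ->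
  (forall p, S p -> G (F p) = p) -> (forall q, T q -> F (G q) = q) ->
  biholomorphic S J T J'.
Proof.
move=> fV fW hF sG TS GF FG; have [ST sF tF] := hF; exists F, G; split=> //; split=> // q v w Tq.
move=> /tangent_mapP[c [sc Sc] [c0 dc dG]].
have cS : curve_in S (fun t => G (c t)).
  by split; [exact: smooth_map_curve sG _|move=> t; exact: TS].
have : tangent_map S F (G q) w v.
  apply/tangent_mapP; exists (fun t => G (c t)) => //; rewrite c0; split=> //.
  by rewrite -dc; congr (derive _ _ _); apply/funext => t; rewrite FG.
move=> /(tF _ _ _ (TS _ Tq)); rewrite FG // => /tangent_mapP[c3 [sc3 Sc3] [c30 dc3 dF3]].
apply/tangent_mapP; exists (fun t => F (c3 t)).
  by split; [exact: smooth_map_curve sF _|move=> t; exact: ST].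
split=> //; first by rewrite c30 FG.
by rewrite -dc3; congr (derive _ _ _); apply/funext => t; rewrite GF.
Qed.

(** Two curves of [T] have the velocity J' w1: the image of the curve provided by [F], and the one
    provided by [G]. By [smooth_map_diff], [G] cannot tell them apart. *)
Lemma holomorphic_comp V W Z (S : set V) J (T : set W) J' (Q : set Z) J''
    (F : V -> W) (G : W -> Z) :
  findim V -> findim W -> findim Z ->
  holomorphic S J T J' F -> holomorphic T J' Q J'' G -> holomorphic S J Q J'' (fun p => G (F p)).
Proof.
move=> fV fW fZ [ST sF tF] [TQ sG tG]; split.
- by move=> p /ST/TQ.
- exact: smooth_mapT ST sF sG.
move=> p v w Sp /tangent_mapP[c [sc Sc] [c0 dc dG]].
have Fc (a : R -> V) : curve_in S a -> curve_in T (fun t => F (a t)).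
  by move=> [sa Sa]; split; [exact: smooth_map_curve sF _|move=> t; exact: ST].
have [LG LGE] := smooth_map_diff sG (ST _ Sp).
set w1 := 'D_1 (fun t => F (c t)) 0.
have h1 : tangent_map S F p v w1 by apply/tangent_mapP; exists c.
have h2 : tangent_map T G (F p) w1 w.
  by apply/tangent_mapP; exists (fun t => F (c t)); [exact: Fc|rewrite c0].
have /tangent_mapP[c2 Sc2 [c20 dc2 dF2]] := tF _ _ _ Sp h1.
have /tangent_mapP[c3 Sc3 [c30 dc3 dG3]] := tG _ _ _ (ST _ Sp) h2.
apply/tangent_mapP; exists c2 => //; split=> //.
by rewrite (LGE _ (Fc _ Sc2)) ?c20 // dF2 -dc3 -LGE.
Qed.

Lemma biholomorphic_trans V W Z (S : set V) J (T : set W) J' (Q : set Z) J'' :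
  findim V -> findim W -> findim Z ->
  biholomorphic S J T J' -> biholomorphic T J' Q J'' -> biholomorphic S J Q J''.
Proof.
move=> fV fW fZ [F [G [hF hG GF FG]]] [F2 [G2 [hF2 hG2 GF2 FG2]]].
have [ST _ _] := hF; have [QT _ _] := hG2.
exists (fun p => F2 (F p)), (fun q => G (G2 q)).
split; [exact: holomorphic_comp hF hF2| |by move=> p Sp; rewrite GF2 ?GF //; exact: ST
  |by move=> q Qq; rewrite FG ?FG2 //; exact: QT].
exact: holomorphic_comp hG2 hG.
Qed.

End SmoothMaps.

(** * Curves on the hyperboloid with prescribed velocity *)

Section Curves.
Context {R : realType}.
Implicit Types V W Z : normedModType R.

Lemma derive_entry V m n (F : V -> 'M[R]_(m, n)) x v i j : differentiable F x ->
  ('D_v F x) i j = 'D_v (fun y => F y i j) x.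
Proof.
move=> dF.
have l : linear (fun M : 'M[R]_(m, n) => M i j : R) by move=> a M N; rewrite !mxE.
by apply: esym (derive_lincomp (L := mklin l) v _ dF) => M; exact: coord_continuous.
Qed.

Lemma derive_fst V W Z (F : V -> W * Z) x v : differentiable F x ->
  ('D_v F x).1 = 'D_v (fun y => (F y).1) x.
Proof. by move=> dF; apply: esym (derive_lincomp (L := fst) v _ dF) => M; exact: cvg_fst. Qed.

Lemma derive_snd V W Z (F : V -> W * Z) x v : differentiable F x ->
  ('D_v F x).2 = 'D_v (fun y => (F y).2) x.
Proof. by move=> dF; apply: esym (derive_lincomp (L := snd) v _ dF) => M; exact: cvg_snd. Qed.

Lemma derive_scalel V W (F : V -> R) (a : W) x v : differentiable F x ->
  'D_v (fun y => F y *: a) x = 'D_v F x *: a.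
Proof.
move=> dF; apply: (derive_lincomp (L := mklin (scalel_linear a)) v _ dF) => b.
by apply: cvgZr_tmp; exact: cvg_id.
Qed.

Lemma derive_even (F : R -> R) : (forall t, F (- t) = F t) -> differentiable F (0 : R) ->
  'D_1 F (0 : R) = 0.
Proof.
move=> FN dF.
have dN : 'D_1 (-%R : R -> R) (0 : R) = -1.
  by apply: derive_affine => h; rewrite oppr0 addr0 addr0 /GRing.scale /= mulr1 mulrN1.
have dno : differentiable (-%R : R -> R) (0 : R) by exact: sm_differentiable (smN openT (sm_id openT)) (I : setT (0 : R)).
have dF' : differentiable F (- (0 : R)) by rewrite oppr0.
have := derive_chain (1 : R) dno dF'; rewrite dN oppr0.
have -> : (fun x : R => F (- x)) = F by apply/funext.
rewrite [in RHS](deriveE _ dF) linearN /= -(deriveE _ dF) => H.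
by lra.
Qed.

(** A reverse Cauchy-Schwarz inequality: multiplied by y_1 ^ 2 >= 1, the form becomes minus a sum of
    squares. *)
Lemma qform_tangent (y V : 'rV[R]_3) : hyperboloid y -> qform y V = 0 -> qform V V <= 0.
Proof.
rewrite /hyperboloid /= /qform -!expr2.
move: (y 0 0) (y 0 1) (y 0 2) (V 0 0) (V 0 1) (V 0 2) => a b c A B D h1 h2.
have a1 : 1 <= a ^+ 2 by have := sqr_ge0 b; have := sqr_ge0 c; lra.
rewrite -(pmulr_rle0 _ (lt_le_trans ltr01 a1)).
have -> : a ^+ 2 * (A ^+ 2 - B ^+ 2 - D ^+ 2) =
    (b * B + c * D) ^+ 2 - (1 + b ^+ 2 + c ^+ 2) * (B ^+ 2 + D ^+ 2).
  have -> : b * B + c * D = a * A by lra.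
  have -> : 1 + b ^+ 2 + c ^+ 2 = a ^+ 2 by lra.
  by ring.
have -> : (b * B + c * D) ^+ 2 - (1 + b ^+ 2 + c ^+ 2) * (B ^+ 2 + D ^+ 2) =
  - ((b * D - c * B) ^+ 2 + B ^+ 2 + D ^+ 2) by ring.
by rewrite oppr_le0 !addr_ge0 ?sqr_ge0.
Qed.

(** The curve sqrt(1 - t ^ 2 q(V)) y + t V stays on the hyperboloid by orthogonality. It is defined
    for all t because q(V) <= 0, and the square root is even in t, so the velocity at 0 is V. *)
Lemma hyperboloid_arc (y V : 'rV[R]_3) : hyperboloid y -> qform y V = 0 ->
  exists2 c : R -> 'rV[R]_3, curve_in (@hyperboloid R) c & c 0 = y /\ 'D_1 c 0 = V.
Proof.
move=> Hy yV; have V0 := qform_tangent Hy yV.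
have oR : open [set: R] by exact: openT.
pose r (t : R) := 1 - t ^+ 2 * qform V V.
have r0 t : 0 < r t.
  rewrite subr_gt0; apply: le_lt_trans ltr01; by rewrite mulr_ge0_le0 // sqr_ge0.
have sr : sm setT r.
  apply: smB => //; first exact: sm_cst.
  by apply: smM => //; [exact: smX oR (sm_id oR)|exact: sm_cst].
have ssq : sm setT (fun t => Num.sqrt (r t)).
  exact: (sm_comp (@findim_R R) oR (@open_gt _ 0) (fun t _ => r0 t) sr sm_sqrt).
pose c t := Num.sqrt (r t) *: y + t *: V.
have sc : sm setT c by apply: smD => //; apply: sm_scalel => //; exact: sm_id.
have c0 : c 0 = y by rewrite /c /r expr0n mul0r subr0 sqrtr1 scale1r scale0r addr0.
exists c; [split=> // t|split=> //].
  rewrite /hyperboloid /= !mxE.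
  have sq : Num.sqrt (r t) ^+ 2 = r t by rewrite sqr_sqrtr // ltW.
  move: Hy yV; rewrite /hyperboloid /= => Hy yV.
  transitivity (Num.sqrt (r t) ^+ 2 * (y 0 0 ^+ 2 - y 0 1 ^+ 2 - y 0 2 ^+ 2) +
     2 * t * Num.sqrt (r t) * qform y V + t ^+ 2 * qform V V); first by rewrite /qform; ring.
  by rewrite Hy yV sq /r; ring.
have ds := sm_differentiable ssq (I : setT (0 : R)).
have D0 : 'D_1 (fun t => Num.sqrt (r t)) (0 : R) = 0.
  apply: derive_even => [t|//]; by rewrite /r sqrrN.
rewrite /c deriveD; [|exact: sm_derivable (sm_scalel y oR ssq) _|
  exact: sm_derivable (sm_scalel V oR (sm_id oR)) _].
rewrite derive_scalel // D0 scale0r add0r derive_scalel; last exact: sm_differentiable (sm_id oR) _.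
by rewrite derive_id scale1r.
Qed.

End Curves.

(** * The twistor space as R^4 x H *)

Section Chart.
Context {R : realType}.
Implicit Types V W Z : normedModType R.

Lemma sm_antimx V (U : set V) (a b c d e g : V -> R) : open U -> sm U a -> sm U b ->
  sm U c -> sm U d -> sm U e -> sm U g ->
  sm U (fun x => antimx (a x) (b x) (c x) (d x) (e x) (g x)).
Proof.
move=> oU sa sb sc sd se sg; apply: sm_mx => // i j.
under eq_fun do rewrite mxE.
move: i j; apply: all4; apply: all4 => /=; first [exact: sm_cst|assumption|exact: smN].
Qed.

Lemma derive_antimx V (U : set V) (a b c d e g : V -> R) x v : open U -> sm U a -> sm U b ->
  sm U c -> sm U d -> sm U e -> sm U g -> U x ->
  'D_v (fun x => antimx (a x) (b x) (c x) (d x) (e x) (g x)) x =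
  antimx ('D_v a x) ('D_v b x) ('D_v c x) ('D_v d x) ('D_v e x) ('D_v g x).
Proof.
move=> oU sa sb sc sd se sg Ux; apply/matrixP => i j; rewrite derive_entry; last first.
  by apply: sm_differentiable Ux; exact: sm_antimx.
under eq_fun do rewrite mxE.
rewrite [RHS]mxE.
have D0 : 'D_v (fun=> 0 : R) x = 0 by exact: derive_cst.
have DN (F : V -> R) : sm U F -> 'D_v (fun x => - F x) x = - 'D_v F x.
  by move=> sF; rewrite deriveN //; exact: sm_derivable Ux.
move: (fun F : V -> R => 'D_v F x) D0 DN => D D0 DN.
by move: i j; apply: all4; apply: all4 => /=; rewrite ?D0 ?DN.
Qed.

Lemma sm_lrow V (U : set V) n (l : seq (V -> R)) : open U ->
  (forall i, (i < size l)%N -> sm U (nth (fun=> 0) l i)) ->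
  sm U (fun x => lrow n [seq F x | F : V -> R <- l]).
Proof.
move=> oU sl; apply: sm_mx => // i j.
under eq_fun do rewrite mxE.
have [jl|lj] := ltnP j (size l).
  by under eq_fun do rewrite (nth_map (fun=> 0)) //; exact: sl.
by under eq_fun do rewrite nth_default ?size_map //; exact: sm_cst.
Qed.

Lemma sm_ycoord V (U : set V) (s : V -> 'M[R]_4) : open U -> sm U s ->
  sm U (fun x => ycoord (s x)).
Proof.
move=> oU ss.
apply: (@sm_lrow _ _ 3 [:: fun x => (s x 0 3 - s x 1 2) / 2; fun x => s x 0 2;
  fun x => (s x 0 3 + s x 1 2) / 2]) => //.
by move=> [|[|[|//]]] _ /=; solve_sm.
Qed.

Variable f : 'rV[R]_4 -> R.
Hypothesis sf : sm setT f.

Lemma sm_sig V (U : set V) (x : V -> 'rV[R]_4) (y : V -> 'rV[R]_3) : open U -> sm U x -> sm U y ->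
  sm U (fun t => sig (f (x t)) (y t)).
Proof.
move=> oU sx sy; have sfx : sm U (fun t => f (x t)).
  by apply: (sm_comp (findim_mx 1 4) oU openT _ sx sf).
by apply: sm_antimx => //; solve_sm.
Qed.

(** The two summands are the vertical and the horizontal part of the velocity: the second one, due
    to the variation of f, is the lift of [hlift_sig]. This is the form expected by [J1_sig]. *)
Lemma derive_sig (x : R -> 'rV[R]_4) (y : R -> 'rV[R]_3) : sm setT x -> sm setT y ->
  'D_1 (fun t => sig (f (x t)) (y t)) (0 : R) =
  sig (f (x 0)) ('D_1 y 0) + antimx 0 0 0 0 0 (- (y 0 0 0 * 'D_('D_1 x 0) f (x 0))).
Proof.
move=> sx sy; have oR : open [set: R] by exact: openT.
have sfx : sm setT (fun t => f (x t)).
  by apply: (sm_comp (findim_mx 1 4) oR openT _ sx sf).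
have sy_ i : sm setT (fun t => y t 0 i) by exact: sm_entry.
have dy_ i : 'D_1 (fun t => y t 0 i) 0 = 'D_1 y 0 0 i.
  by rewrite derive_entry //; exact: sm_differentiable sy _.
have dd (F : R -> R) : sm setT F -> derivable F 0 1 by move=> sF; exact: sm_derivable sF _.
rewrite (derive_antimx _ oR) //; [|solve_sm..].
rewrite add_antimx derive_cst deriveD ?deriveB ?deriveN ?deriveM; try (by apply: dd; solve_sm).
rewrite !dy_ /sig.
have -> : 'D_1 (fun t : R => f (x t)) 0 = 'D_('D_1 x 0) f (x 0).
  by rewrite (derive_chain _ (sm_differentiable sx I) (sm_differentiable sf I)).
congr antimx; rewrite ?addr0 // /GRing.scale /=; ring.
Qed.

Hypothesis f_dep : forall x x' : 'rV[R]_4, x 0 0 = x' 0 0 -> x 0 1 = x' 0 1 -> f x = f x'.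
Hypothesis f_pos : forall x, 0 < f x.

Definition R4H : set ('rV[R]_4 * 'rV[R]_3) := [set q | hyperboloid q.2].
Definition JR4H (q w : 'rV[R]_4 * 'rV[R]_3) := (Ksig (f q.1) q.2 w.1, cross3 q.2 w.2).
Definition chart (q : 'rV[R]_4 * 'rV[R]_3) := (q.1, sig (f q.1) q.2).
Definition unchart (p : 'rV[R]_4 * 'M[R]_4) := (p.1, ycoord p.2).

Lemma qform_cross y w : qform y (cross3 y w) = 0 :> R.
Proof. by rewrite /qform !mxE /= !(tnth_nth 0) /=; ring. Qed.

Lemma chartK q : unchart (chart q) = q.
Proof. by case: q => x y; rewrite /unchart /= ycoord_sig. Qed.

Lemma unchartK p : twistor_space (neutral_metric f) p -> chart (unchart p) = p.
Proof. by case: p => x s /(twistor_spaceP) [/= h1 _]; rewrite /chart /= -h1. Qed.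

Lemma R4H_arc x y X Y : hyperboloid y -> qform y Y = 0 ->
  exists2 c, curve_in R4H c & c 0 = (x, y) /\ 'D_1 c 0 = (X, Y).
Proof.
move=> Hy yY; have oR : open [set: R] by exact: openT.
have [c [sc Hc] [c0 dc]] := hyperboloid_arc Hy yY.
have sx : sm setT (fun t : R => x + t *: X).
  by apply: smD => //; [exact: sm_cst|apply: sm_scalel => //; exact: sm_id].
exists (fun t => (x + t *: X, c t)); first by split=> // ; exact: sm_pair.
rewrite c0 scale0r addr0; split=> //.
rewrite (derive_pair _ (sm_differentiable sx I) (sm_differentiable sc I)) dc; congr pair.
by apply: derive_affine => h; rewrite scale0r addr0 addr0 addrC [h *: 1]mulr1.
Qed.

Lemma twistor_R4H : biholomorphic (twistor_space (neutral_metric f))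
  (J1 (neutral_metric f) (neutral_frame f)) R4H JR4H.
Proof.
have oV W : open [set: W] by exact: openT.
have fV : findim ('rV[R]_4 * 'M[R]_4)%type by apply: findim_prod; exact: findim_mx.
have fW : findim ('rV[R]_4 * 'rV[R]_3)%type by apply: findim_prod; exact: findim_mx.
have suc : sm setT unchart.
  by apply: sm_pair; [|apply: sm_fst => //; exact: sm_id|apply: sm_ycoord => //;
     apply: sm_snd => //; exact: sm_id].
have sch : sm setT chart.
  apply: sm_pair; first by []. by apply: sm_fst => //; exact: sm_id.
  by apply: sm_sig => //; [apply: sm_fst|apply: sm_snd] => //; exact: sm_id.
have glob (V W : normedModType R) (S : set V) (F : V -> W) : sm setT F -> smooth_map S F.
  by move=> sF; apply/smooth_mapP => p _; exists setT, F; split.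
apply: (@biholomorphicI _ _ _ _ _ _ _ unchart chart) => //; first last.
- by move=> q _; exact: chartK.
- exact: unchartK.
- by move=> [x y] Hy; apply/twistor_spaceP => //=; rewrite ycoord_sig.
- exact: glob.
split; [by move=> p /twistor_spaceP[]|exact: glob|].
move=> p v w Sp /tangent_mapP[c [sc Sc] [c0 dc dF]].
pose c' t := unchart (c t).
have sc' : sm setT c' by apply: (sm_compW fV fW (oV _) (oV _) _ sc suc).
have cc : c = (fun t => chart (c' t)) by apply/funext => t; rewrite /c' unchartK.
have [x' y'] : sm setT (fun t => (c' t).1) /\ sm setT (fun t => (c' t).2).
  by split; [apply: sm_fst|apply: sm_snd].
have dch (a : R -> 'rV[R]_4 * 'rV[R]_3) : sm setT a -> 'D_1 (fun t => chart (a t)) (0 : R) =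
    (('D_1 a 0).1, sig (f (a 0).1) ('D_1 a 0).2 +
       antimx 0 0 0 0 0 (- ((a 0).2 0 0 * 'D_('D_1 a 0).1 f (a 0).1))).
  move=> sa; have da := sm_differentiable sa (I : setT (0 : R)).
  have s1 : sm setT (fun t => (a t).1) by apply: sm_fst.
  have s2 : sm setT (fun t => (a t).2) by apply: sm_snd.
  rewrite (derive_pair _ (sm_differentiable s1 I) (sm_differentiable (sm_sig (oV _) s1 s2) I)).
  rewrite (derive_sig s1 s2) -(derive_fst _ da) -(derive_snd _ da).
  exact: erefl.
have pE : p = chart (c' 0) by rewrite -c0 cc.
have wE : w = 'D_1 c' 0 by rewrite -dF.
have vE := dch _ sc'; rewrite -cc dc -wE in vE.
have c'0 : c' 0 = unchart p by rewrite /c' c0.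
have Hy : hyperboloid (c' 0).2 by rewrite c'0; have /twistor_spaceP[] := Sp.
(* A curve realizing J v is built in R^4 x H, where [cross3] gives a tangent vector, and carried
   back by [chart]. *)
have [a [sa Ha] [a0 da]] := R4H_arc (c' 0).1 (Ksig (f (c' 0).1) (c' 0).2 w.1) Hy (qform_cross (c' 0).2 w.2).
apply/tangent_mapP; exists (fun t => chart (a t)).
  split; first exact: (sm_compW fW fV (oV _) (oV _) _ sa sch).
  by move=> t; apply/twistor_spaceP => //=; rewrite ycoord_sig; split=> //; exact: Ha.
split.
- by rewrite a0 -surjective_pairing -pE.
- by rewrite dch // a0 da vE pE /= J1_sig.
- under eq_fun do rewrite chartK.
  by rewrite da -c'0.
Qed.

End Chart.

(** * Holomorphic coordinates *)

Section Algebra.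
Context {R : realType}.
Notation C := R[i].
Notation Re := complex.Re.
Notation Im := complex.Im.
Implicit Types (x X : 'rV[R]_4) (y Y : 'rV[R]_3).

(** Here z is zeta, b is |y_1|, and conjugates are independent letters. The two sides differ by a
    multiple of the relation [zet_norm], which encodes the hyperboloid. *)
Lemma alg_u (i z zb b Z Zb : C) : z * zb * (1 + b) = b - 1 ->
  (i * b * Z + i * z * (1 + b) * Zb) + z * (- (i * b * Zb) - i * zb * (1 + b) * Z) =
  i * (Z + z * Zb).
Proof.
move=> H; transitivity (i * (Z + z * Zb) + i * Z * (b - 1 - z * zb * (1 + b))); first by ring.
by rewrite H subrr mulr0 addr0.
Qed.

(** [A] and [B] stand for d_1 k and d_2 k. The terms in f produced by K_y on the coordinate W are
    compensated by the variation of 2 zeta k exactly when k solves the equation. *)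
Lemma alg_v (i z zb b Z Zb W Wb f A B : C) : z * zb * (1 + b) = b - 1 ->
  (1 - z) * A + i * (1 + z) * B = f ->
  let E Z Zb W Wb := W - z * Wb - z * ((Z + Zb) * A - i * (Z - Zb) * B) in
  E (i * b * Z + i * z * (1 + b) * Zb) (- (i * b * Zb) - i * zb * (1 + b) * Z)
    (i * b * W - i * z * (1 + b) * (Wb + f * Zb))
    (- (i * b * Wb) + i * zb * (1 + b) * (W + f * Z)) = i * E Z Zb W Wb.
Proof.
move=> H <- /=; set E1 := (X in _ = X).
transitivity (E1 + (i * W - i * z * A * Z + i * i * z * B * Z) * (b - 1 - z * zb * (1 + b))).
  by rewrite /E1; ring.
by rewrite H subrr mulr0 addr0.
Qed.

Lemma alg_zeta (n nb b N Nb B0 : C) : n * nb = (b - 1) * (1 + b) -> 2 * b * B0 = nb * N + n * Nb ->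
  2 * (b * N - B0 * n) * (1 + b) - n * (nb * N - n * Nb) = 2 * (N * (1 + b) - n * B0).
Proof.
move=> h1 h2; set E1 := (X in _ = X).
transitivity (E1 + 2 * N * ((b - 1) * (1 + b) - n * nb) - n * (2 * b * B0 - nb * N - n * Nb)).
  by rewrite /E1; ring.
by rewrite h1 h2; ring.
Qed.

(* [e] is the sign of y_1: on the sheet y_1 < 0, [zz], [ww] and [eta] are conjugated. *)
Variable e : R.
Hypothesis He : e = 1 \/ e = -1.

Definition zz x : C := x 0 0 +i* (e * x 0 1).
Definition ww x : C := x 0 2 +i* (e * x 0 3).
Definition eta y : C := y 0 1 +i* (e * y 0 2).
Definition zet y : C := 'i%C * eta y * ((1 + e * y 0 0)^-1)%:C.
Definition dzet y Y : C :=
  'i%C * (eta Y * ((1 + e * y 0 0)^-1)%:C - eta y * (e * Y 0 0 / (1 + e * y 0 0) ^+ 2)%:C).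

(** Smooth maps on H are given by extensions to open sets, so the coordinates are defined on an open
    neighbourhood of the sheet; the second condition says |zet| < 1. *)
Definition Ue : set 'rV[R]_3 := [set y | 0 < e * y 0 0] `&`
  [set y | y 0 1 ^+ 2 + (e * y 0 2) ^+ 2 < (1 + e * y 0 0) ^+ 2].

Lemma zz_Ksig a y X : zz (Ksig a y X) =
  'i%C * (e * y 0 0)%:C * zz X - eta y * (zz X)^*%C.
Proof.
by apply: eqc; rewrite ?(ReMc, ImMc, ReDc, ImDc) /= ?(ReMc, ImMc) /= !mxE /=; case: He => ->; ring.
Qed.

Lemma ww_Ksig a y X : ww (Ksig a y X) =
  'i%C * (e * y 0 0)%:C * ww X + eta y * ((ww X)^*%C + a%:C * (zz X)^*%C).
Proof.
by apply: eqc; rewrite ?(ReMc, ImMc, ReDc, ImDc) /= ?(ReMc, ImMc) /= !mxE /=; case: He => ->; ring.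
Qed.

Lemma Re2_conj (z : C) : 2 * (Re z)%:C = z + z^*%C.
Proof. by apply: eqc; rewrite ?(ReMc, ImMc, ReDc, ImDc); case: z => a b /=; ring. Qed.

Lemma Im2_conj (z : C) : 2 * (Im z)%:C = - 'i%C * (z - z^*%C).
Proof. by apply: eqc; rewrite ?(ReMc, ImMc, ReDc, ImDc); case: z => a b /=; ring. Qed.

Section Sheet.
Variable y : 'rV[R]_3.
Hypothesis Hy : hyperboloid y.
Hypothesis ey : 0 < e * y 0 0.
Let b : C := (e * y 0 0)%:C.

Let a0 : 1 + e * y 0 0 != 0. Proof. by rewrite gt_eqF // ltr_wpDl. Qed.

Let aE : 1 + b = (1 + e * y 0 0)%:C.
Proof. by apply: eqc; rewrite ?ReDc ?ImDc /= ?addr0. Qed.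

Let a0C : 1 + b != 0.
Proof. by rewrite aE; apply: contraNneq a0 => /complexI ->. Qed.

Lemma zetE : zet y = 'i%C * eta y / (1 + b).
Proof. by rewrite /zet aE -fmorphV. Qed.

Lemma eta_zet : eta y = - 'i%C * zet y * (1 + b).
Proof.
rewrite zetE -!mulrA mulVf // mulr1 mulrA mulNr -expr2 sqr_i opprK mul1r //.
Qed.

Lemma eta_norm : eta y * (eta y)^*%C = (b - 1) * (1 + b).
Proof.
move: Hy; rewrite /hyperboloid /= => H.
have -> : (b - 1) * (1 + b) = ((e * y 0 0) ^+ 2 - 1)%:C.
  by rewrite /b rmorphB rmorphXn /=; ring.
apply: eqc; rewrite ?(ReMc, ImMc) /=; last by ring.
by rewrite -H; case: He => ->; ring.
Qed.

Lemma conj_zet : (zet y)^*%C = - 'i%C * (eta y)^*%C / (1 + b).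
Proof.
rewrite aE -fmorphV.
by apply: eqc; rewrite /zet !(ReMc, ImMc) /= ?(ReMc, ImMc) /=; ring.
Qed.

Lemma zet_norm : zet y * (zet y)^*%C * (1 + b) = b - 1.
Proof.
rewrite conj_zet zetE.
transitivity ((- 'i%C * 'i%C) * (eta y * (eta y)^*%C) / (1 + b) * ((1 + b) / (1 + b))); first by ring.
by rewrite divff // mulr1 mulNr -expr2 sqr_i opprK mul1r eta_norm mulfK.
Qed.

Lemma Ue_sheet : Ue y.
Proof.
split=> //=; move: Hy ey; rewrite /hyperboloid /=.
by case: He => -> H ?; nra.
Qed.

(** [zet] is, up to the factor i and the conjugation on the second sheet, stereographic projection
    of the sheet onto the disk. After clearing denominators its holomorphy is [alg_zeta]. *)
Lemma dzet_cross Y : qform y Y = 0 -> dzet y (cross3 y Y) = 'i%C * dzet y Y.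
Proof.
move=> yY; have two : (2 : C) != 0 by rewrite pnatr_eq0.
set B0 : C := (e * Y 0 0)%:C; set n := eta y; set N := eta Y.
have dE W : dzet y W = 'i%C * ((eta W * (1 + b) - n * (e * W 0 0)%:C) / (1 + b) ^+ 2).
  rewrite /dzet fmorph_div /= rmorphXn /= fmorphV /= -aE.
  rewrite -/n; congr (_ * _); move: (1 + b) a0C => w w0; by field.
(* The tangency condition, in the form of the differential of [eta_norm]. *)
have h2 : 2 * b * B0 = n^*%C * N + n * N^*%C.
  apply: eqc; rewrite ?(ReMc, ImMc, ReDc, ImDc) /= ?(ReMc, ImMc) /=; last by ring.
  by move: yY; rewrite /qform => H; case: He => ->; lra.
have h3 : eta (cross3 y Y) = 'i%C * (b * N - B0 * n).
  apply: eqc; rewrite ?(ReMc, ImMc, ReDc, ImDc) /= ?(ReMc, ImMc) /= !mxE !(tnth_nth 0) /=;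
  case: He => ->; ring.
have h4 : 2 * (e * cross3 y Y 0 0)%:C = 'i%C * (n^*%C * N - n * N^*%C).
  apply: eqc; rewrite ?(ReMc, ImMc, ReDc, ImDc) /= ?(ReMc, ImMc) /= !mxE !(tnth_nth 0) /=;
  ring.
rewrite !dE; congr (_ * _); rewrite mulrA; congr (_ / _).
apply: (mulfI two); rewrite mulrBr mulrCA -[2 * (n * _)]mulrCA h3 h4.
have := alg_zeta eta_norm h2; rewrite -/n -/N => H.
transitivity ('i%C * (2 * (b * N - B0 * n) * (1 + b) - n * (n^*%C * N - n * N^*%C))).
  by rewrite /n; ring.
by rewrite H /n; ring.
Qed.

End Sheet.

End Algebra.

(** * Smoothness and differentials of the coordinates *)

Section Coordinates.
Context {R : realType}.
Notation C := R[i].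
Notation Re := complex.Re.
Notation Im := complex.Im.
Notation P := (R * R * R * R)%type.
Implicit Types (V : normedModType R).

Lemma cD_conj V (U : set V) (F : V -> C) v x : csm U F -> U x ->
  cD v (fun t => (F t)^*%C) x = (cD v F x)^*%C.
Proof.
move=> [F1 F2] Ux; apply: eqc; rewrite /= /dvs /=.
  by apply: (f_equal (fun G => 'D_v G x)); apply/funext => t; case: (F t).
rewrite -deriveN; last exact: sm_derivable F2 Ux.
apply: (f_equal (fun G => 'D_v G x)); apply/funext => t.
by rewrite -[RHS]/(- Im (F t)); case: (F t).
Qed.

Lemma dir_basis (a b c d : R) :
  (a, b, c, d) = 1 *: (a *: eX1 + b *: eX2) + 1 *: (c *: eZ1 + d *: eZ2) :> P.
Proof.
rewrite !scale1r /eX1 /eX2 /eZ1 /eZ2.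
apply: injective_projections; [apply: injective_projections; [apply: injective_projections|]|];
  rewrite /= /GRing.scale /=; ring.
Qed.

Variable e : R.

Lemma csm_zz V (U : set V) (x : V -> 'rV[R]_4) : open U -> sm U x -> csm U (fun t => zz e (x t)).
Proof. by move=> oU sx; apply: csm_pair; solve_sm. Qed.

Lemma csm_ww V (U : set V) (x : V -> 'rV[R]_4) : open U -> sm U x -> csm U (fun t => ww e (x t)).
Proof. by move=> oU sx; apply: csm_pair; solve_sm. Qed.

Lemma csm_eta V (U : set V) (y : V -> 'rV[R]_3) : open U -> sm U y -> csm U (fun t => eta e (y t)).
Proof. by move=> oU sy; apply: csm_pair; solve_sm. Qed.

Lemma Ue_neq0 (y : 'rV[R]_3) : Ue e y -> 1 + e * y 0 0 != 0.
Proof. by move=> [y0 _]; rewrite gt_eqF // ltr_wpDl. Qed.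

Lemma open_Ue : open (@Ue R e).
Proof.
have oT : open [set: 'rV[R]_3] by exact: openT.
have sy i : sm setT (fun y : 'rV[R]_3 => y 0 i) by apply: sm_entry => //; exact: sm_id.
have -> : @Ue R e = [set y | - (e * y 0 0) < 0] `&`
    [set y | y 0 1 ^+ 2 + (e * y 0 2) ^+ 2 - (1 + e * y 0 0) ^+ 2 < 0].
  by apply/seteqP; split=> y; rewrite /Ue /= oppr_lt0 subr_lt0.
by apply: openI; apply: open_sm_lt; solve_sm.
Qed.

Lemma sm_a V (U : set V) (y : V -> 'rV[R]_3) : open U -> sm U y ->
  (forall t, U t -> Ue e (y t)) -> sm U (fun t => (1 + e * y t 0 0)^-1).
Proof. by move=> oU sy yU; apply: smV => [//|t /yU/Ue_neq0//|]; solve_sm. Qed.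

Lemma csm_zet V (U : set V) (y : V -> 'rV[R]_3) : open U -> sm U y ->
  (forall t, U t -> Ue e (y t)) -> csm U (fun t => zet e (y t)).
Proof.
move=> oU sy yU; apply: csmM => //; last by apply: csm_rc => //; exact: sm_a.
by apply: csmM => //; [exact: csm_cst|exact: csm_eta].
Qed.

Definition pp (x : 'rV[R]_4) (y : 'rV[R]_3) : P := (x 0 0, e * x 0 1, Re (zet e y), Im (zet e y)).

Lemma zeta_pp x y : zeta (pp x y) = zet e y.
Proof. exact: eqc. Qed.

Lemma UP_pp x y : Ue e y -> UP (pp x y).
Proof.
move=> Uy; have a0 := Ue_neq0 Uy; have [/= y0 yn] := Uy.
rewrite /UP /= zeta_pp /norm2 /zet ?(ReMc, ImMc) /=.
have -> : forall p q r : R, (0 * p - 1 * q) * r - (0 * q + 1 * p) * 0 = - q * r by move=> *; ring.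
set a := 1 + _ in a0 yn *.
rewrite [X in X < _](_ : _ = (y 0 1 ^+ 2 + (e * y 0 2) ^+ 2) / a ^+ 2); last by field.
by rewrite ltr_pdivrMr ?mul1r // exprn_even_gt0.
Qed.

Lemma sm_pp V (U : set V) (x : V -> 'rV[R]_4) (y : V -> 'rV[R]_3) : open U -> sm U x -> sm U y ->
  (forall t, U t -> Ue e (y t)) -> sm U (fun t => pp (x t) (y t)).
Proof. by move=> oU sx sy yU; have [z1 z2] := csm_zet oU sy yU; solve_sm. Qed.

Section Derivatives.
Variables (A : set R) (x : R -> 'rV[R]_4) (y : R -> 'rV[R]_3).
Hypotheses (oA : open A) (A0 : A 0) (sx : sm A x) (sy : sm A y) (yU : forall t, A t -> Ue e (y t)).
Notation X := ('D_1 x (0 : R)).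
Notation Y := ('D_1 y (0 : R)).

Let x_ i : 'D_1 (fun t => x t 0 i) (0 : R) = X 0 i.
Proof. by rewrite derive_entry //; exact: sm_differentiable sx A0. Qed.

Let ex_ i : 'D_1 (fun t => e * x t 0 i) (0 : R) = e * X 0 i.
Proof.
rewrite -x_ deriveM; [|exact: derivable_cst|exact: sm_derivable (sm_entry 0 i oA sx) A0].
by rewrite derive_cst /GRing.scale /= mulr0 addr0.
Qed.

Let y_ i : 'D_1 (fun t => y t 0 i) (0 : R) = Y 0 i.
Proof. by rewrite derive_entry //; exact: sm_differentiable sy A0. Qed.

Let ey_ i : 'D_1 (fun t => e * y t 0 i) (0 : R) = e * Y 0 i.
Proof.
rewrite -y_ deriveM; [|exact: derivable_cst|exact: sm_derivable (sm_entry 0 i oA sy) A0].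
by rewrite derive_cst /GRing.scale /= mulr0 addr0.
Qed.

Lemma cD_zz : cD (1 : R) (fun t => zz e (x t)) 0 = zz e X.
Proof. by apply: eqc; rewrite /= /dvs /=; [exact: x_|exact: ex_]. Qed.

Lemma cD_ww : cD (1 : R) (fun t => ww e (x t)) 0 = ww e X.
Proof. by apply: eqc; rewrite /= /dvs /=; [exact: x_|exact: ex_]. Qed.

Lemma cD_eta : cD (1 : R) (fun t => eta e (y t)) 0 = eta e Y.
Proof. by apply: eqc; rewrite /= /dvs /=; [exact: y_|exact: ey_]. Qed.

Lemma cD_zet : cD (1 : R) (fun t => zet e (y t)) 0 = dzet e (y 0) Y.
Proof.
have sa := sm_a oA sy yU; have seta := csm_eta oA sy.
have s1 : csm A (fun t => 'i%C * eta e (y t)) by apply: csmM => //; exact: csm_cst.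
rewrite (cDM _ oA s1 (csm_rc oA sa) A0) (cDZ _ _ oA seta A0) cD_eta.
have sd : sm A (fun t => 1 + e * y t 0 0) by solve_sm.
have -> : cD (1 : R) (fun t => ((1 + e * y t 0 0)^-1)%:C) 0 =
    - (e * Y 0 0 / (1 + e * y 0 0 0) ^+ 2)%:C.
  apply: eqc; rewrite /= /dvs /=; last by rewrite derive_cst oppr0.
  rewrite deriveV; [|exact: Ue_neq0 (yU A0)|exact: sm_derivable sd A0].
  rewrite deriveD; [|exact: derivable_cst|].
    rewrite derive_cst add0r ey_ /GRing.scale /= mulNr; congr (- _).
    by rewrite mulrC.
  have se : sm A (fun t => e * y t 0 0) by solve_sm.
  exact: sm_derivable se A0.
by rewrite /dzet; ring.
Qed.

Lemma derive_pp : 'D_1 (fun t => pp (x t) (y t)) (0 : R) =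
  (X 0 0, e * X 0 1, Re (dzet e (y 0) Y), Im (dzet e (y 0) Y)).
Proof.
have [z1 z2] := csm_zet oA sy yU.
have d1 : differentiable (fun t => x t 0 0) (0 : R) by apply: sm_differentiable A0; solve_sm.
have d2 : differentiable (fun t => e * x t 0 1) (0 : R) by apply: sm_differentiable A0; solve_sm.
have d3 := sm_differentiable z1 A0; have d4 := sm_differentiable z2 A0.
rewrite (derive_pair _ (differentiable_pair (differentiable_pair d1 d2) d3) d4).
rewrite (derive_pair _ (differentiable_pair d1 d2) d3) (derive_pair _ d1 d2) x_ ex_.
by rewrite -cD_zet.
Qed.

(** Doubling expresses real and imaginary parts through conjugates. Holomorphy in zeta merges the
    two derivatives in zeta into one complex multiple of [dzet]. *)
Lemma cD_pp (k : P -> C) : csm (@UP R) k -> (forall p, UP p -> cD eZ2 k p = 'i%C * cD eZ1 k p) ->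
  2 * cD (1 : R) (fun t => k (pp (x t) (y t))) 0 =
  let p := pp (x 0) (y 0) in
  (zz e X + (zz e X)^*%C) * cD eX1 k p - 'i%C * (zz e X - (zz e X)^*%C) * cD eX2 k p
  + 2 * dzet e (y 0) Y * cD eZ1 k p.
Proof.
move=> sk kZ; have Up : UP (pp (x 0) (y 0)) by apply: UP_pp; exact: yU.
rewrite (cD_chain _ (sm_pp oA sx sy yU) sk A0 Up) derive_pp /=.
set p := pp _ _ in Up *; set a := X 0 0; set b := e * X 0 1; set z := dzet _ _ _.
have -> : (a, b, Re z, Im z) = 1 *: (a *: eX1 + b *: eX2) + 1 *: (Re z *: eZ1 + Im z *: eZ2) :> P.
  exact: dir_basis.
have lin u v (c d : R) : cD (c *: u + d *: v) k p = c%:C * cD u k p + d%:C * cD v k p.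
  exact: cD_lin sk Up.
rewrite lin (lin eX1) (lin eZ1) (kZ _ Up).
move: (cD eX1 k p) (cD eX2 k p) (cD eZ1 k p) => K1 K2 K3.
have h1 : zz e X + (zz e X)^*%C = 2 * a%:C by rewrite -(Re2_conj (zz e X)).
have h2 : 'i%C * (zz e X - (zz e X)^*%C) = - (2 * b%:C).
  by rewrite -[b]/(Im (zz e X)) (Im2_conj (zz e X)); ring.
have h3 : 2 * z = 2 * (Re z)%:C + 2 * 'i%C * (Im z)%:C.
  by move: z => w; apply: eqc; rewrite ?(ReMc, ImMc, ReDc, ImDc) /= ?(ReMc, ImMc) /=; ring.
rewrite h1 h2 h3; move: (Re z) (Im z) a b {h1 h2 h3} => z1 z2 a b; ring.
Qed.

End Derivatives.

End Coordinates.

Section HolomorphicCoordinates.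
Context {R : realType}.
Notation C := R[i].
Notation Re := complex.Re.
Notation Im := complex.Im.
Notation P := (R * R * R * R)%type.
Implicit Types (V : normedModType R).

Lemma cDN V (U : set V) (F : V -> C) v x : open U -> csm U F -> U x ->
  cD v (fun t => - F t) x = - cD v F x.
Proof.
move=> oU sF Ux; have -> : (fun t => - F t) = (fun t => -1 * F t).
  by apply/funext => t; rewrite mulN1r.
by rewrite (cDZ _ _ oU sF Ux) mulN1r.
Qed.

Lemma conjcD (a b : C) : (a + b)^*%C = a^*%C + b^*%C.
Proof. by apply: eqc; case: a b => ? ? [? ?] /=; ring. Qed.

Lemma conjcM (a b : C) : (a * b)^*%C = a^*%C * b^*%C.
Proof. by apply: eqc; case: a b => ? ? [? ?] /=; ring. Qed.

Lemma conjcN (a : C) : (- a)^*%C = - a^*%C.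
Proof. by apply: eqc; case: a => ? ? /=; ring. Qed.

Lemma conjci : ('i%C : C)^*%C = - 'i%C.
Proof. by apply: eqc => /=; ring. Qed.

(* Inverse of u |-> u + z conj(u) for |z| < 1. *)
Definition zinv (z u : C) : C := (u - z * u^*%C) * ((1 - norm2 z)^-1)%:C.

Lemma zinvK (z u : C) : norm2 z < 1 -> zinv z (u + z * u^*%C) = u.
Proof.
rewrite -subr_gt0 => /lt0r_neq0; rewrite /zinv; case: z u => a b [c d] h.
by apply: eqc; rewrite ?(ReMc, ImMc, ReDc, ImDc) /= ?(ReMc, ImMc) /=; rewrite /norm2 /= in h *; field.
Qed.

Lemma zinvKV (z u : C) : norm2 z < 1 -> zinv z u + z * (zinv z u)^*%C = u.
Proof.
rewrite -subr_gt0 => /lt0r_neq0; rewrite /zinv; case: z u => a b [c d] h.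
by apply: eqc; rewrite ?(ReMc, ImMc, ReDc, ImDc) /= ?(ReMc, ImMc) /=; rewrite /norm2 /= in h *; field.
Qed.

Lemma norm2N (z : C) : norm2 (- z) = norm2 z.
Proof. by case: z => a b; rewrite /norm2 /=; ring. Qed.

Lemma csm_zinv V (U : set V) (z u : V -> C) : open U -> csm U z -> csm U u ->
  (forall x, U x -> norm2 (z x) < 1) -> csm U (fun x => zinv (z x) (u x)).
Proof.
move=> oU sz su z1; apply: csmM => //.
  by apply: csmB => //; apply: csmM => //; exact: csm_conj.
have [z2 z3] := sz; apply: csm_rc => //; apply: smV => //; last by rewrite /norm2; solve_sm.
by move=> x /z1; rewrite -subr_gt0 => /lt0r_neq0.
Qed.

Definition cpair (z : C) : (R * R)%type := (Re z, Im z).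
Definition cof (a : (R * R)%type) : C := a.1 +i* a.2.

Lemma cpairK z : cof (cpair z) = z. Proof. by case: z. Qed.
Lemma cofK a : cpair (cof a) = a. Proof. by case: a. Qed.

Section Sheet.
Variables (e : R) (k : P -> C).
Hypothesis He : e = 1 \/ e = -1.
Hypothesis sk : csm (@UP R) k.

Definition uF (x : 'rV[R]_4) (y : 'rV[R]_3) : C := zz e x + zet e y * (zz e x)^*%C.
Definition vF (x : 'rV[R]_4) (y : 'rV[R]_3) : C :=
  ww e x + - zet e y * (ww e x)^*%C - 2 * zet e y * k (pp e x y).

Definition Fe (q : 'rV[R]_4 * 'rV[R]_3) : ((R * R) * (R * R)) * 'rV[R]_3 :=
  (cpair (uF q.1 q.2), cpair (vF q.1 q.2), q.2).

(** The inversion is triangular: zeta is read off y, then z is recovered from u, after which k(z,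
    zeta) is known and v can be solved for W, with - zeta in place of zeta. *)
Definition zG (q : ((R * R) * (R * R)) * 'rV[R]_3) : C := zinv (zet e q.2) (cof q.1.1).
Definition pG q : P := (Re (zG q), Im (zG q), Re (zet e q.2), Im (zet e q.2)).
Definition wG q : C := zinv (- zet e q.2) (cof q.1.2 + 2 * zet e q.2 * k (pG q)).
Definition Ge q : 'rV[R]_4 * 'rV[R]_3 :=
  (lrow 4 [:: Re (zG q); e * Im (zG q); Re (wG q); e * Im (wG q)], q.2).

Lemma norm2_zet y : Ue e y -> norm2 (zet e y) < 1.
Proof. by move=> /(UP_pp 0); rewrite /UP /= zeta_pp. Qed.

Lemma ppE x y : pp e x y = (Re (zz e x), Im (zz e x), Re (zet e y), Im (zet e y)).
Proof. by []. Qed.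

Lemma lrow_zw x : x = lrow 4 [:: Re (zz e x); e * Im (zz e x); Re (ww e x); e * Im (ww e x)].
Proof.
by apply/rowP; apply: all4; rewrite !mxE //=; case: He => ->; ring.
Qed.

Lemma zz_lrow (z w : C) : zz e (lrow 4 [:: Re z; e * Im z; Re w; e * Im w]) = z.
Proof. by apply: eqc; rewrite /= !mxE //=; case: He => ->; ring. Qed.

Lemma ww_lrow (z w : C) : ww e (lrow 4 [:: Re z; e * Im z; Re w; e * Im w]) = w.
Proof. by apply: eqc; rewrite /= !mxE //=; case: He => ->; ring. Qed.

Lemma FeK q : Ue e q.2 -> Ge (Fe q) = q.
Proof.
case: q => x y /= Uy; have n1 := norm2_zet Uy.
have zE : zG (Fe (x, y)) = zz e x by rewrite /zG /= cpairK zinvK.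
have pE : pG (Fe (x, y)) = pp e x y by rewrite /pG zE.
have wE : wG (Fe (x, y)) = ww e x.
  by rewrite /wG pE /= cpairK /vF subrK zinvK // norm2N.
by rewrite /Ge zE wE -lrow_zw.
Qed.

Lemma GeK q : Ue e q.2 -> Fe (Ge q) = q.
Proof.
case: q => [[u v] y] /= Uy; have n1 := norm2_zet Uy.
pose x := (Ge (u, v, y)).1; rewrite -[Fe _]/(cpair (uF x y), cpair (vF x y), y).
have zE : zz e x = zG (u, v, y) by exact: zz_lrow.
have wE : ww e x = wG (u, v, y) by exact: ww_lrow.
have pE : pp e x y = pG (u, v, y) by rewrite ppE zE.
rewrite /uF /vF zE wE pE (zinvKV _ n1) cofK /wG zinvKV ?norm2N //.
by rewrite addrK cofK.
Qed.

Lemma csm_uF V (U : set V) (F : V -> 'rV[R]_4) (G : V -> 'rV[R]_3) : open U -> sm U F -> sm U G ->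
  (forall t, U t -> Ue e (G t)) -> csm U (fun t => uF (F t) (G t)).
Proof.
move=> oU sF sG UG; apply: csmD => //; first exact: csm_zz.
by apply: csmM => //; [exact: csm_zet|exact (csm_conj oU (csm_zz e oU sF))].
Qed.

Lemma csm_vF V (U : set V) (F : V -> 'rV[R]_4) (G : V -> 'rV[R]_3) : open U -> sm U F -> sm U G ->
  (forall t, U t -> Ue e (G t)) -> csm U (fun t => vF (F t) (G t)).
Proof.
move=> oU sF sG UG; have sz := csm_zet oU sG UG; have sw := csm_ww e oU sF.
have sp : csm U (fun t => k (pp e (F t) (G t))).
  apply: (csm_comp (@findim_P R) oU (@open_UP R) _ (sm_pp oU sF sG UG) sk) => t Ut.
  by apply: UP_pp; exact: UG.
apply: csmB => //.
  by apply: csmD => //; apply: csmM => //; [exact: csmN|exact (csm_conj oU sw)].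
by apply: csmM => //; apply: csmM => //; exact: csm_cst.
Qed.

Lemma sm_cpair V (U : set V) (F : V -> C) : open U -> csm U F -> sm U (fun t => cpair (F t)).
Proof. by move=> oU [s1 s2]; exact: sm_pair. Qed.

Lemma csm_cof V (U : set V) (F : V -> R * R) : open U -> sm U F -> csm U (fun t => cof (F t)).
Proof. by move=> oU sF; apply: csm_pair; solve_sm. Qed.

Lemma sm_Fe : sm [set q | Ue e q.2] Fe.
Proof.
have oU : open [set q : 'rV[R]_4 * 'rV[R]_3 | Ue e q.2].
  by apply: (@open_comp _ _ snd) => [q _|]; [exact: cvg_snd|exact: open_Ue].
have si := sm_id oU; have s1 := sm_fst oU si; have s2 := sm_snd oU si.
apply: sm_pair => //; apply: sm_pair => //; apply: sm_cpair => //.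
  exact: csm_uF.
exact: csm_vF.
Qed.

Lemma sm_Ge : sm [set q | Ue e q.2] Ge.
Proof.
have oU : open [set q : ((R * R) * (R * R)) * 'rV[R]_3 | Ue e q.2].
  by apply: (@open_comp _ _ snd) => [q _|]; [exact: cvg_snd|exact: open_Ue].
set U := [set q | _] in oU *.
have si := sm_id oU; have s1 := sm_fst oU si; have s2 := sm_snd oU si.
have s11 := sm_fst oU s1; have s12 := sm_snd oU s1.
have UG (q : ((R * R) * (R * R)) * 'rV[R]_3) : U q -> Ue e q.2 by [].
have sz : csm U (fun q => zet e q.2) by exact: csm_zet.
have szG : csm U zG.
  by apply: csm_zinv => //; [exact: csm_cof|move=> q /UG/norm2_zet].
have [r1 r2] := szG; have [r3 r4] := sz.
have spG : sm U pG by rewrite /pG; solve_sm.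
have skG : csm U (fun q => k (pG q)).
  apply: (csm_comp (@findim_P R) oU (@open_UP R) _ spG sk) => q /UG/norm2_zet.
  have E : zeta (pG q) = zet e q.2 by exact: eqc.
  by rewrite /UP /= E.
have swG : csm U wG.
  apply: csm_zinv => //; [exact: csmN| |by move=> q /UG/norm2_zet; rewrite norm2N].
  apply: csmD => //; first exact: csm_cof.
  by apply: csmM => //; apply: csmM => //; exact: csm_cst.
have [r5 r6] := swG.
apply: sm_pair => //.
apply: (@sm_lrow _ _ _ 4 [:: fun q => Re (zG q); fun q => e * Im (zG q); fun q => Re (wG q);
  fun q => e * Im (wG q)]) => //.
by move=> [|[|[|[|//]]]] _ /=; solve_sm.
Qed.

Definition du (x X : 'rV[R]_4) (y Y : 'rV[R]_3) : C :=
  zz e X + (zet e y * (zz e X)^*%C + (zz e x)^*%C * dzet e y Y).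

Definition dv (x X : 'rV[R]_4) (y Y : 'rV[R]_3) : C :=
  ww e X + (- zet e y * (ww e X)^*%C + (ww e x)^*%C * - dzet e y Y)
  - (zet e y * ((zz e X + (zz e X)^*%C) * cD eX1 k (pp e x y)
       - 'i%C * (zz e X - (zz e X)^*%C) * cD eX2 k (pp e x y)
       + 2 * dzet e y Y * cD eZ1 k (pp e x y)) + k (pp e x y) * (2 * dzet e y Y)).

Hypothesis kZ : forall p, UP p -> cD eZ2 k p = 'i%C * cD eZ1 k p.

Lemma derive_Fe (A : set R) (c : R -> 'rV[R]_4 * 'rV[R]_3) : open A -> A 0 -> sm A c ->
  (forall t, A t -> Ue e (c t).2) ->
  'D_1 (fun t => Fe (c t)) (0 : R) =
  (cpair (du (c 0).1 ('D_1 c 0).1 (c 0).2 ('D_1 c 0).2),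
   cpair (dv (c 0).1 ('D_1 c 0).1 (c 0).2 ('D_1 c 0).2), ('D_1 c 0).2).
Proof.
move=> oA A0 sc UA.
have sx := sm_fst oA sc; have sy := sm_snd oA sc.
have dc := sm_differentiable sc A0.
rewrite (derive_fst _ dc) (derive_snd _ dc).
set x := fun t => (c t).1 in sx *; set y := fun t => (c t).2 in sy *.
have su := csm_uF oA sx sy UA; have sv := csm_vF oA sx sy UA.
have cp (u : R -> C) : csm A u -> 'D_1 (fun t => cpair (u t)) (0 : R) = cpair (cD (1 : R) u 0).
  move=> [u1 u2].
  by rewrite (derive_pair _ (sm_differentiable u1 A0) (sm_differentiable u2 A0)).
have d1 := sm_differentiable (sm_cpair oA su) A0; have d2 := sm_differentiable (sm_cpair oA sv) A0.
rewrite (derive_pair _ (differentiable_pair d1 d2) (sm_differentiable sy A0)).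
rewrite (derive_pair _ d1 d2) (cp _ su) (cp _ sv); congr (cpair _, cpair _, _).
  have sz := csm_zz e oA sx; have szz : csm A (fun t => (zz e (x t))^*%C) by exact (csm_conj oA sz).
  have szt := csm_zet oA sy UA.
  rewrite /uF (cDD _ sz (csmM oA szt szz) A0) (cDM _ oA szt szz A0) (cD_conj _ sz A0).
  by rewrite (cD_zz e oA A0 sx) (cD_zet oA A0 sy UA).
have sw := csm_ww e oA sx; have sww : csm A (fun t => (ww e (x t))^*%C) by exact (csm_conj oA sw).
 have szt := csm_zet oA sy UA.
have sp : csm A (fun t => k (pp e (x t) (y t))).
  apply: (csm_comp (@findim_P R) oA (@open_UP R) _ (sm_pp oA sx sy UA) sk) => t At.
  by apply: UP_pp; exact: UA.
have s2 : csm A (fun t => 2 * zet e (y t)) by apply: csmM => //; exact: csm_cst.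
have sN := csmN oA szt; have sNw := csmM oA sN sww; have s2k := csmM oA s2 sp.
rewrite /vF (cDD _ (csmD oA sw sNw) (csmN oA s2k) A0) (cDN _ oA s2k A0).
rewrite (cDD _ sw sNw A0) (cDM _ oA sN sww A0) (cDM _ oA s2 sp A0) (cDN _ oA szt A0).
rewrite (cDZ _ _ oA szt A0) (cD_conj _ sw A0) (cD_ww e oA A0 sx) (cD_zet oA A0 sy UA).
have H := cD_pp oA A0 sx sy UA sk kZ.
set D := cD _ _ _ in H *.
have -> : 2 * zet e (y 0) * D = zet e (y 0) * (2 * D) by ring.
rewrite H; exact: erefl.
Qed.

Section Hyperboloid.
Variables (a : R) (y : 'rV[R]_3).
Hypotheses (Hy : hyperboloid y) (ey : 0 < e * y 0 0).
Let b : C := (e * y 0 0)%:C.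
Let z := zet e y.

Let bJ : (1 + b)^*%C = 1 + b.
Proof. by rewrite conjcD conjc1 conjc_real. Qed.

Let zz_K X : zz e (Ksig a y X) = 'i%C * b * zz e X + 'i%C * z * (1 + b) * (zz e X)^*%C.
Proof. by rewrite zz_Ksig // (eta_zet ey) -/b -/z; ring. Qed.

Let ww_K X : ww e (Ksig a y X) =
  'i%C * b * ww e X - 'i%C * z * (1 + b) * ((ww e X)^*%C + a%:C * (zz e X)^*%C).
Proof. by rewrite ww_Ksig // (eta_zet ey) -/b -/z; ring. Qed.

Let zz_KJ X : (zz e (Ksig a y X))^*%C =
  - ('i%C * b * (zz e X)^*%C) - 'i%C * z^*%C * (1 + b) * zz e X.
Proof.
rewrite zz_K conjcD !conjcM conjci conjc_real conjcK bJ; ring.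
Qed.

Let ww_KJ X : (ww e (Ksig a y X))^*%C =
  - ('i%C * b * (ww e X)^*%C) + 'i%C * z^*%C * (1 + b) * (ww e X + a%:C * zz e X).
Proof.
rewrite ww_K conjcD conjcN !conjcM conjcD conjcM conjci !conjc_real !conjcK bJ; ring.
Qed.

Lemma du_J x X Y : qform y Y = 0 -> du x (Ksig a y X) y (cross3 y Y) = 'i%C * du x X y Y.
Proof.
move=> yY; rewrite /du (dzet_cross He Hy ey yY) zz_KJ zz_K -/z.
have H := zet_norm He Hy ey; rewrite -/z -/b in H.
have U := alg_u 'i%C (zz e X) (zz e X)^*%C H.
by rewrite addrA U; ring.
Qed.

(** The terms of [dv] containing [dzet] are multiplied by i thanks to [dzet_cross]; the remaining
    ones are the expression treated in [alg_v]. *)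
Lemma dv_J x X Y : qform y Y = 0 ->
  (1 - zeta (pp e x y)) * cD eX1 k (pp e x y) +
    'i%C * (1 + zeta (pp e x y)) * cD eX2 k (pp e x y) = a%:C ->
  dv x (Ksig a y X) y (cross3 y Y) = 'i%C * dv x X y Y.
Proof.
move=> yY; rewrite zeta_pp -/z => PDE.
have H := zet_norm He Hy ey; rewrite -/z -/b in H.
have := alg_v (zz e X) (zz e X)^*%C (ww e X) (ww e X)^*%C H PDE.
rewrite /dv (dzet_cross He Hy ey yY) zz_KJ zz_K ww_KJ ww_K -/z.
move: (cD eX1 k _) (cD eX2 k _) (cD eZ1 k _) (k _) (dzet e y Y) (ww e x) => K1 K2 K3 k0 d w.
move: (zz e X) (ww e X) => Z W /= E.
set E1 := (X in X = _) in E; set E2 := ('i%C * _) in E.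
transitivity (E1 - 'i%C * (w^*%C * d + 2 * z * d * K3 + 2 * k0 * d)).
  by rewrite /E1; ring.
by rewrite E /E2; ring.
Qed.

End Hyperboloid.

End Sheet.

End HolomorphicCoordinates.

(** * Gluing the two sheets *)

Section Biholomorphism.
Context {R : realType}.
Notation C := R[i].
Notation Re := complex.Re.
Notation Im := complex.Im.
Notation P := (R * R * R * R)%type.
Variable f : 'rV[R]_4 -> R.
Hypothesis sf : sm setT f.
Hypothesis f_dep : forall x x' : 'rV[R]_4, x 0 0 = x' 0 0 -> x 0 1 = x' 0 1 -> f x = f x'.

Definition sheet (y : 'rV[R]_3) : R := if 0 < y 0 0 then 1 else -1.

Lemma sheet1 y : sheet y = 1 \/ sheet y = -1.
Proof. by rewrite /sheet; case: ifP => _; [left|right]. Qed.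

Lemma sheet_gt0 y : hyperboloid y -> 0 < sheet y * y 0 0.
Proof.
rewrite /hyperboloid /sheet /= => H; case: ifPn => [|]; first by rewrite mul1r.
rewrite -leNgt mulN1r oppr_gt0 lt_neqAle => ->; rewrite andbT; apply/eqP => y0.
by move: H; rewrite y0 expr0n sub0r; have := sqr_ge0 (y 0 1); have := sqr_ge0 (y 0 2); lra.
Qed.

Lemma sheet_Ue e y : e = 1 \/ e = -1 -> Ue e y -> sheet y = e.
Proof.
move=> He [/= + _]; case: He => ->; rewrite /sheet; first by rewrite mul1r => ->.
by rewrite mulN1r oppr_gt0 => /ltW; rewrite leNgt => /negPf ->.
Qed.

Lemma Ue_sheet' y : hyperboloid y -> Ue (sheet y) y.
Proof. by move=> Hy; apply: Ue_sheet => //; [exact: sheet1|exact: sheet_gt0]. Qed.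

Lemma cpair_i (z : C) : cpair ('i%C * z) = imul (cpair z).
Proof. by rewrite /cpair /imul !(ReMc, ImMc) /=; congr pair; ring. Qed.

Lemma curve_orth (y : R -> 'rV[R]_3) : curve_in (@hyperboloid R) y ->
  qform (y 0) ('D_1 y 0) = 0.
Proof.
move=> [sy Hy].
have sy_ i : sm setT (fun t => y t 0 i) by apply: sm_entry => //; exact: openT.
have dy_ i : 'D_1 (fun t => y t 0 i) 0 = 'D_1 y 0 0 i.
  by rewrite derive_entry //; exact: sm_differentiable sy _.
have dd (F : R -> R) : sm setT F -> derivable F 0 1 by move=> sF; exact: sm_derivable sF _.
have oR : open [set: R] by exact: openT.
have E : (fun t => y t 0 0 * y t 0 0 - y t 0 1 * y t 0 1 - y t 0 2 * y t 0 2) = cst 1.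
  by apply/funext => t; rewrite -!expr2; exact: Hy.
have : 'D_1 (fun t => y t 0 0 * y t 0 0 - y t 0 1 * y t 0 1 - y t 0 2 * y t 0 2) (0 : R) = 0.
  by rewrite E derive_cst.
rewrite !deriveB ?deriveM; try (by apply: dd; solve_sm).
rewrite !dy_ /qform /GRing.scale /= => H; lra.
Qed.

(** On the sheet y_1 < 0 the coordinate z is conjugated, so the right-hand side of the equation is f
    reflected in x_2. The last two entries of the row default to 0, which [f_dep] allows. *)
Definition fsheet (e : R) (a : R * R) : R := f (lrow 4 [:: a.1; e * a.2]).

Lemma sm_fsheet e : sm setT (fsheet e).
Proof.
have oT : open [set: (R * R)%type] by exact: openT.
have si := sm_id oT.
apply: (sm_comp (findim_mx 1 4) oT openT _ _ sf) => //.
apply: (@sm_lrow _ _ _ 4 [:: fst; fun a => e * a.2]) => //.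
by move=> [|[|//]] _ /=; solve_sm.
Qed.

Lemma open_snd (V W : normedModType R) (U : set W) : open U -> open [set q : V * W | U q.2].
Proof. by move=> oU; apply: (@open_comp _ _ snd) => // q _; exact: cvg_snd. Qed.

Lemma R4H_C2xH : biholomorphic (@R4H R) (JR4H f) (@C2xH R) (@JC2xH R).
Proof.
have /choice[k Hk] : forall e : R, exists k : P -> C, csm (@UP R) k /\ forall p, UP p ->
    (1 - zeta p) * cD eX1 k p + 'i%C * (1 + zeta p) * cD eX2 k p = (fsheet e p.1.1)%:C /\
    cD eZ2 k p = 'i%C * cD eZ1 k p.
  by move=> e; have [k sk Dk] := dbar_solution (sm_fsheet e); exists k.
have sk e : csm (@UP R) (k e) by have [] := Hk e.
have kZ e p : UP p -> cD eZ2 (k e) p = 'i%C * cD eZ1 (k e) p.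
  by move=> Up; have [_ /(_ _ Up)[]] := Hk e.
have kX e x y : e = 1 \/ e = -1 -> Ue e y ->
    (1 - zeta (pp e x y)) * cD eX1 (k e) (pp e x y) +
    'i%C * (1 + zeta (pp e x y)) * cD eX2 (k e) (pp e x y) = (f x)%:C.
  move=> He Uy; have [_ /(_ _ (UP_pp x Uy))[-> _]] := Hk e.
  congr (_%:C); apply: f_dep; rewrite !mxE //=; case: He => ->; ring.
(* Each sheet has its own k; the sets [Ue 1] and [Ue (-1)] are open and disjoint, so the choice is
   locally constant and smoothness is unaffected. *)
pose F q := Fe (sheet q.2) (k (sheet q.2)) q.
pose G q := Ge (sheet q.2) (k (sheet q.2)) q.
have fV : findim ('rV[R]_4 * 'rV[R]_3)%type by apply: findim_prod; exact: findim_mx.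
have fW : findim (((R * R) * (R * R)) * 'rV[R]_3)%type.
  by apply: findim_prod; [do 2 apply: findim_prod; exact: findim_R|exact: findim_mx].
have oU e : open (@Ue R e) by exact: open_Ue.
have sF : smooth_map (@R4H R) F.
  apply/smooth_mapP => q Hq; set e := sheet q.2.
  exists [set q | Ue e q.2], (Fe e (k e)); split; [exact: open_snd|exact: Ue_sheet'|exact: sm_Fe|].
  by move=> r Ur _; rewrite /F (sheet_Ue _ Ur) //; exact: sheet1.
have sG : smooth_map (@C2xH R) G.
  apply/smooth_mapP => q Hq; set e := sheet q.2.
  exists [set q | Ue e q.2], (Ge e (k e)); split; [exact: open_snd|exact: Ue_sheet'|exact: sm_Ge|].
  by move=> r Ur _; rewrite /G (sheet_Ue _ Ur) //; exact: sheet1.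
apply: (@biholomorphicI _ _ _ _ _ _ _ F G) => //; first last.
- by move=> q Hq; rewrite /F /G /=; apply: GeK; [exact: sheet1|exact: Ue_sheet'].
- by move=> q Hq; rewrite /F /G /=; apply: FeK; [exact: sheet1|exact: Ue_sheet'].
split=> //.
move=> q v w Hq /tangent_mapP[c [sc Sc] [c0 dc dF]].
set e := sheet q.2; have He : e = 1 \/ e = -1 by exact: sheet1.
have ey : 0 < e * q.2 0 0 by exact: sheet_gt0.
have DF (a : R -> 'rV[R]_4 * 'rV[R]_3) : curve_in (@R4H R) a -> a 0 = q ->
    'D_1 (fun t => F (a t)) (0 : R) =
    (cpair (du e q.1 ('D_1 a 0).1 q.2 ('D_1 a 0).2),
     cpair (dv e (k e) q.1 ('D_1 a 0).1 q.2 ('D_1 a 0).2), ('D_1 a 0).2).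
  (* Near time 0 the curve stays over the sheet of [q], and [F] can be replaced by the formula with
     fixed [e]. *)
  move=> [sa Sa] a0; pose A := a @^-1` [set q | Ue e q.2].
  have oA : open A by apply: open_curve => //; exact: open_snd.
  have A0 : A 0 by rewrite /A /= a0; exact: Ue_sheet'.
  have E : 'D_1 (fun t => F (a t)) (0 : R) = 'D_1 (fun t => Fe e (k e) (a t)) (0 : R).
    apply: near_eq_derive; apply: (open_near oA A0) => t At.
    by rewrite /F (sheet_Ue He At).
  have sA : sm A a by exact: sm_subset sa.
  rewrite E (derive_Fe (sk e) (kZ e) oA A0 sA (fun t At => At)).
  by rewrite a0.
have orth : qform q.2 v.2 = 0.
  rewrite -c0 -dc (derive_snd _ (sm_differentiable sc I)); apply: curve_orth.
  by split; [apply: sm_snd => //; exact: openT|exact: Sc].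
have dw := DF _ (conj sc Sc) c0; rewrite dF dc in dw.
have [a [sa Sa] [a0 da]] := R4H_arc q.1 (Ksig (f q.1) q.2 v.1) Hq (qform_cross q.2 v.2).
rewrite -surjective_pairing in a0.
apply/tangent_mapP; exists a => //; split=> //.
rewrite DF // da /=.
rewrite (du_J He _ Hq ey _ _ orth) (dv_J He Hq ey _ orth (kX _ _ _ He (Ue_sheet' Hq))).
by rewrite dw /JC2xH /= !cpair_i.
Qed.

End Biholomorphism.

Theorem theorem4 (R : realType) (f : 'rV[R]_4 -> R)
    (f_smooth : smooth_on [set: 'rV[R]_4] f)
    (f_pos : forall x, 0 < f x)
    (f_dep : forall x y : 'rV[R]_4,
      x 0 0 = y 0 0 -> x 0 1 = y 0 1 -> f x = f y) :
  biholomorphic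
    (twistor_space (neutral_metric f)) (J1 (neutral_metric f) (neutral_frame f))
    (@C2xH R) (@JC2xH R).
Proof.
have sf : sm setT f by exact/smooth_onP.
apply: (biholomorphic_trans _ _ _ (twistor_R4H sf f_dep f_pos) (R4H_C2xH sf f_dep)).
- by apply: findim_prod; exact: findim_mx.
- by apply: findim_prod; exact: findim_mx.
- by apply: findim_prod; [do 2 apply: findim_prod; exact: findim_R|exact: findim_mx].
Qed.
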